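(* Fix $\theta\in\mathcal{O}^-_0$ and $\mu_0\in\mathbf{T}$ with $e^{-i\mu_0}\in\sigma_p(U_{np})$. For sufficiently small $\epsilon>0$ and $s\in(0,1/2]$, we have $$\left\|\widetilde{P}_\epsilon(\mu_0)\right\|_{\mathbf{B}(\mathcal{H})}=O(\epsilon^s),$$ where $$\widetilde{P}_\epsilon(\mu_0)=\frac{1}{2\pi}\oint_{\mathcal{L}_{\epsilon,s}(\mu_0)}e^{-i\kappa}R_\epsilon(\kappa,\theta)\,d\kappa-\frac{1}{2\pi}\oint_{\mathcal{L}_{\epsilon,s}(\mu_0)}e^{-i\kappa}R_{np}(\kappa,\theta)\,d\kappa .$$
   Context: Notation. $\mathcal{H}=\ell^2(\mathbf{Z}^2;\mathbf{C}^4)$, $u(x)=[u_\leftarrow(x),u_\rightarrow(x),u_\downarrow(x),u_\uparrow(x)]^{\mathsf T}$; $\mathbf{B}(\mathcal{H})$ is the space of bounded operators. $e_1=[1,0]^{\mathsf T}$, $e_2=[0,1]^{\mathsf T}$. $\mathbf{T}=\mathbf{R}/2\pi\mathbf{Z}$, $\mathbf{T}_{\mathbf{C}}=\mathbf{C}/2\pi\mathbf{Z}$, $\mathcal{O}^-_0=\{\kappa\in\mathbf{T}_{\mathbf{C}} : \mathrm{Im}\,\kappa<0\}$. $\sigma_p(A)$ is the set of eigenvalues of $A$. The shift is $(Su)(x)=[u_\leftarrow(x+e_1),u_\rightarrow(x-e_1),u_\downarrow(x+e_2),u_\uparrow(x-e_2)]^{\mathsf T}$. A quantum walk is $U=SC$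 on $\mathcal{H}$, with $C$ multiplication by $C(x)\in\mathrm{U}(4)$. Fix a positive integer $M_0$ and let $\Omega^i=\{x\in\mathbf{Z}^2 : |x_1|\le M_0,\ |x_2|\le M_0\}$. All quantum walks here satisfy $C(x)=I_4$ for $x\in\mathbf{Z}^2\setminus\Omega^i$, so $V=U-S$ has finite rank. Complex translation: for $\theta\in\mathbf{T}_{\mathbf{C}}$, $T(\theta)$ is multiplication by $\mathrm{diag}[e^{i\theta x_1},e^{-i\theta x_1},e^{i\theta x_2},e^{-i\theta x_2}]$. For $\theta\in\mathcal{O}^-_0$, $U(\theta)=T(\theta)UT(\theta)^{-1}$ means the bounded operator $e^{-i\theta}S+T(\theta)VT(\theta)^{-1}$ on $\mathcal{H}$. Non-penetrable barrier. Let $K_1^\pm=\{x\in\Omega^i : x_1=\pm M_0\}$, $K_2^\pm=\{x\in\Omega^i : x_2=\pm M_0\}$, $K=K_1^+\cup K_1^-\cup K_2^+\cup K_2^-$. $U_{np}=SC_{np}$ is a quantum walk on $\mathcal{H}$, where $C_{np}$ is multiplication by $C_{np}(x)\in\mathrm{U}(4)$ with $C_{np}(x)=I_4$ for $x\in\mathbf{Z}^2\setminus\Omega^i$, satisfying, for all $u$, $(U_{np}u)_\rightarrow(x+e_1)=u_\leftarrow(x)$ for $x\in K_1^+$; $(U_{np}u)_\leftarrow(x-e_1)=u_\rightarrow(x)$ for $x\in K_1^-$; $(U_{np}u)_\uparrow(x+e_2)=u_\downarrow(x)$ for $x\in K_2^+$; $(U_{np}u)_\downarrow(x-e_2)=u_\uparrow(x)$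 for $x\in K_2^-$. Perturbation. For $\epsilon\in(0,1]$, $U_\epsilon=SC_\epsilon$ with $C_\epsilon(x)\in\mathrm{U}(4)$, $C_\epsilon(x)=C_{np}(x)$ for $x\in\mathbf{Z}^2\setminus K$, and $|C_\epsilon(x)-C_{np}(x)|_\infty<\epsilon$ for $x\in K$, where $|A|_\infty=\max_{j,k}|a_{j,k}|$. Put $R_\epsilon(\kappa,\theta)=(U_\epsilon(\theta)-e^{-i\kappa})^{-1}$ and $R_{np}(\kappa,\theta)=(U_{np}(\theta)-e^{-i\kappa})^{-1}$. Loop. For fixed constants $a,b>0$ and $s,\epsilon>0$, $\mathcal{L}_{\epsilon,s}(\mu_0)$ is the counterclockwise boundary of the rectangle with vertices $\mu_0\pm a\epsilon^s\pm ib\epsilon^s$; $\epsilon$ is taken so small that there is no $\mu\ne\mu_0$ inside the loop with $e^{-i\mu}\in\sigma_p(U_{np})$. The $O(\epsilon^s)$ is as $\epsilon\downarrow0$, with $\theta,\mu_0,s$ fixed. *)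

(* Defs.v *)
From Stdlib Require Import Reals ZArith List FinFun Lra Lia Psatz.
From Stdlib Require Import FunctionalExtensionality ProofIrrelevance ClassicalEpsilon.
From Coquelicot Require Import Coquelicot.
Open Scope R_scope.

Definition Cexp (z : C) : C := (exp (Re z) * cos (Im z), exp (Re z) * sin (Im z)).

(** [is_RInt] takes values in normed modules over [R_AbsRing], while the spaces
    below are complex, hence this restriction of scalars. *)

Section RestrictScalars.
Variable V : NormedModule C_AbsRing.

Definition restrict_scal (k : R) (x : V) : V := scal (RtoC k : C_AbsRing) x.

Lemma restrict_scal_assoc (x y : R_AbsRing) (u : V) :
  restrict_scal x (restrict_scal y u) = restrict_scal (mult x y) u.
Proof.
  unfold restrict_scal; rewrite scal_assoc; f_equal.
  change (Cmult (RtoC x) (RtoC y) = RtoC (Rmult x y)); now rewrite RtoC_mult.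
Qed.

Lemma restrict_scal_one (u : V) : restrict_scal (one : R_AbsRing) u = u.
Proof. exact (scal_one (V := V) u). Qed.

Lemma restrict_scal_distr_l (x : R_AbsRing) (u v : V) :
  restrict_scal x (plus u v) = plus (restrict_scal x u) (restrict_scal x v).
Proof. exact (scal_distr_l (V := V) _ u v). Qed.

Lemma restrict_scal_distr_r (x y : R_AbsRing) (u : V) :
  restrict_scal (plus x y) u = plus (restrict_scal x u) (restrict_scal y u).
Proof.
  unfold restrict_scal.
  etransitivity; [ | apply (scal_distr_r (V := V))]; apply (f_equal (fun c : C_AbsRing => scal c u)).
  change (RtoC (Rplus x y) = Cplus (RtoC x) (RtoC y)); now rewrite RtoC_plus.
Qed.

Definition restrict_ModuleSpace_mixin :=
  ModuleSpace.Mixin R_AbsRing (NormedModule.AbelianGroup C_AbsRing V) restrict_scal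
    restrict_scal_assoc restrict_scal_one restrict_scal_distr_l restrict_scal_distr_r.

Definition restrict_ModuleSpace : ModuleSpace R_AbsRing :=
  ModuleSpace.Pack R_AbsRing V
    (ModuleSpace.Class R_AbsRing V _ restrict_ModuleSpace_mixin) V.

Definition restrict_NormedModuleAux : NormedModuleAux R_AbsRing :=
  NormedModuleAux.Pack R_AbsRing V
    (NormedModuleAux.Class R_AbsRing V (ModuleSpace.class _ restrict_ModuleSpace)
       (UniformSpace.class (NormedModule.UniformSpace C_AbsRing V))) V.

Lemma restrict_norm_scal (l : R_AbsRing) (x : restrict_NormedModuleAux) :
  norm (scal l x : V) <= abs l * norm (x : V).
Proof.
  change (norm (scal (RtoC l : C_AbsRing) (x : V)) <= Rabs l * norm (x : V)).
  rewrite <- Cmod_R. apply (norm_scal (V := V)).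
Qed.

Definition restrict_NormedModule_mixin :=
  NormedModule.Mixin R_AbsRing restrict_NormedModuleAux
    (fun x => norm (x : V)) (@norm_factor _ V)
    (norm_triangle (V := V)) restrict_norm_scal
    (norm_compat1 (V := V)) (norm_compat2 (V := V)) (norm_eq_zero (V := V)).

Definition restrict_NormedModule : NormedModule R_AbsRing :=
  NormedModule.Pack R_AbsRing V
    (NormedModule.Class R_AbsRing V
       (NormedModuleAux.class _ restrict_NormedModuleAux)
       restrict_NormedModule_mixin) V.

End RestrictScalars.

(** Contour integrals are Riemann integrals converging in the norm of [V]. *)

Section Contour.
Variable V : NormedModule C_AbsRing.

Definition is_segment_int (F : C -> V) (p q : C) (I : V) : Prop :=
  is_RInt (V := restrict_NormedModule V)
    (fun t : R => scal (Cminus q p : C_AbsRing) (F (Cplus p (Cmult (RtoC t) (Cminus q p)))))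
    0 1 I.

(** Counterclockwise boundary of [x0 - h, x0 + h] x [-k, k]. *)
Definition is_rect_int (F : C -> V) (x0 h k : R) (I : V) : Prop :=
  exists I1 I2 I3 I4 : V,
    is_segment_int F (x0 - h, - k) (x0 + h, - k) I1 /\
    is_segment_int F (x0 + h, - k) (x0 + h, k) I2 /\
    is_segment_int F (x0 + h, k) (x0 - h, k) I3 /\
    is_segment_int F (x0 - h, k) (x0 - h, - k) I4 /\
    I = plus (plus (plus I1 I2) I3) I4.

End Contour.

Arguments is_segment_int {V} F p q I.
Arguments is_rect_int {V} F x0 h k I.

Definition inside_rect (x0 h k : R) (z : C) : Prop :=
  Rabs (Re z - x0) < h /\ Rabs (Im z) < k.

Definition on_rect (x0 h k : R) (z : C) : Prop :=
  (Rabs (Re z - x0) = h /\ Rabs (Im z) <= k) \/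
  (Rabs (Re z - x0) <= h /\ Rabs (Im z) = k).

Section BoundedOperators.
Variable V : NormedModule C_AbsRing.

Record bounded_op := mk_bop { bop_fun :> V -> V; bop_linear : is_linear bop_fun }.

Lemma bop_ext (A B : bounded_op) : (forall u, A u = B u) -> A = B.
Proof.
  destruct A as [f Hf], B as [g Hg]; simpl; intros H.
  assert (E : f = g) by (now apply functional_extensionality).
  subst g; f_equal; apply proof_irrelevance.
Qed.

Lemma bop_plus_linear (A B : bounded_op) : is_linear (fun u : V => plus (A u) (B u)).
Proof.
  apply (is_linear_comp (fun u : V => (A u, B u))
           (fun p : prod_NormedModule _ V V => plus (fst p) (snd p))).
  - apply is_linear_prod; apply bop_linear.
  - apply is_linear_plus.
Qed.

Lemma bop_opp_linear (A : bounded_op) : is_linear (fun u : V => opp (A u)).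
Proof.
  apply (is_linear_comp A opp); [apply bop_linear | apply is_linear_opp].
Qed.

Lemma bop_scal_linear (c : C) (A : bounded_op) :
  is_linear (fun u : V => scal (c : C_AbsRing) (A u)).
Proof.
  apply (is_linear_comp A (fun u : V => scal (c : C_AbsRing) u)).
  - apply bop_linear.
  - apply is_linear_scal_r; intros n m; apply Cmult_comm.
Qed.

Lemma bop_comp_linear (A B : bounded_op) : is_linear (fun u : V => A (B u)).
Proof. apply (is_linear_comp B A); apply bop_linear. Qed.

Definition bop_plus (A B : bounded_op) := mk_bop _ (bop_plus_linear A B).
Definition bop_opp (A : bounded_op) := mk_bop _ (bop_opp_linear A).
Definition bop_scal (c : C) (A : bounded_op) := mk_bop _ (bop_scal_linear c A).
Definition bop_zero := mk_bop (fun _ => zero) is_linear_zero.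
Definition bop_id := mk_bop (fun u => u) is_linear_id.
Definition bop_comp (A B : bounded_op) := mk_bop _ (bop_comp_linear A B).

Definition bop_norm (A : bounded_op) : R :=
  real (Lub_Rbar (fun r => exists u : V, norm u <= 1 /\ r = norm (A u))).

Lemma bop_norm_lub (A : bounded_op) :
  is_lub_Rbar (fun r => exists u : V, norm u <= 1 /\ r = norm (A u))
    (Finite (bop_norm A)).
Proof.
  unfold bop_norm.
  set (E := fun r => exists u : V, norm u <= 1 /\ r = norm (A u)).
  pose proof (Lub_Rbar_correct E) as HL.
  destruct (linear_norm A (bop_linear A)) as [M [HM HA]].
  destruct HL as [Hub Hlub].
  assert (H1 : Rbar_le (Finite 0) (Lub_Rbar E)).
  { apply Hub; exists zero; split; [rewrite norm_zero; lra | ].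
    rewrite (linear_zero A (bop_linear A)); now rewrite norm_zero. }
  assert (H2 : Rbar_le (Lub_Rbar E) (Finite M)).
  { apply Hlub; intros r [u [Hu ->]]; simpl.
    eapply Rle_trans; [apply HA | ].
    rewrite <- (Rmult_1_r M) at 2; apply Rmult_le_compat_l; lra. }
  destruct (Lub_Rbar E) as [l | | ]; simpl in *; try tauto.
  split; [exact Hub | exact Hlub].
Qed.

Lemma bop_norm_ge_0 (A : bounded_op) : 0 <= bop_norm A.
Proof.
  destruct (bop_norm_lub A) as [Hub _].
  apply (Hub 0); exists zero; split; [rewrite norm_zero; lra | ].
  rewrite (linear_zero A (bop_linear A)); now rewrite norm_zero.
Qed.

Lemma bop_norm_le (A : bounded_op) (M : R) :
  0 <= M -> (forall u : V, norm (A u) <= M * norm u) -> bop_norm A <= M.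
Proof.
  intros HM HA; destruct (bop_norm_lub A) as [_ Hlub].
  apply (Hlub (Finite M)); intros r [u [Hu ->]]; simpl.
  eapply Rle_trans; [apply HA | ].
  rewrite <- (Rmult_1_r M) at 2; apply Rmult_le_compat_l; lra.
Qed.

Lemma bop_norm_apply (A : bounded_op) (u : V) : norm (A u) <= bop_norm A * norm u.
Proof.
  destruct (bop_norm_lub A) as [Hub _].
  pose proof (norm_ge_0 u) as Hu.
  destruct (Req_dec (norm u) 0) as [H0 | H0].
  - rewrite (norm_eq_zero u H0), (linear_zero A (bop_linear A)), !norm_zero; lra.
  - assert (Hc : (RtoC 1) = Cmult (RtoC (norm u)) (RtoC (/ norm u))).
    { rewrite <- RtoC_mult, Rinv_r; auto. }
    set (v := scal (RtoC (/ norm u) : C_AbsRing) u).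
    assert (Hv : norm v <= 1).
    { eapply Rle_trans; [apply (norm_scal (V := V)) | ].
      change (Cmod (RtoC (/ norm u)) * norm u <= 1).
      rewrite Cmod_R, Rabs_pos_eq, Rinv_l; auto; try lra.
      left; apply Rinv_0_lt_compat; lra. }
    assert (Hu' : u = scal (RtoC (norm u) : C_AbsRing) v).
    { unfold v; rewrite scal_assoc.
      rewrite <- (scal_one (V := V) u) at 1.
      f_equal; exact Hc. }
    rewrite Hu' at 1; rewrite (linear_scal A (bop_linear A)).
    eapply Rle_trans; [apply (norm_scal (V := V)) | ].
    change (Cmod (RtoC (norm u)) * norm (A v) <= bop_norm A * norm u).
    rewrite Cmod_R, Rabs_pos_eq by lra; rewrite Rmult_comm.
    apply Rmult_le_compat_r; [lra | ].
    apply (Hub (norm (A v))); exists v; auto.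
Qed.

Lemma bop_plus_comm (A B : bounded_op) : bop_plus A B = bop_plus B A.
Proof. apply bop_ext; intros u; apply plus_comm. Qed.

Lemma bop_plus_assoc (A B D : bounded_op) :
  bop_plus A (bop_plus B D) = bop_plus (bop_plus A B) D.
Proof. apply bop_ext; intros u; apply plus_assoc. Qed.

Lemma bop_plus_zero_r (A : bounded_op) : bop_plus A bop_zero = A.
Proof. apply bop_ext; intros u; apply plus_zero_r. Qed.

Lemma bop_plus_opp_r (A : bounded_op) : bop_plus A (bop_opp A) = bop_zero.
Proof. apply bop_ext; intros u; apply (plus_opp_r (A u)). Qed.

Definition bop_AbelianMonoid_mixin :=
  AbelianMonoid.Mixin bounded_op bop_plus bop_zero bop_plus_comm bop_plus_assoc bop_plus_zero_r.
Canonical bop_AbelianMonoid := AbelianMonoid.Pack bounded_op bop_AbelianMonoid_mixin bounded_op.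

Definition bop_AbelianGroup_mixin :=
  AbelianGroup.Mixin bop_AbelianMonoid bop_opp bop_plus_opp_r.
Canonical bop_AbelianGroup :=
  AbelianGroup.Pack bounded_op (AbelianGroup.Class bounded_op _ bop_AbelianGroup_mixin) bounded_op.

Lemma bop_norm_plus (A B : bounded_op) : bop_norm (bop_plus A B) <= bop_norm A + bop_norm B.
Proof.
  pose proof (bop_norm_ge_0 A); pose proof (bop_norm_ge_0 B).
  apply bop_norm_le; [lra | ]; intros u; simpl.
  eapply Rle_trans; [apply (norm_triangle (V := V)) | ].
  rewrite Rmult_plus_distr_r; apply Rplus_le_compat; apply bop_norm_apply.
Qed.

Lemma bop_norm_scal (c : C) (A : bounded_op) : bop_norm (bop_scal c A) <= Cmod c * bop_norm A.
Proof.
  pose proof (bop_norm_ge_0 A); pose proof (Cmod_ge_0 c).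
  apply bop_norm_le; [now apply Rmult_le_pos | ]; intros u; simpl.
  eapply Rle_trans; [apply (norm_scal (V := V)) | ].
  change (Cmod c * norm (A u) <= Cmod c * bop_norm A * norm u).
  rewrite Rmult_assoc; apply Rmult_le_compat_l; [lra | apply bop_norm_apply].
Qed.

Lemma bop_norm_zero : bop_norm bop_zero = 0.
Proof.
  apply Rle_antisym; [ | apply bop_norm_ge_0].
  apply bop_norm_le; [lra | ]; intros u; simpl; rewrite norm_zero; lra.
Qed.

Lemma bop_norm_opp (A : bounded_op) : bop_norm (bop_opp A) = bop_norm A.
Proof.
  apply Rle_antisym; apply bop_norm_le; try apply bop_norm_ge_0; intros u.
  - simpl; rewrite norm_opp; apply bop_norm_apply.
  - rewrite <- norm_opp; apply (bop_norm_apply (bop_opp A)).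
Qed.

Definition bop_ball (A : bounded_op) (e : R) (B : bounded_op) : Prop := bop_norm (minus B A) < e.

Lemma bop_ball_center (A : bounded_op) (e : posreal) : bop_ball A e A.
Proof.
  unfold bop_ball; rewrite minus_eq_zero.
  change (bop_norm bop_zero < e); rewrite bop_norm_zero; apply cond_pos.
Qed.

Lemma bop_ball_sym (A B : bounded_op) (e : R) : bop_ball A e B -> bop_ball B e A.
Proof.
  unfold bop_ball; intros H.
  rewrite <- opp_minus.
  change (bop_norm (bop_opp (minus B A)) < e); now rewrite bop_norm_opp.
Qed.

Lemma bop_ball_triangle (A B D : bounded_op) (e1 e2 : R) :
  bop_ball A e1 B -> bop_ball B e2 D -> bop_ball A (e1 + e2) D.
Proof.
  unfold bop_ball; intros H1 H2.
  rewrite (minus_trans B D A).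
  eapply Rle_lt_trans; [apply bop_norm_plus | lra].
Qed.

Definition bop_UniformSpace_mixin :=
  UniformSpace.Mixin bounded_op bop_zero bop_ball bop_ball_center bop_ball_sym bop_ball_triangle.
Canonical bop_UniformSpace := UniformSpace.Pack bounded_op bop_UniformSpace_mixin bounded_op.

Lemma bop_scal_assoc (x y : C_AbsRing) (A : bounded_op) :
  bop_scal x (bop_scal y A) = bop_scal (mult x y) A.
Proof. apply bop_ext; intros u; apply (scal_assoc (V := V)). Qed.

Lemma bop_scal_one (A : bounded_op) : bop_scal (one : C_AbsRing) A = A.
Proof. apply bop_ext; intros u; apply (scal_one (V := V)). Qed.

Lemma bop_scal_distr_l (x : C_AbsRing) (A B : bounded_op) :
  bop_scal x (plus A B) = plus (bop_scal x A) (bop_scal x B).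
Proof. apply bop_ext; intros u; apply (scal_distr_l (V := V)). Qed.

Lemma bop_scal_distr_r (x y : C_AbsRing) (A : bounded_op) :
  bop_scal (plus x y) A = plus (bop_scal x A) (bop_scal y A).
Proof. apply bop_ext; intros u; apply (scal_distr_r (V := V)). Qed.

Definition bop_ModuleSpace_mixin :=
  ModuleSpace.Mixin C_AbsRing bop_AbelianGroup bop_scal
    bop_scal_assoc bop_scal_one bop_scal_distr_l bop_scal_distr_r.
Canonical bop_ModuleSpace :=
  ModuleSpace.Pack C_AbsRing bounded_op (ModuleSpace.Class C_AbsRing bounded_op _ bop_ModuleSpace_mixin) bounded_op.

Canonical bop_NormedModuleAux :=
  NormedModuleAux.Pack C_AbsRing bounded_op
    (NormedModuleAux.Class C_AbsRing bounded_op (ModuleSpace.class _ bop_ModuleSpace)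
       bop_UniformSpace_mixin) bounded_op.

Lemma bop_norm_compat2 (A B : bounded_op) (e : posreal) :
  bop_ball A e B -> bop_norm (minus B A) < 1 * e.
Proof. now rewrite Rmult_1_l. Qed.

Lemma bop_norm_eq_zero (A : bounded_op) : bop_norm A = 0 -> A = bop_zero.
Proof.
  intros H; apply bop_ext; intros u; simpl.
  apply norm_eq_zero; apply Rle_antisym; [ | apply norm_ge_0].
  eapply Rle_trans; [apply bop_norm_apply | rewrite H; lra].
Qed.

Definition bop_NormedModule_mixin :=
  NormedModule.Mixin C_AbsRing bop_NormedModuleAux bop_norm 1
    bop_norm_plus bop_norm_scal (fun A B e H => H) bop_norm_compat2 bop_norm_eq_zero.
Canonical bop_NormedModule :=
  NormedModule.Pack C_AbsRing bounded_op
    (NormedModule.Class C_AbsRing bounded_op (NormedModuleAux.class _ bop_NormedModuleAux)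
       bop_NormedModule_mixin) bounded_op.

Definition is_inverse (A B : bounded_op) : Prop := bop_comp A B = bop_id /\ bop_comp B A = bop_id.

(** The two-sided inverse in B(V); unspecified when there is none. *)
Definition bop_inv (A : bounded_op) : bounded_op := epsilon (inhabits bop_zero) (is_inverse A).

Definition shifted (A : bounded_op) (z : C) : bounded_op :=
  minus A (scal (z : C_AbsRing) (bop_id : bop_NormedModule)).

Definition in_resolvent_set (A : bounded_op) (z : C) : Prop := exists B, is_inverse (shifted A z) B.

Definition resolvent (A : bounded_op) (z : C) : bounded_op := bop_inv (shifted A z).

Definition eigenvalue (A : bounded_op) (z : C) : Prop :=
  exists u : V, u <> zero /\ A u = scal (z : C_AbsRing) u.

End BoundedOperators.

Arguments mk_bop {V} _ _.
Arguments bop_comp {V} _ _.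
Arguments resolvent {V} _ _.
Arguments in_resolvent_set {V} _ _.
Arguments eigenvalue {V} _ _.

Inductive dir := dleft | dright | ddown | dup.

Definition dsum (f : dir -> C) : C :=
  Cplus (Cplus (Cplus (f dleft) (f dright)) (f ddown)) (f dup).

Definition dir_eqb (j k : dir) : bool :=
  match j, k with
  | dleft, dleft | dright, dright | ddown, ddown | dup, dup => true
  | _, _ => false
  end.

Definition site : Type := (Z * Z)%type.
Definition e1 : site := (1, 0)%Z.
Definition e2 : site := (0, 1)%Z.
Definition sadd (x y : site) : site := (fst x + fst y, snd x + snd y)%Z.
Definition ssub (x y : site) : site := (fst x - fst y, snd x - snd y)%Z.

Notation field := (site -> dir -> C).

Definition normsq4 (v : dir -> C) : R :=
  Cmod (v dleft) ^ 2 + Cmod (v dright) ^ 2 + Cmod (v ddown) ^ 2 + Cmod (v dup) ^ 2.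

Definition lsum {X : Type} (f : X -> R) (l : list X) : R :=
  fold_right (fun x s => f x + s) 0 l.

(** Sum of [f >= 0] over Z^2 bounded by [M]: all sums over finite sets of sites are. *)
Definition sum_le (f : site -> R) (M : R) : Prop :=
  forall l : list site, NoDup l -> lsum f l <= M.

Definition square_summable (u : field) : Prop :=
  exists M, sum_le (fun x => normsq4 (u x)) M.

(** l^2(Z^2; C^4) *)
Record l2 := mk_l2 { l2_fun :> field; l2_summable : square_summable l2_fun }.

Definition l2_norm (u : l2) : R :=
  sqrt (real (Lub_Rbar (fun r =>
    exists l : list site, NoDup l /\ r = lsum (fun x => normsq4 (u x)) l))).

Lemma l2_ext (u v : l2) : (forall x j, u x j = v x j) -> u = v.
Proof.
  destruct u as [f Hf], v as [g Hg]; simpl; intros H.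
  assert (E : f = g).
  { apply functional_extensionality; intros x.
    apply functional_extensionality; intros j; apply H. }
  subst g; f_equal; apply proof_irrelevance.
Qed.

Lemma normsq4_ge_0 (v : dir -> C) : 0 <= normsq4 v.
Proof.
  unfold normsq4; repeat apply Rplus_le_le_0_compat; apply pow2_ge_0.
Qed.

Lemma lsum_ge_0 {X} (f : X -> R) l : (forall x, 0 <= f x) -> 0 <= lsum f l.
Proof.
  intros H; induction l as [ | x l IH]; simpl; [lra | specialize (H x); lra].
Qed.

Lemma lsum_le {X} (f g : X -> R) l : (forall x, f x <= g x) -> lsum f l <= lsum g l.
Proof.
  intros H; induction l as [ | x l IH]; simpl; [lra | specialize (H x); lra].
Qed.

Lemma lsum_plus {X} (f g : X -> R) l : lsum (fun x => f x + g x) l = lsum f l + lsum g l.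
Proof. induction l as [ | x l IH]; simpl; lra. Qed.

Lemma lsum_scal {X} c (f : X -> R) l : lsum (fun x => c * f x) l = c * lsum f l.
Proof. induction l as [ | x l IH]; simpl; [lra | rewrite IH; lra]. Qed.

Lemma lsum_map {X Y} (g : X -> Y) (f : Y -> R) l :
  lsum f (map g l) = lsum (fun x => f (g x)) l.
Proof. induction l as [ | x l IH]; simpl; [lra | rewrite IH; lra]. Qed.

Lemma l2_norm_lub (u : l2) :
  0 <= l2_norm u /\ sum_le (fun x => normsq4 (u x)) (l2_norm u ^ 2) /\
  (forall M, 0 <= M -> sum_le (fun x => normsq4 (u x)) (M ^ 2) -> l2_norm u <= M).
Proof.
  unfold l2_norm.
  set (E := fun r => exists l : list site, NoDup l /\ r = lsum (fun x => normsq4 (u x)) l).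
  destruct (Lub_Rbar_correct E) as [Hub Hlub].
  destruct (l2_summable u) as [M HM].
  assert (H1 : Rbar_le (Finite 0) (Lub_Rbar E)).
  { apply Hub; exists nil; split; [constructor | reflexivity]. }
  assert (H2 : Rbar_le (Lub_Rbar E) (Finite M)).
  { apply Hlub; intros r [l [Hl ->]]; now apply HM. }
  destruct (Lub_Rbar E) as [s | | ]; simpl in H1, H2; try tauto; simpl.
  split; [apply sqrt_pos | split].
  - intros l Hl; rewrite Rmult_1_r, sqrt_sqrt by lra.
    apply (Hub (lsum (fun x => normsq4 (u x)) l)); exists l; auto.
  - intros N HN H; rewrite <- (sqrt_pow2 N) by lra; apply sqrt_le_1_alt.
    apply (Hlub (Finite (N ^ 2))); intros r [l [Hl ->]]; now apply H.
Qed.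

Lemma sqrt_minkowski2 a b c d :
  0 <= a -> 0 <= b -> 0 <= c -> 0 <= d ->
  sqrt ((a + c) ^ 2 + (b + d) ^ 2) <= sqrt (a ^ 2 + b ^ 2) + sqrt (c ^ 2 + d ^ 2).
Proof.
  intros.
  pose proof (Cmod_triangle (a, b) (c, d)) as H3.
  unfold Cmod in H3; simpl in H3; simpl; exact H3.
Qed.

Lemma sqrt_step (p q : R) : 0 <= q -> sqrt (p ^ 2 + q) = sqrt (p ^ 2 + sqrt q ^ 2).
Proof. intros; f_equal; rewrite (pow2_sqrt q); auto. Qed.

Lemma lsum_minkowski {X} (f g : X -> R) l :
  (forall x, 0 <= f x) -> (forall x, 0 <= g x) ->
  sqrt (lsum (fun x => (f x + g x) ^ 2) l)
  <= sqrt (lsum (fun x => f x ^ 2) l) + sqrt (lsum (fun x => g x ^ 2) l).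
Proof.
  intros Hf Hg; induction l as [ | x l IH].
  - unfold lsum; simpl; rewrite sqrt_0; lra.
  - change (sqrt ((f x + g x) ^ 2 + lsum (fun x => (f x + g x) ^ 2) l)
            <= sqrt (f x ^ 2 + lsum (fun x => f x ^ 2) l)
               + sqrt (g x ^ 2 + lsum (fun x => g x ^ 2) l)).
    rewrite (sqrt_step (f x)), (sqrt_step (g x)), (sqrt_step (f x + g x))
      by (apply lsum_ge_0; intros; apply pow2_ge_0).
    eapply Rle_trans; [ | apply sqrt_minkowski2; auto; apply sqrt_pos].
    apply sqrt_le_1_alt, Rplus_le_compat_l, pow_incr; split; [apply sqrt_pos | exact IH].
Qed.

Lemma normsq4_lsum v :
  normsq4 v = lsum (fun j => Cmod (v j) ^ 2) (dleft :: dright :: ddown :: dup :: nil).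
Proof. unfold normsq4, lsum, fold_right; ring. Qed.

Lemma normsq4_triangle (v w : dir -> C) :
  sqrt (normsq4 (fun j => Cplus (v j) (w j))) <= sqrt (normsq4 v) + sqrt (normsq4 w).
Proof.
  rewrite !normsq4_lsum.
  eapply Rle_trans; [ | apply lsum_minkowski; intros; apply Cmod_ge_0].
  apply sqrt_le_1_alt, lsum_le; intros j; apply pow_incr; split;
    [apply Cmod_ge_0 | apply Cmod_triangle].
Qed.

Definition field_plus (u v : field) : field := fun x j => Cplus (u x j) (v x j).
Definition field_scal (c : C) (u : field) : field := fun x j => Cmult c (u x j).

Lemma field_plus_sum_le (u v : field) a b :
  0 <= a -> 0 <= b ->
  sum_le (fun x => normsq4 (u x)) (a ^ 2) -> sum_le (fun x => normsq4 (v x)) (b ^ 2) ->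
  sum_le (fun x => normsq4 (field_plus u v x)) ((a + b) ^ 2).
Proof.
  intros Ha Hb Hu Hv l Hl.
  set (f := fun x => sqrt (normsq4 (u x))); set (g := fun x => sqrt (normsq4 (v x))).
  assert (E : forall w : field, lsum (fun x => sqrt (normsq4 (w x)) ^ 2) l
                        = lsum (fun x => normsq4 (w x)) l).
  { intros w; apply Rle_antisym; apply lsum_le; intros x;
      rewrite pow2_sqrt; auto using normsq4_ge_0; lra. }
  assert (H : lsum (fun x => normsq4 (field_plus u v x)) l
              <= lsum (fun x => (f x + g x) ^ 2) l).
  { rewrite <- E; apply lsum_le; intros x; apply pow_incr; split;
      [apply sqrt_pos | apply (normsq4_triangle (u x) (v x))]. }
  assert (P : 0 <= lsum (fun x => (f x + g x) ^ 2) l)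
    by (apply lsum_ge_0; intros; apply pow2_ge_0).
  assert (H' : sqrt (lsum (fun x => (f x + g x) ^ 2) l) <= a + b).
  { eapply Rle_trans; [apply lsum_minkowski; intros; apply sqrt_pos | ].
    unfold f, g; rewrite !E; apply Rplus_le_compat.
    - rewrite <- (sqrt_pow2 a) by lra; apply sqrt_le_1_alt, Hu, Hl.
    - rewrite <- (sqrt_pow2 b) by lra; apply sqrt_le_1_alt, Hv, Hl. }
  rewrite <- (pow2_sqrt _ P) in H.
  eapply Rle_trans; [exact H | ].
  apply pow_incr; split; [apply sqrt_pos | exact H'].
Qed.

Lemma field_scal_sum_le c (u : field) M :
  sum_le (fun x => normsq4 (u x)) M ->
  sum_le (fun x => normsq4 (field_scal c u x)) (Cmod c ^ 2 * M).
Proof.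
  intros Hu l Hl.
  rewrite (Rle_antisym (lsum (fun x => normsq4 (field_scal c u x)) l)
             (Cmod c ^ 2 * lsum (fun x => normsq4 (u x)) l)).
  - apply Rmult_le_compat_l; [apply pow2_ge_0 | now apply Hu].
  - rewrite <- lsum_scal; apply lsum_le; intros x.
    unfold normsq4, field_scal; rewrite !Cmod_mult; right; ring.
  - rewrite <- lsum_scal; apply lsum_le; intros x.
    unfold normsq4, field_scal; rewrite !Cmod_mult; right; ring.
Qed.

Lemma field_zero_sum_le : sum_le (fun _ => normsq4 (fun _ => RtoC 0)) 0.
Proof.
  intros l _; induction l as [ | x l IH]; simpl; [lra | ].
  assert (H : normsq4 (fun _ => RtoC 0) = 0) by (unfold normsq4; rewrite Cmod_0; ring).
  lra.
Qed.

Lemma l2_plus_summable (u v : l2) : square_summable (field_plus u v).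
Proof.
  destruct (l2_norm_lub u) as [Hu [Hu' _]], (l2_norm_lub v) as [Hv [Hv' _]].
  exists ((l2_norm u + l2_norm v) ^ 2); now apply field_plus_sum_le.
Qed.

Lemma l2_scal_summable (c : C) (u : l2) : square_summable (field_scal c u).
Proof.
  destruct (l2_summable u) as [M HM].
  exists (Cmod c ^ 2 * M); now apply field_scal_sum_le.
Qed.

Definition l2_plus (u v : l2) : l2 := mk_l2 _ (l2_plus_summable u v).
Definition l2_scal (c : C) (u : l2) : l2 := mk_l2 _ (l2_scal_summable c u).
Definition l2_zero : l2 := mk_l2 (fun _ _ => RtoC 0) (ex_intro _ 0 field_zero_sum_le).
Definition l2_opp (u : l2) : l2 := l2_scal (Copp (RtoC 1)) u.

Lemma l2_plus_comm (u v : l2) : l2_plus u v = l2_plus v u.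
Proof. apply l2_ext; intros x j; apply Cplus_comm. Qed.

Lemma l2_plus_assoc (u v w : l2) : l2_plus u (l2_plus v w) = l2_plus (l2_plus u v) w.
Proof. apply l2_ext; intros x j; apply Cplus_assoc. Qed.

Lemma l2_plus_zero_r (u : l2) : l2_plus u l2_zero = u.
Proof. apply l2_ext; intros x j; apply Cplus_0_r. Qed.

Lemma l2_plus_opp_r (u : l2) : l2_plus u (l2_opp u) = l2_zero.
Proof.
  apply l2_ext; intros x j; simpl; unfold field_plus, field_scal; simpl.
  unfold field_scal; ring.
Qed.

Definition l2_AbelianMonoid_mixin :=
  AbelianMonoid.Mixin l2 l2_plus l2_zero l2_plus_comm l2_plus_assoc l2_plus_zero_r.
Canonical l2_AbelianMonoid := AbelianMonoid.Pack l2 l2_AbelianMonoid_mixin l2.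

Definition l2_AbelianGroup_mixin :=
  AbelianGroup.Mixin l2_AbelianMonoid l2_opp l2_plus_opp_r.
Canonical l2_AbelianGroup :=
  AbelianGroup.Pack l2 (AbelianGroup.Class l2 _ l2_AbelianGroup_mixin) l2.

Lemma l2_norm_plus (u v : l2) : l2_norm (l2_plus u v) <= l2_norm u + l2_norm v.
Proof.
  destruct (l2_norm_lub u) as [Hu [Hu' _]], (l2_norm_lub v) as [Hv [Hv' _]].
  apply l2_norm_lub; [lra | now apply field_plus_sum_le].
Qed.

Lemma l2_norm_scal (c : C) (u : l2) : l2_norm (l2_scal c u) <= Cmod c * l2_norm u.
Proof.
  destruct (l2_norm_lub u) as [Hu [Hu' _]].
  apply l2_norm_lub; [apply Rmult_le_pos; auto; apply Cmod_ge_0 | ].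
  rewrite Rpow_mult_distr; now apply field_scal_sum_le.
Qed.

Lemma l2_norm_zero : l2_norm l2_zero = 0.
Proof.
  apply Rle_antisym; [ | apply l2_norm_lub].
  apply l2_norm_lub; [lra | ]; intros l Hl.
  eapply Rle_trans; [apply (field_zero_sum_le l Hl) | lra].
Qed.

Lemma l2_norm_opp_le (u : l2) : l2_norm (l2_opp u) <= l2_norm u.
Proof.
  eapply Rle_trans; [apply l2_norm_scal | ].
  rewrite Cmod_opp, Cmod_1; lra.
Qed.

Definition l2_ball (u : l2) (e : R) (v : l2) : Prop := l2_norm (minus v u) < e.

Lemma l2_ball_center (u : l2) (e : posreal) : l2_ball u e u.
Proof.
  unfold l2_ball; rewrite minus_eq_zero.
  change (l2_norm l2_zero < e); rewrite l2_norm_zero; apply cond_pos.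
Qed.

Lemma l2_ball_sym (u v : l2) (e : R) : l2_ball u e v -> l2_ball v e u.
Proof.
  unfold l2_ball; intros H; rewrite <- opp_minus.
  eapply Rle_lt_trans; [apply l2_norm_opp_le | exact H].
Qed.

Lemma l2_ball_triangle (u v w : l2) (a b : R) :
  l2_ball u a v -> l2_ball v b w -> l2_ball u (a + b) w.
Proof.
  unfold l2_ball; intros H1 H2; rewrite (minus_trans v w u).
  eapply Rle_lt_trans; [apply l2_norm_plus | lra].
Qed.

Definition l2_UniformSpace_mixin :=
  UniformSpace.Mixin l2 l2_zero l2_ball l2_ball_center l2_ball_sym l2_ball_triangle.
Canonical l2_UniformSpace := UniformSpace.Pack l2 l2_UniformSpace_mixin l2.

Lemma l2_scal_assoc (a b : C_AbsRing) (u : l2) :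
  l2_scal a (l2_scal b u) = l2_scal (mult a b) u.
Proof. apply l2_ext; intros x j; apply Cmult_assoc. Qed.

Lemma l2_scal_one (u : l2) : l2_scal (one : C_AbsRing) u = u.
Proof. apply l2_ext; intros x j; apply Cmult_1_l. Qed.

Lemma l2_scal_distr_l (a : C_AbsRing) (u v : l2) :
  l2_scal a (plus u v) = plus (l2_scal a u) (l2_scal a v).
Proof. apply l2_ext; intros x j; apply Cmult_plus_distr_l. Qed.

Lemma l2_scal_distr_r (a b : C_AbsRing) (u : l2) :
  l2_scal (plus a b) u = plus (l2_scal a u) (l2_scal b u).
Proof. apply l2_ext; intros x j; apply Cmult_plus_distr_r. Qed.

Definition l2_ModuleSpace_mixin :=
  ModuleSpace.Mixin C_AbsRing l2_AbelianGroup l2_scal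
    l2_scal_assoc l2_scal_one l2_scal_distr_l l2_scal_distr_r.
Canonical l2_ModuleSpace :=
  ModuleSpace.Pack C_AbsRing l2 (ModuleSpace.Class C_AbsRing l2 _ l2_ModuleSpace_mixin) l2.

Canonical l2_NormedModuleAux :=
  NormedModuleAux.Pack C_AbsRing l2
    (NormedModuleAux.Class C_AbsRing l2 (ModuleSpace.class _ l2_ModuleSpace)
       l2_UniformSpace_mixin) l2.

Lemma l2_norm_compat2 (u v : l2) (e : posreal) :
  l2_ball u e v -> l2_norm (minus v u) < 1 * e.
Proof. now rewrite Rmult_1_l. Qed.

Lemma l2_norm_eq_zero (u : l2) : l2_norm u = 0 -> u = l2_zero.
Proof.
  intros H; destruct (l2_norm_lub u) as [_ [Hu _]]; rewrite H in Hu.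
  apply l2_ext; intros x j; simpl; apply Cmod_eq_0.
  assert (Hx : normsq4 (u x) <= 0).
  { specialize (Hu (x :: nil)); simpl in Hu.
    assert (NoDup (x :: nil)) by (constructor; [simpl; tauto | constructor]).
    specialize (Hu H0); lra. }
  unfold normsq4 in Hx.
  pose proof (pow2_ge_0 (Cmod (u x dleft))); pose proof (pow2_ge_0 (Cmod (u x dright))).
  pose proof (pow2_ge_0 (Cmod (u x ddown))); pose proof (pow2_ge_0 (Cmod (u x dup))).
  apply (Rsqr_0_uniq (Cmod (u x j))); unfold Rsqr; destruct j; nra.
Qed.

Definition l2_NormedModule_mixin :=
  NormedModule.Mixin C_AbsRing l2_NormedModuleAux l2_norm 1
    l2_norm_plus l2_norm_scal (fun u v e H => H) l2_norm_compat2 l2_norm_eq_zero.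
Canonical l2_NormedModule :=
  NormedModule.Pack C_AbsRing l2
    (NormedModule.Class C_AbsRing l2 (NormedModuleAux.class _ l2_NormedModuleAux)
       l2_NormedModule_mixin) l2.

Notation BH := (bounded_op l2_NormedModule).

(** The dilation [T(theta)] is unbounded on l^2, so products involving it are
    formed on arbitrary functions and only then restricted to l^2. *)

Record l2_bounded (F : field -> field) : Prop := {
  l2_bounded_plus : forall u v, F (field_plus u v) = field_plus (F u) (F v);
  l2_bounded_scal : forall c u, F (field_scal c u) = field_scal c (F u);
  l2_bounded_bound : exists K, 0 < K /\ forall u M,
    sum_le (fun x => normsq4 (u x)) M -> sum_le (fun x => normsq4 (F u x)) (K * M) }.

Lemma l2_bounded_summable F (HF : l2_bounded F) (u : l2) : square_summable (F u).
Proof.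
  destruct HF as [_ _ [K [_ H]]], (l2_summable u) as [M HM].
  exists (K * M); now apply H.
Qed.

Definition l2_apply F (HF : l2_bounded F) (u : l2) : l2 :=
  mk_l2 (F u) (l2_bounded_summable F HF u).

Lemma l2_apply_linear F (HF : l2_bounded F) :
  is_linear (U := l2_NormedModule) (V := l2_NormedModule) (l2_apply F HF).
Proof.
  constructor.
  - intros u v; apply l2_ext; intros x j; simpl.
    now rewrite (l2_bounded_plus F HF).
  - intros k u; apply l2_ext; intros x j; simpl.
    now rewrite (l2_bounded_scal F HF).
  - destruct (l2_bounded_bound F HF) as [K [HK H]].
    exists (sqrt K); split; [now apply sqrt_lt_R0 | ]; intros u.
    destruct (l2_norm_lub u) as [Hu [Hu' _]].
    apply (l2_norm_lub (l2_apply F HF u)).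
    + apply Rmult_le_pos; [apply sqrt_pos | exact Hu].
    + rewrite Rpow_mult_distr, pow2_sqrt by lra; now apply H.
Qed.

Definition l2_lift F (HF : l2_bounded F) : BH :=
  mk_bop (V := l2_NormedModule) (l2_apply F HF) (l2_apply_linear F HF).

Lemma l2_bounded_ext F G : (forall u x j, F u x j = G u x j) -> l2_bounded F -> l2_bounded G.
Proof.
  intros H HF; replace G with F; auto.
  apply functional_extensionality; intros u.
  apply functional_extensionality; intros x.
  apply functional_extensionality; intros j; apply H.
Qed.

Lemma l2_bounded_comp F G :
  l2_bounded F -> l2_bounded G -> l2_bounded (fun u => F (G u)).
Proof.
  intros [F1 F2 [K [HK F3]]] [G1 G2 [L [HL G3]]]; constructor.
  - intros; now rewrite G1, F1.
  - intros; now rewrite G2, F2.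
  - exists (K * L); split; [now apply Rmult_lt_0_compat | ]; intros u M H.
    rewrite Rmult_assoc; now apply F3, G3.
Qed.

Lemma l2_bounded_scaled c F :
  l2_bounded F -> l2_bounded (fun u => field_scal c (F u)).
Proof.
  intros [F1 F2 [K [HK F3]]]; constructor.
  - intros u v; rewrite F1; apply functional_extensionality; intros x.
    apply functional_extensionality; intros j; unfold field_scal, field_plus; ring.
  - intros d u; rewrite F2; apply functional_extensionality; intros x.
    apply functional_extensionality; intros j; unfold field_scal; ring.
  - exists ((Cmod c ^ 2 + 1) * K); split.
    + pose proof (pow2_ge_0 (Cmod c)); apply Rmult_lt_0_compat; lra.
    + intros u M H; pose proof (F3 u M H) as H'; intros l Hl.
      eapply Rle_trans; [apply (field_scal_sum_le c _ _ H' l Hl) | ].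
      assert (0 <= K * M).
      { apply Rmult_le_pos; [lra | ]; specialize (H nil (NoDup_nil _)); exact H. }
      nra.
Qed.

Definition shift_fun (u : field) : field := fun x j =>
  match j with
  | dleft => u (sadd x e1) dleft
  | dright => u (ssub x e1) dright
  | ddown => u (sadd x e2) ddown
  | dup => u (ssub x e2) dup
  end.

Definition mat4 : Type := dir -> dir -> C.

Definition mat_id : mat4 := fun j k => if dir_eqb j k then (RtoC 1) else RtoC 0.

Definition unitary (A : mat4) : Prop :=
  (forall j k, dsum (fun l => Cmult (A j l) (Cconj (A k l))) = mat_id j k) /\
  (forall j k, dsum (fun l => Cmult (Cconj (A l j)) (A l k)) = mat_id j k).

Definition mat_max (A : mat4) : R :=
  let row j := Rmax (Rmax (Cmod (A j dleft)) (Cmod (A j dright)))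
                    (Rmax (Cmod (A j ddown)) (Cmod (A j dup))) in
  Rmax (Rmax (row dleft) (row dright)) (Rmax (row ddown) (row dup)).

Definition mat_sub (A B : mat4) : mat4 := fun j k => Cminus (A j k) (B j k).

Definition mul_fun (A : site -> mat4) (u : field) : field := fun x j =>
  dsum (fun k => Cmult (A x j k) (u x k)).

Definition in_box (M0 : Z) (x : site) : Prop := (Z.abs (fst x) <= M0 /\ Z.abs (snd x) <= M0)%Z.

Record coin (M0 : Z) := mk_coin {
  coin_mat :> site -> mat4;
  coin_unitary : forall x, unitary (coin_mat x);
  coin_outside : forall x, ~ in_box M0 x -> coin_mat x = mat_id }.

Arguments coin_mat {M0} _ _ _ _.
Arguments coin_unitary {M0} _ _.
Arguments coin_outside {M0} _ _ _.

Lemma shift_bounded : l2_bounded shift_fun.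
Proof.
  constructor.
  - intros u v; apply functional_extensionality; intros x.
    apply functional_extensionality; intros j; destruct j; reflexivity.
  - intros c u; apply functional_extensionality; intros x.
    apply functional_extensionality; intros j; destruct j; reflexivity.
  - exists 4; split; [lra | ]; intros u M H l Hl.
    assert (T : forall g : site -> site, (forall x y, g x = g y -> x = y) ->
              lsum (fun x => normsq4 (u (g x))) l <= M).
    { intros g Hg; rewrite <- (lsum_map g (fun x => normsq4 (u x))); apply H.
      apply FinFun.Injective_map_NoDup; auto. }
    assert (Ha : forall e x y, sadd x e = sadd y e -> x = y).
    { intros [] [] [] E; unfold sadd in E; simpl in E; inversion E; f_equal; lia. }
    assert (Hs : forall e x y, ssub x e = ssub y e -> x = y).
    { intros [] [] [] E; unfold ssub in E; simpl in E; inversion E; f_equal; lia. }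
    pose proof (T _ (Ha e1)) as T1; pose proof (T _ (Hs e1)) as T2.
    pose proof (T _ (Ha e2)) as T3; pose proof (T _ (Hs e2)) as T4.
    apply Rle_trans with
      (lsum (fun x => normsq4 (u (sadd x e1)) + normsq4 (u (ssub x e1))
              + normsq4 (u (sadd x e2)) + normsq4 (u (ssub x e2))) l).
    + apply lsum_le; intros x; unfold normsq4, shift_fun.
      repeat match goal with
      | |- context [Cmod ?z ^ 2] =>
          let t := fresh "t" in let Ht := fresh "Ht" in
          pose proof (pow2_ge_0 (Cmod z)) as Ht; set (t := Cmod z ^ 2) in *; clearbody t
      end; lra.
    + rewrite !lsum_plus; lra.
Qed.

Lemma Cmod_dsum_sq (a v : dir -> C) c :
  0 <= c -> (forall k, Cmod (a k) <= c) ->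
  Cmod (dsum (fun k => Cmult (a k) (v k))) ^ 2 <= 4 * c ^ 2 * normsq4 v.
Proof.
  intros Hc Ha.
  assert (T : Cmod (dsum (fun k => Cmult (a k) (v k)))
              <= c * (Cmod (v dleft) + Cmod (v dright) + Cmod (v ddown) + Cmod (v dup))).
  { assert (P : forall k, Cmod (Cmult (a k) (v k)) <= c * Cmod (v k)).
    { intros k; rewrite Cmod_mult; apply Rmult_le_compat_r; [apply Cmod_ge_0 | apply Ha]. }
    unfold dsum.
    eapply Rle_trans; [apply Cmod_triangle | ].
    eapply Rle_trans; [apply Rplus_le_compat_r, Cmod_triangle | ].
    eapply Rle_trans; [apply Rplus_le_compat_r, Rplus_le_compat_r, Cmod_triangle | ].
    pose proof (P dleft); pose proof (P dright); pose proof (P ddown); pose proof (P dup).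
    lra. }
  eapply Rle_trans; [apply pow_incr; split; [apply Cmod_ge_0 | exact T] | ].
  rewrite Rpow_mult_distr, (Rmult_comm 4), Rmult_assoc.
  apply Rmult_le_compat_l; [apply pow2_ge_0 | ]; unfold normsq4.
  set (p := Cmod (v dleft)); set (q := Cmod (v dright)).
  set (r := Cmod (v ddown)); set (s := Cmod (v dup)).
  pose proof (pow2_ge_0 (p - q)); pose proof (pow2_ge_0 (p - r)).
  pose proof (pow2_ge_0 (p - s)); pose proof (pow2_ge_0 (q - r)).
  pose proof (pow2_ge_0 (q - s)); pose proof (pow2_ge_0 (r - s)).
  nra.
Qed.

Lemma mul_bounded (A : site -> mat4) c :
  (forall x j k, Cmod (A x j k) <= c) -> l2_bounded (mul_fun A).
Proof.
  intros H.
  assert (Hc : 0 <= c)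
    by (eapply Rle_trans; [apply Cmod_ge_0 | apply (H e1 dleft dleft)]).
  constructor.
  - intros u v; apply functional_extensionality; intros x.
    apply functional_extensionality; intros j.
    unfold mul_fun, field_plus, dsum; ring.
  - intros d u; apply functional_extensionality; intros x.
    apply functional_extensionality; intros j.
    unfold mul_fun, field_scal, dsum; ring.
  - exists (16 * c ^ 2 + 1); split; [pose proof (pow2_ge_0 c); lra | ].
    intros u M Hu l Hl.
    apply Rle_trans with (lsum (fun x => (16 * c ^ 2 + 1) * normsq4 (u x)) l).
    + apply lsum_le; intros x; unfold normsq4 at 1, mul_fun.
      pose proof (Cmod_dsum_sq (A x dleft) (u x) c Hc (H x dleft)).
      pose proof (Cmod_dsum_sq (A x dright) (u x) c Hc (H x dright)).
      pose proof (Cmod_dsum_sq (A x ddown) (u x) c Hc (H x ddown)).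
      pose proof (Cmod_dsum_sq (A x dup) (u x) c Hc (H x dup)).
      pose proof (normsq4_ge_0 (u x)); lra.
    + rewrite lsum_scal; apply Rmult_le_compat_l; [pose proof (pow2_ge_0 c); lra | ].
      now apply Hu.
Qed.

Lemma unitary_entry (A : mat4) j k : unitary A -> Cmod (A j k) <= 1.
Proof.
  intros [H _]; specialize (H j j).
  assert (E : mat_id j j = RtoC 1) by (destruct j; reflexivity).
  rewrite E in H.
  assert (D : dsum (fun l => Cmult (A j l) (Cconj (A j l))) = RtoC (normsq4 (A j))).
  { unfold dsum, normsq4; rewrite <- !Cmod2_conj.
    now rewrite <- !RtoC_plus. }
  rewrite D in H; apply RtoC_inj in H; unfold normsq4 in H.
  pose proof (pow2_ge_0 (Cmod (A j dleft))); pose proof (pow2_ge_0 (Cmod (A j dright))).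
  pose proof (pow2_ge_0 (Cmod (A j ddown))); pose proof (pow2_ge_0 (Cmod (A j dup))).
  pose proof (Cmod_ge_0 (A j k)).
  assert (Cmod (A j k) ^ 2 <= 1) by (destruct k; lra).
  nra.
Qed.

Lemma coin_bounded {M0} (Cn : coin M0) : l2_bounded (mul_fun Cn).
Proof.
  apply (mul_bounded _ 1); intros; apply unitary_entry, coin_unitary.
Qed.

Definition shift : BH := l2_lift shift_fun shift_bounded.

Definition walk {M0} (Cn : coin M0) : BH := bop_comp shift (l2_lift _ (coin_bounded Cn)).

(** [V = U - S] *)
Definition pert_fun {M0} (Cn : coin M0) (u : field) : field := fun x j =>
  Cminus (shift_fun (mul_fun Cn u) x j) (shift_fun u x j).

(** The diagonal entries of [T(theta)]; a class of C/2piZ is given by a representative,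
    on which the entries do not depend since the coordinates are integers. *)
Definition dil_phase (theta : C) (x : site) (j : dir) : C :=
  match j with
  | dleft => Cexp (Cmult (Cmult Ci theta) (RtoC (IZR (fst x))))
  | dright => Cexp (Copp (Cmult (Cmult Ci theta) (RtoC (IZR (fst x)))))
  | ddown => Cexp (Cmult (Cmult Ci theta) (RtoC (IZR (snd x))))
  | dup => Cexp (Copp (Cmult (Cmult Ci theta) (RtoC (IZR (snd x)))))
  end.

Definition dil (theta : C) (u : field) : field := fun x j =>
  Cmult (dil_phase theta x j) (u x j).

Definition dil_inv (theta : C) (u : field) : field := fun x j =>
  Cmult (Cinv (dil_phase theta x j)) (u x j).

Definition dil_pert_fun {M0} (Cn : coin M0) (theta : C) (u : field) : field :=
  dil theta (pert_fun Cn (dil_inv theta u)).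

Lemma Cexp_plus z w : Cexp (Cplus z w) = Cmult (Cexp z) (Cexp w).
Proof.
  destruct z as [a b], w as [c d]; unfold Cexp, Cmult; simpl.
  rewrite exp_plus, cos_plus, sin_plus; f_equal; ring.
Qed.

Lemma Cmod_Cexp z : Cmod (Cexp z) = exp (Re z).
Proof.
  unfold Cexp, Cmod; simpl.
  replace (exp (Re z) * cos (Im z) * (exp (Re z) * cos (Im z) * 1)
           + exp (Re z) * sin (Im z) * (exp (Re z) * sin (Im z) * 1))
    with (exp (Re z) ^ 2 * (Rsqr (sin (Im z)) + Rsqr (cos (Im z))))
    by (unfold Rsqr; ring).
  rewrite sin2_cos2, Rmult_1_r; apply sqrt_pow2; left; apply exp_pos.
Qed.

Lemma Cexp_neq_0 z : Cexp z <> RtoC 0.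
Proof.
  intros H; pose proof (Cmod_Cexp z) as E; rewrite H, Cmod_0 in E.
  pose proof (exp_pos (Re z)); lra.
Qed.

Lemma dil_phase_neq_0 theta x j : dil_phase theta x j <> RtoC 0.
Proof. destruct j; apply Cexp_neq_0. Qed.

Lemma dil_phase_bound M0 theta x j :
  in_box M0 x ->
  Cmod (dil_phase theta x j) <= exp (Rabs (Im theta) * IZR M0) /\
  Cmod (Cinv (dil_phase theta x j)) <= exp (Rabs (Im theta) * IZR M0).
Proof.
  intros [H1 H2]; rewrite Cmod_inv by apply dil_phase_neq_0.
  assert (Q : forall m r : R, Rabs m <= IZR M0 -> r = m * Im theta ->
            - (Rabs (Im theta) * IZR M0) <= r <= Rabs (Im theta) * IZR M0).
  { intros m r Hm ->; apply Rabs_le_between; rewrite Rabs_mult, Rmult_comm.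
    apply Rmult_le_compat_l; [apply Rabs_pos | exact Hm]. }
  apply IZR_le in H1, H2; rewrite abs_IZR in H1, H2.
  assert (E : exists r, Cmod (dil_phase theta x j) = exp r /\
            - (Rabs (Im theta) * IZR M0) <= r <= Rabs (Im theta) * IZR M0).
  { destruct theta as [p q]; destruct j; simpl; rewrite Cmod_Cexp; eexists; split;
      try reflexivity.
    - apply (Q (- IZR (fst x))); [now rewrite Rabs_Ropp | simpl; ring].
    - apply (Q (IZR (fst x))); [exact H1 | simpl; ring].
    - apply (Q (- IZR (snd x))); [now rewrite Rabs_Ropp | simpl; ring].
    - apply (Q (IZR (snd x))); [exact H2 | simpl; ring]. }
  destruct E as [r [-> Hr]].
  assert (X : forall a b, a <= b -> exp a <= exp b).
  { intros a b [H | ->]; [left; now apply exp_increasing | right; reflexivity]. }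
  rewrite <- exp_Ropp; split; apply X; lra.
Qed.

Lemma dil_shift theta (u : field) x j :
  dil theta (shift_fun (dil_inv theta u)) x j
  = Cmult (Cexp (Copp (Cmult Ci theta))) (shift_fun u x j).
Proof.
  assert (K : forall a b d w : C, a = Cplus d b ->
            Cmult (Cexp a) (Cmult (Cinv (Cexp b)) w) = Cmult (Cexp d) w).
  { intros a b d w ->; rewrite Cexp_plus; field; apply Cexp_neq_0. }
  unfold dil, dil_inv, shift_fun, dil_phase; destruct j; apply K; simpl;
    try rewrite plus_IZR; try rewrite minus_IZR;
    destruct theta; unfold Cplus, Cmult, Copp, RtoC, Ci; simpl; f_equal; ring.
Qed.

Definition dil_coin {M0} (Cn : coin M0) (theta : C) (x : site) : mat4 := fun j k =>
  Cmult (Cmult (dil_phase theta x j) (Cminus (Cn x j k) (mat_id j k)))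
        (Cinv (dil_phase theta x k)).

Lemma dil_coin_bounded {M0} (Cn : coin M0) theta : l2_bounded (mul_fun (dil_coin Cn theta)).
Proof.
  set (E := exp (Rabs (Im theta) * IZR M0)).
  assert (HE : 0 < E) by apply exp_pos.
  apply (mul_bounded _ (E * 2 * E)); intros x j k; unfold dil_coin.
  destruct (classic (in_box M0 x)) as [Hx | Hx].
  - rewrite !Cmod_mult.
    destruct (dil_phase_bound M0 theta x j Hx) as [P _].
    destruct (dil_phase_bound M0 theta x k Hx) as [_ Q].
    assert (D : Cmod (Cminus (Cn x j k) (mat_id j k)) <= 2).
    { unfold Cminus; eapply Rle_trans; [apply Cmod_triangle | ]; rewrite Cmod_opp.
      pose proof (unitary_entry _ j k (coin_unitary Cn x)).
      assert (Cmod (mat_id j k) <= 1).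
      { unfold mat_id; destruct (dir_eqb j k); rewrite ?Cmod_0, ?Cmod_1; lra. }
      lra. }
    repeat apply Rmult_le_compat; auto using Cmod_ge_0, Rmult_le_pos.
  - rewrite (coin_outside Cn x Hx).
    replace (Cminus (mat_id j k) (mat_id j k)) with (RtoC 0) by ring.
    rewrite !Cmod_mult, Cmod_0; nra.
Qed.

Lemma dil_pert_bounded {M0} (Cn : coin M0) theta : l2_bounded (dil_pert_fun Cn theta).
Proof.
  apply (l2_bounded_ext
    (fun u => field_scal (Cexp (Copp (Cmult Ci theta)))
                (shift_fun (mul_fun (dil_coin Cn theta) u)))).
  - intros u x j; unfold field_scal; rewrite <- dil_shift.
    unfold dil_pert_fun, dil at 1, dil at 1; f_equal.
    assert (W : forall y k, dil_inv theta (mul_fun (dil_coin Cn theta) u) y k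
              = Cminus (mul_fun Cn (dil_inv theta u) y k) (dil_inv theta u y k)).
    { intros y k; unfold dil_inv, mul_fun, dsum, dil_coin.
      destruct k; unfold mat_id; cbn [dir_eqb]; field; repeat split; apply dil_phase_neq_0. }
    unfold pert_fun; destruct j; apply W.
  - apply (l2_bounded_scaled _ (fun u => shift_fun (mul_fun (dil_coin Cn theta) u))).
    apply (l2_bounded_comp shift_fun); [apply shift_bounded | apply dil_coin_bounded].
Qed.

(** [U(theta) = e^{-i theta} S + T(theta) V T(theta)^{-1}]. *)
Definition dil_walk {M0} (Cn : coin M0) (theta : C) : BH :=
  plus (scal (Cexp (Copp (Cmult Ci theta)) : C_AbsRing) (shift : bop_NormedModule _))
       (l2_lift _ (dil_pert_bounded Cn theta)).

Definition K1 (M0 : Z) (sgn : Z) (x : site) : Prop := in_box M0 x /\ fst x = (sgn * M0)%Z.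
Definition K2 (M0 : Z) (sgn : Z) (x : site) : Prop := in_box M0 x /\ snd x = (sgn * M0)%Z.

Definition barrier (M0 : Z) (x : site) : Prop :=
  K1 M0 1 x \/ K1 M0 (-1) x \/ K2 M0 1 x \/ K2 M0 (-1) x.

Definition non_penetrable {M0} (Cn : coin M0) : Prop :=
  forall (u : l2) (x : site),
    (K1 M0 1 x -> (walk Cn u : l2) (sadd x e1) dright = u x dleft) /\
    (K1 M0 (-1) x -> (walk Cn u : l2) (ssub x e1) dleft = u x dright) /\
    (K2 M0 1 x -> (walk Cn u : l2) (sadd x e2) dup = u x ddown) /\
    (K2 M0 (-1) x -> (walk Cn u : l2) (ssub x e2) ddown = u x dup).

(** [e^{-i kappa} (U(theta) - e^{-i kappa})^{-1}] *)
Definition loop_integrand {M0} (Cn : coin M0) (theta kappa : C) : BH :=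
  scal (Cexp (Copp (Cmult Ci kappa)) : C_AbsRing)
       (resolvent (dil_walk Cn theta) (Cexp (Copp (Cmult Ci kappa))) : bop_NormedModule _).

(* Main.v *)
Require Import Defs.
From Stdlib Require Import Reals ZArith.
From Coquelicot Require Import Coquelicot.
From Stdlib Require Import List FinFun Lra Lia Psatz.
From Stdlib Require Import FunctionalExtensionality PropExtensionality ClassicalEpsilon.
Open Scope R_scope.

(**
Write [U = walk Cnp], [W = dil_walk Cnp theta], [z0 = e^{-i mu0}] and [r = eps^s].  The difference of
the two resolvents on the loop is at most [2 |R_np|^2 |U_eps(theta) - W|] as soon as the product
[|R_np| |U_eps(theta) - W|] is at most 1/2.  The perturbation has norm [O(eps)], which is [O(r^2)]
because [s <= 1/2]; the loop stays at distance of order [r] from [mu0] and has length of order [r].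
Hence everything follows from the bound [|R_np| = O(1 / r)] on the loop, that is, from the fact that
[z0] is at most a simple pole of the resolvent of [W] ([dil_walk_resolvent_near]).

The barrier is what makes the pole simple.  Call a component [(x, j)] inside when it reaches the site
[x] of the box from another site of the box.  At a side of the box the coin sends the component coming
from outside straight back, and by unitarity nothing else enters or leaves; so [W] leaves the inside
and the outside components invariant, and the two parts can be bounded below separately.

- Outside, [W] moves each component along an outgoing trajectory, and the dilation multiplies it by a
  weight of modulus at most [exp (Im theta) < 1]: [exterior_contraction].

- Inside, the dilation is conjugation by a bounded invertible diagonal matrix ([undil_intertwines]),
  so it can be removed, and [U] is a unitary on a finite-dimensional space.  The bound
  [c |z - z0| |f| <= |(U - z) f|] is proved by compactness ([interior_lower_bound]): otherwise unit
  vectors violating it would converge to an eigenvector [g] for [z0], while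
  [approximate_eigenvector_far] keeps them away from [g], because [U] preserves inner products.

These estimates say that [W - z] is bounded below for [z] close to [z0] and for [|z| > 1].  For large
[z] it is invertible by a Neumann series, and invertibility is carried from infinity to [z] along a
ray on which the lower bounds are uniform ([resolvent_set_segment]).

Neumann series and contour integrals converge since bounded operators on l^2 form a complete space
([l2_banach], [bop_banach]).
*)

(** * Completeness of l^2 and of its bounded operators *)

(** Completeness as a property, so that it can pass from a space to the operators on it, and from
    a complex space to the real one underlying it: both have the same uniform structure. *)
Definition banach {K : AbsRing} (V : NormedModule K) : Prop :=
  forall F : (V -> Prop) -> Prop, ProperFilter F -> cauchy F ->
    exists x : V, forall eps : posreal, F (ball x eps).

Section Complete.
Context {K : AbsRing} {V : NormedModule K} (HV : banach V).

Definition banach_lim (F : (V -> Prop) -> Prop) : V :=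
  epsilon (A := V) (inhabits zero) (fun x : V => forall eps : posreal, F (ball x eps)).

Lemma banach_lim_correct (F : (V -> Prop) -> Prop) :
  ProperFilter F -> cauchy F -> forall eps : posreal, F (ball (banach_lim F) eps).
Proof.
  intros H1 H2; unfold banach_lim.
  exact (epsilon_spec (A := V) (inhabits zero) (fun x : V => forall eps : posreal, F (ball x eps))
    (HV F H1 H2)).
Qed.

Lemma banach_lim_ext (F1 F2 : (V -> Prop) -> Prop) :
  filter_le F1 F2 -> filter_le F2 F1 -> close (banach_lim F1) (banach_lim F2).
Proof.
  (* [banach_lim] depends on [F] only through its members *)
  intros H12 H21; replace F2 with F1; [apply close_refl | ].
  apply functional_extensionality; intros P; apply propositional_extensionality.
  split; [apply H21 | apply H12].
Qed.

Definition banach_CompleteNormedModule : CompleteNormedModule K :=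
  CompleteNormedModule.Pack K V
    (CompleteNormedModule.Class K V (NormedModule.class K V)
       (CompleteSpace.Mixin V banach_lim banach_lim_correct banach_lim_ext)) V.

Lemma banach_ex_series (a : nat -> V) (b : nat -> R) :
  (forall n, norm (a n) <= b n) -> ex_series b -> ex_series a.
Proof. exact (ex_series_le (V := banach_CompleteNormedModule) a b). Qed.

End Complete.

Lemma banach_ex_RInt {V : NormedModule R_AbsRing} (HV : banach V) (f : R -> V) (a b : R) :
  (forall z, Rmin a b <= z <= Rmax a b -> continuous f z) -> ex_RInt f a b.
Proof. exact (ex_RInt_continuous (V := banach_CompleteNormedModule HV) f a b). Qed.

Lemma C_banach : banach C_NormedModule.
Proof.
  intros F HF Hc; exists (lim (T := C_CompleteNormedModule) F).
  apply (complete_cauchy (T := C_CompleteNormedModule) F HF Hc).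
Qed.

Lemma norm_minus_trans {K : AbsRing} {V : NormedModule K} (x y z : V) :
  norm (minus x z) <= norm (minus x y) + norm (minus y z).
Proof. rewrite (minus_trans y x z); apply norm_triangle. Qed.

Lemma norm_minus_sym {K : AbsRing} {V : NormedModule K} (x y : V) :
  norm (minus x y) = norm (minus y x).
Proof. now rewrite <- opp_minus, norm_opp. Qed.

Lemma norm_minus_eq_0 {K : AbsRing} {V : NormedModule K} (x y : V) :
  norm (minus x y) = 0 -> x = y.
Proof.
  intros H; apply norm_eq_zero in H; apply (plus_reg_r (opp y)).
  rewrite (plus_opp_r y); exact H.
Qed.

Lemma minus_plus_plus {G : AbelianGroup} (a b c d : G) :
  minus (plus a b) (plus c d) = plus (minus a c) (minus b d).
Proof.
  unfold minus; rewrite opp_plus, !plus_assoc; f_equal.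
  rewrite <- !plus_assoc; f_equal; apply plus_comm.
Qed.

Lemma norm_minus_plus {K : AbsRing} {V : NormedModule K} (a b c d : V) :
  norm (minus (plus a b) (plus c d)) <= norm (minus a c) + norm (minus b d).
Proof.
  eapply Rle_trans; [ | apply norm_triangle].
  right; f_equal; apply (minus_plus_plus (G := NormedModule.AbelianGroup K V)).
Qed.

Lemma norm_minus_scal {K : AbsRing} {V : NormedModule K} (k : K) (a b : V) :
  norm (minus (scal k a) (scal k b)) <= abs k * norm (minus a b).
Proof.
  eapply Rle_trans; [ | apply norm_scal].
  right; f_equal; symmetry; apply (scal_minus_distr_l (V := NormedModule.ModuleSpace K V)).
Qed.

Lemma plus_minus {G : AbelianGroup} (a b : G) : plus (minus a b) b = a.
Proof. unfold minus; rewrite <- plus_assoc, plus_opp_l; apply plus_zero_r. Qed.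

Lemma norm_le_minus {K : AbsRing} {V : NormedModule K} (a b : V) :
  norm a <= norm (minus a b) + norm b.
Proof.
  rewrite <- (plus_minus (G := NormedModule.AbelianGroup K V) a b) at 1.
  apply (norm_triangle (V := V)).
Qed.

Lemma le_of_all_eps (x y : R) : (forall e, 0 < e -> x <= y + e) -> x <= y.
Proof.
  intros H; destruct (Rle_lt_dec x y) as [| Hlt]; [easy | ].
  specialize (H ((x - y) / 2)); lra.
Qed.

(** Limits in a space of functions are built from the limits of the values, evaluation at a point
    being a Lipschitz map [f]. *)
Lemma banach_lipschitz_lim {K L : AbsRing} {T : NormedModule K} {V : NormedModule L}
  (HV : banach V) (F : (T -> Prop) -> Prop) (f : T -> V) (k : R) :
  ProperFilter F -> cauchy F -> 
  (forall x y, norm (minus (f y) (f x)) <= k * norm (minus y x)) ->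
  exists l : V, forall e, 0 < e -> F (fun x => norm (minus (f x) l) < e).
Proof.
  intros HF Hc Hk.
  assert (Hn : forall x y : T, 0 <= norm (minus y x)) by (intros; apply norm_ge_0).
  destruct (HV (filtermap f F)) as [l Hl].
  - now apply filtermap_proper_filter.
  - intros e; pose proof (@norm_factor_gt_0 _ T) as HT.
    assert (Hd : 0 < e / (@norm_factor _ T * (Rabs k + 1))).
    { apply Rdiv_lt_0_compat; [apply cond_pos | ].
      pose proof (Rabs_pos k); apply Rmult_lt_0_compat; lra. }
    destruct (Hc (mkposreal _ Hd)) as [x0 Hx0]; exists (f x0).
    unfold filtermap; revert Hx0; apply filter_imp; intros x Hx.
    apply norm_compat1; eapply Rle_lt_trans; [apply Hk | ].
    apply norm_compat2 in Hx; simpl in Hx.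
    apply Rle_lt_trans with ((Rabs k + 1) * norm (minus x x0)).
    + apply Rmult_le_compat_r; [apply Hn | pose proof (Rle_abs k); lra].
    + pose proof (Rabs_pos k).
      apply (Rmult_lt_compat_l (Rabs k + 1)) in Hx; [ | lra].
      eapply Rlt_le_trans; [exact Hx | ]; right; field; split; lra.
  - exists l; intros e He; pose proof (@norm_factor_gt_0 _ V) as HT.
    assert (Hd : 0 < e / @norm_factor _ V) by now apply Rdiv_lt_0_compat.
    specialize (Hl (mkposreal _ Hd)); unfold filtermap in Hl.
    revert Hl; apply filter_imp; intros x Hx; apply norm_compat2 in Hx; simpl in Hx.
    eapply Rlt_le_trans; [exact Hx | ]; right; field; lra.
Qed.

(** The limit of a Cauchy family of operators exists pointwise, and is bounded since it
    stays uniformly close to any operator to which a tail of the family is close. *)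
Lemma bop_banach (V : NormedModule C_AbsRing) : banach V -> banach (bop_NormedModule V).
Proof.
  intros HV F HF Hc.
  assert (HL : exists L : V -> V, forall u e, 0 < e ->
            F (fun A : bounded_op V => norm (minus (A u) (L u)) < e)).
  { apply (choice (fun u l => forall e, 0 < e ->
            F (fun A : bounded_op V => norm (minus (A u) l) < e))); intros u.
    apply (banach_lipschitz_lim HV F (fun A : bounded_op V => A u) (norm u) HF Hc).
    intros A B; rewrite Rmult_comm; apply (bop_norm_apply V (minus B A) u). }
  destruct HL as [L HL].
  assert (Hnear : forall (A0 : bounded_op V) d, F (fun A => bop_norm V (minus A A0) < d) ->
            forall u, norm (minus (L u) (A0 u)) <= d * norm u).
  { intros A0 d HA u; apply le_of_all_eps; intros e He.
    destruct (filter_ex _ (filter_and _ _ HA (HL u e He))) as [A [H1 H2]].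
    eapply Rle_trans; [apply (norm_minus_trans _ (A u)) | ].
    rewrite norm_minus_sym.
    pose proof (bop_norm_apply V (minus A A0) u) as H3.
    change (norm (minus (A u) (A0 u)) <= bop_norm V (minus A A0) * norm u) in H3.
    pose proof (norm_ge_0 u).
    assert (bop_norm V (minus A A0) * norm u <= d * norm u)
      by (apply Rmult_le_compat_r; [lra | left; exact H1]).
    lra. }
  assert (Hlin : is_linear L).
  { constructor.
    - intros u v; apply norm_minus_eq_0, Rle_antisym; [ | apply norm_ge_0].
      apply le_of_all_eps; intros e He.
      assert (He3 : 0 < e / 3) by lra.
      destruct (filter_ex _ (filter_and _ _ (HL (plus u v) _ He3)
                  (filter_and _ _ (HL u _ He3) (HL v _ He3)))) as [A [H1 [H2 H3]]].
      eapply Rle_trans; [apply (norm_minus_trans _ (A (plus u v))) | ].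
      rewrite norm_minus_sym, (linear_plus A (bop_linear V A)).
      rewrite (linear_plus A (bop_linear V A)) in H1.
      eapply Rle_trans;
        [apply Rplus_le_compat; [left; exact H1 | apply norm_minus_plus] | lra].
    - intros k u; apply norm_minus_eq_0, Rle_antisym; [ | apply norm_ge_0].
      apply le_of_all_eps; intros e He.
      pose proof (abs_ge_0 k) as Hk.
      assert (He2 : 0 < e / 2) by lra.
      assert (He3 : 0 < e / 2 / (abs k + 1)) by (apply Rdiv_lt_0_compat; lra).
      destruct (filter_ex _ (filter_and _ _ (HL (scal k u) _ He2) (HL u _ He3)))
        as [A [H1 H2]].
      eapply Rle_trans; [apply (norm_minus_trans _ (A (scal k u))) | ].
      rewrite norm_minus_sym, (linear_scal A (bop_linear V A)).
      rewrite (linear_scal A (bop_linear V A)) in H1.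
      assert (abs k * norm (minus (A u) (L u)) <= e / 2).
      { apply Rle_trans with ((abs k + 1) * (e / 2 / (abs k + 1))); [ | right; field; lra].
        apply Rmult_le_compat; try lra; try apply norm_ge_0; left; exact H2. }
      eapply Rle_trans;
        [apply Rplus_le_compat; [left; exact H1 | apply norm_minus_scal] | lra].
    - destruct (Hc (mkposreal 1 Rlt_0_1)) as [A0 HA].
      exists (bop_norm V A0 + 1); pose proof (bop_norm_ge_0 V A0); split; [lra | ]; intros u.
      pose proof (Hnear A0 1 HA u); pose proof (bop_norm_apply V A0 u).
      pose proof (norm_le_minus (L u) (A0 u)); lra. }
  exists (mk_bop L Hlin); intros e.
  assert (He : 0 < e / 3) by (pose proof (cond_pos e); lra).
  destruct (Hc (mkposreal _ He)) as [A0 HA].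
  generalize HA; apply filter_imp; intros A H.
  change (bop_norm V (minus A (mk_bop L Hlin)) < e).
  change (bop_norm V (minus A A0) < e / 3) in H.
  pose proof (norm_minus_trans (V := bop_NormedModule V) A A0 (mk_bop L Hlin)) as H1.
  change (bop_norm V (minus A (mk_bop L Hlin))
    <= bop_norm V (minus A A0) + bop_norm V (minus A0 (mk_bop L Hlin))) in H1.
  assert (bop_norm V (minus A0 (mk_bop L Hlin)) <= e / 3).
  { apply bop_norm_le; [lra | ]; intros u.
    change (norm (minus (A0 u) (L u)) <= e / 3 * norm u).
    rewrite norm_minus_sym; apply (Hnear A0 (e / 3) HA u). }
  lra.
Qed.

Lemma l2_component_le (u : l2) x j : Cmod (u x j) <= l2_norm u.
Proof.
  assert (Hnd : NoDup (x :: nil)) by (constructor; [simpl; tauto | constructor]).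
  destruct (l2_norm_lub u) as [H0 [H _]]; specialize (H _ Hnd); simpl in H; rewrite Rmult_1_r in H.
  apply Rsqr_incr_0_var; [ | exact H0]; unfold Rsqr.
  assert (Cmod (u x j) * Cmod (u x j) <= normsq4 (u x)); [ | lra].
  unfold normsq4.
  pose proof (pow2_ge_0 (Cmod (u x dleft))); pose proof (pow2_ge_0 (Cmod (u x dright))).
  pose proof (pow2_ge_0 (Cmod (u x ddown))); pose proof (pow2_ge_0 (Cmod (u x dup))).
  destruct j; nra.
Qed.

(** The limit is taken componentwise; finite partial sums control its distance to a member of the
    Cauchy family, hence also its square summability. *)
Lemma l2_banach : banach l2_NormedModule.
Proof.
  intros F HF Hc.
  assert (HL : forall p : site * dir, exists l : C, forall e, 0 < e ->
            F (fun u : l2 => Cmod (Cminus (u (fst p) (snd p)) l) < e)).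
  { intros [x j].
    apply (banach_lipschitz_lim C_banach F (fun u : l2 => u x j : C_NormedModule) 1 HF Hc).
    intros u v; rewrite Rmult_1_l.
    eapply Rle_trans; [ | apply (l2_component_le (minus v u) x j)]; right.
    change (Cmod (Cminus (v x j) (u x j)) = Cmod (Cplus (v x j) (Cmult (Copp (RtoC 1)) (u x j)))).
    f_equal; ring. }
  apply choice in HL; destruct HL as [g' HL].
  set (g := fun x j => g' (x, j)).
  assert (Hg : forall x j e, 0 < e -> F (fun u : l2 => Cmod (Cminus (u x j) (g x j)) < e))
    by (intros x j; apply (HL (x, j))).
  clearbody g; clear g' HL.
  (* On finitely many sites the family converges uniformly to its pointwise limit. *)
  assert (Hl : forall l e, 0 < e ->
            F (fun u : l2 => lsum (fun x => normsq4 (fun j => Cminus (u x j) (g x j))) l < e)).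
  { induction l as [ | x l IH]; intros e He.
    - apply filter_forall; intros u; exact He.
    - assert (He2 : 0 < e / 2) by lra; specialize (IH _ He2).
      assert (He8 : 0 < sqrt (e / 8)) by (apply sqrt_lt_R0; lra).
      generalize (filter_and _ _ IH (filter_and _ _
        (filter_and _ _ (Hg x dleft _ He8) (Hg x dright _ He8))
        (filter_and _ _ (Hg x ddown _ He8) (Hg x dup _ He8)))).
      apply filter_imp; intros u [H [[H1 H2] [H3 H4]]]; simpl.
      assert (Q : forall c, Cmod c < sqrt (e / 8) -> Cmod c ^ 2 < e / 8).
      { intros c Hc'; rewrite <- (pow2_sqrt (e / 8)) by lra.
        pose proof (Cmod_ge_0 c); nra. }
      apply Q in H1, H2, H3, H4; unfold normsq4 at 1; lra. }
  assert (Hnear : forall (u0 : l2) d, 0 <= d -> F (fun u => l2_norm (minus u u0) < d) ->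
            sum_le (fun x => normsq4 (fun j => Cminus (g x j) (u0 x j))) (d ^ 2)).
  { intros u0 d Hd HF0 l Hnd.
    set (S := lsum _ l).
    assert (HS : 0 <= S) by (apply lsum_ge_0; intros; apply normsq4_ge_0).
    rewrite <- (pow2_sqrt S HS); apply pow_incr; split; [apply sqrt_pos | ].
    apply le_of_all_eps; intros e He.
    destruct (filter_ex _ (filter_and _ _ HF0 (Hl l (e ^ 2) ltac:(nra)))) as [u [H1 H2]].
    set (fg := fun x => sqrt (normsq4 (fun j => Cminus (u x j) (g x j)))).
    set (fu := fun x => sqrt (normsq4 (fun j => Cminus (u x j) (u0 x j)))).
    assert (HM : sqrt S <= sqrt (lsum (fun x => fu x ^ 2) l) + sqrt (lsum (fun x => fg x ^ 2) l)).
    { eapply Rle_trans; [ | apply lsum_minkowski; intros; apply sqrt_pos].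
      apply sqrt_le_1_alt, lsum_le; intros x.
      rewrite <- (pow2_sqrt (normsq4 _)) by apply normsq4_ge_0.
      apply pow_incr; split; [apply sqrt_pos | ].
      replace (normsq4 (fun j => Cminus (g x j) (u0 x j)))
        with (normsq4 (fun j => Cplus (Cminus (u x j) (u0 x j)) (Copp (Cminus (u x j) (g x j))))).
      - eapply Rle_trans; [apply normsq4_triangle | ]; unfold fu, fg.
        apply Rplus_le_compat_l; right; f_equal; unfold normsq4; now rewrite !Cmod_opp.
      - f_equal; apply functional_extensionality; intros j; ring. }
    assert (E : forall w : field, lsum (fun x => sqrt (normsq4 (w x)) ^ 2) l
                        = lsum (fun x => normsq4 (w x)) l).
    { intros w; apply Rle_antisym; apply lsum_le; intros x;
        rewrite pow2_sqrt; auto using normsq4_ge_0; lra. }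
    unfold fu, fg in HM.
    rewrite (E (fun x j => Cminus (u x j) (u0 x j))), (E (fun x j => Cminus (u x j) (g x j))) in HM.
    assert (T1 : sqrt (lsum (fun x => normsq4 (fun j => Cminus (u x j) (g x j))) l) <= e).
    { rewrite <- (sqrt_pow2 e) by lra; apply sqrt_le_1_alt; lra. }
    assert (T2 : sqrt (lsum (fun x => normsq4 (fun j => Cminus (u x j) (u0 x j))) l) <= d).
    { eapply Rle_trans; [ | left; exact H1].
      destruct (l2_norm_lub (minus u u0)) as [P0 [P1 _]].
      rewrite <- (sqrt_pow2 (l2_norm (minus u u0))) by exact P0; apply sqrt_le_1_alt.
      eapply Rle_trans; [ | apply (P1 l Hnd)]; right.
      apply f_equal2; [ | reflexivity]; apply functional_extensionality; intros x.
      apply f_equal; apply functional_extensionality; intros j.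
      change (Cminus (u x j) (u0 x j) = Cplus (u x j) (Cmult (Copp (RtoC 1)) (u0 x j))); ring. }
    lra. }
  assert (Hsum : square_summable g).
  { destruct (Hc (mkposreal 1 Rlt_0_1)) as [u0 H0].
    specialize (Hnear u0 1 Rle_0_1 H0).
    destruct (l2_norm_lub u0) as [P0 [P1 _]].
    exists ((1 + l2_norm u0) ^ 2).
    replace g with (field_plus (fun x j => Cminus (g x j) (u0 x j)) u0).
    - apply field_plus_sum_le; auto; lra.
    - apply functional_extensionality; intros x; apply functional_extensionality; intros j.
      unfold field_plus; ring. }
  exists (mk_l2 g Hsum); intros e.
  assert (He : 0 < e / 3) by (pose proof (cond_pos e); lra).
  destruct (Hc (mkposreal _ He)) as [u0 H0].
  generalize H0; apply filter_imp; intros u H.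
  change (l2_norm (minus u (mk_l2 g Hsum)) < e).
  change (l2_norm (minus u u0) < e / 3) in H.
  pose proof (norm_minus_trans (V := l2_NormedModule) u u0 (mk_l2 g Hsum)) as H1.
  assert (H2 : norm (minus u0 (mk_l2 g Hsum) : l2_NormedModule) <= e / 3).
  { rewrite norm_minus_sym.
    apply l2_norm_lub; [lra | ].
    specialize (Hnear u0 (e / 3) ltac:(lra) H0).
    intros l Hnd; eapply Rle_trans; [ | apply (Hnear l Hnd)]; right.
    apply f_equal2; [ | reflexivity]; apply functional_extensionality; intros x.
    apply f_equal; apply functional_extensionality; intros j.
    change (Cplus (g x j) (Cmult (Copp (RtoC 1)) (u0 x j)) = Cminus (g x j) (u0 x j)); ring. }
  change (l2_norm (minus u (mk_l2 g Hsum))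
    <= l2_norm (minus u u0) + norm (minus u0 (mk_l2 g Hsum) : l2_NormedModule)) in H1.
  lra.
Qed.

(** * Neumann series and stability of resolvents *)

Lemma minus_plus_l {G : AbelianGroup} (a b : G) : minus a (plus a b) = opp b.
Proof.
  unfold minus; rewrite opp_plus, plus_assoc.
  transitivity (plus zero (opp b)); [ | apply plus_zero_l].
  f_equal; apply plus_opp_r.
Qed.

Lemma minus_minus_l {G : AbelianGroup} (a b : G) : minus (minus a b) a = opp b.
Proof.
  unfold minus; rewrite plus_comm, plus_assoc.
  transitivity (plus zero (opp b)); [ | apply plus_zero_l].
  f_equal; apply plus_opp_l.
Qed.

Lemma shift_both {G : AbelianGroup} (a b w z : G) :
  plus (minus a z) (minus (minus b a) (minus w z)) = minus b w.
Proof.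
  unfold minus at 3 4; rewrite (minus_plus_plus b).
  replace (minus (opp a) (opp z)) with (opp (minus a z))
    by (unfold minus; apply opp_plus).
  rewrite plus_comm, <- plus_assoc, plus_opp_l; apply plus_zero_r.
Qed.

Section BanachResolvent.
Variable V : NormedModule C_AbsRing.
Notation BV := (bop_NormedModule V).
Implicit Types A B T E G : bounded_op V.

Lemma bop_norm_comp A B : bop_norm V (bop_comp A B) <= bop_norm V A * bop_norm V B.
Proof.
  pose proof (bop_norm_ge_0 V A); pose proof (bop_norm_ge_0 V B).
  apply bop_norm_le; [now apply Rmult_le_pos | intros u; simpl].
  eapply Rle_trans; [apply bop_norm_apply | ].
  rewrite Rmult_assoc; apply Rmult_le_compat_l; [easy | apply bop_norm_apply].
Qed.

Lemma bop_norm_id : bop_norm V (bop_id V) <= 1.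
Proof. apply bop_norm_le; [lra | intros u; simpl; lra]. Qed.

Lemma bop_comp_assoc A B T : bop_comp A (bop_comp B T) = bop_comp (bop_comp A B) T.
Proof. now apply bop_ext. Qed.

Lemma bop_comp_id_l A : bop_comp (bop_id V) A = A.
Proof. now apply bop_ext. Qed.

Lemma bop_comp_id_r A : bop_comp A (bop_id V) = A.
Proof. now apply bop_ext. Qed.

Lemma bop_apply_opp A u : A (opp u) = opp (A u).
Proof. apply (linear_opp A u (bop_linear V A)). Qed.

Lemma bop_comp_plus_l A B T :
  bop_comp (plus A B) T = plus (bop_comp A T) (bop_comp B T) :> BV.
Proof. now apply bop_ext. Qed.

Lemma bop_comp_plus_r A B T :
  bop_comp A (plus B T) = plus (bop_comp A B) (bop_comp A T) :> BV.
Proof. apply bop_ext; intros u; apply (linear_plus A (bop_linear V A)). Qed.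

Lemma bop_comp_minus_l A B T :
  bop_comp (minus A B) T = minus (bop_comp A T) (bop_comp B T) :> BV.
Proof. now apply bop_ext. Qed.

Lemma bop_comp_minus_r A B T :
  bop_comp A (minus B T) = minus (bop_comp A B) (bop_comp A T) :> BV.
Proof.
  apply bop_ext; intros u; simpl.
  rewrite (linear_plus A (bop_linear V A)); f_equal; apply bop_apply_opp.
Qed.

Fixpoint bop_pow B n : bounded_op V :=
  match n with O => bop_id V | S n => bop_comp B (bop_pow B n) end.

Lemma bop_pow_norm B n : bop_norm V (bop_pow B n) <= bop_norm V B ^ n.
Proof.
  induction n as [ | n IH]; simpl; [apply bop_norm_id | ].
  eapply Rle_trans; [apply bop_norm_comp | ].
  apply Rmult_le_compat_l; [apply bop_norm_ge_0 | exact IH].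
Qed.

Lemma bop_pow_comm B n : bop_comp (bop_pow B n) B = bop_comp B (bop_pow B n).
Proof.
  induction n as [ | n IH]; simpl; [now apply bop_ext | ].
  now rewrite <- bop_comp_assoc, IH.
Qed.

Lemma is_inverse_unique A B T : is_inverse V A B -> is_inverse V A T -> B = T.
Proof.
  intros [_ H1] [H2 _].
  now rewrite <- (bop_comp_id_r B), <- H2, bop_comp_assoc, H1, bop_comp_id_l.
Qed.

Lemma bop_inv_correct A : (exists B, is_inverse V A B) -> is_inverse V A (bop_inv V A).
Proof. intros H; unfold bop_inv; now apply epsilon_spec. Qed.

Lemma bop_inv_unique A B : is_inverse V A B -> bop_inv V A = B.
Proof.
  intros H; apply (is_inverse_unique A); [apply bop_inv_correct; now exists B | exact H].
Qed.

Hypothesis HV : banach V.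

(** The partial sums of the powers of [B] are inverses of [1 - B] up to the next power of [B]. *)
Lemma neumann B : bop_norm V B <= 1 / 2 ->
  exists G, is_inverse V (minus (bop_id V) B) G /\ bop_norm V G <= 2.
Proof.
  intros HB; pose proof (bop_norm_ge_0 V B) as HB0.
  assert (HP : forall n, bop_norm V (bop_pow B n) <= (1 / 2) ^ n).
  { intros n; eapply Rle_trans; [apply bop_pow_norm | apply pow_incr; lra]. }
  destruct (banach_ex_series (bop_banach V HV) (bop_pow B : nat -> BV) (fun n => (1 / 2) ^ n))
    as [G HG].
  { exact HP. }
  { apply ex_series_geom; rewrite Rabs_pos_eq; lra. }
  set (S := fun n => sum_n (bop_pow B : nat -> BV) n).
  assert (HS : forall n,
    bop_comp (minus (bop_id V) B) (S n) = minus (bop_id V) (bop_pow B (n + 1)) :> BV /\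
    bop_comp (S n) (minus (bop_id V) B) = minus (bop_id V) (bop_pow B (n + 1)) :> BV).
  { assert (Hshift : forall a b c d : BV, c = d -> plus (minus a b) (minus b c) = minus a d).
    { intros a b c d ->; unfold minus.
      rewrite <- plus_assoc; f_equal; rewrite plus_assoc, plus_opp_l; apply plus_zero_l. }
    induction n as [ | n [IH1 IH2]].
    - unfold S; rewrite sum_O; split; now apply bop_ext.
    - unfold S in *; rewrite sum_Sn, bop_comp_plus_r, bop_comp_plus_l, IH1, IH2.
      replace (n + 1)%nat with (Datatypes.S n) by lia.
      replace (Datatypes.S n + 1)%nat with (Datatypes.S (Datatypes.S n)) by lia.
      rewrite bop_comp_minus_l, bop_comp_minus_r, bop_comp_id_l, bop_comp_id_r.
      split; apply Hshift; [easy | ]; now rewrite bop_pow_comm. }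
  assert (Hlim : forall e, 0 < e -> exists n,
            bop_norm V (minus (S n) G) < e /\ bop_norm V (bop_pow B (n + 1)) < e).
  { intros e He.
    assert (H1 : eventually (fun n => bop_norm V (minus (S n) G) < e)).
    { apply (HG (fun A => bop_norm V (minus A G) < e)).
      exists (mkposreal e He); intros A HA; exact HA. }
    assert (H2 : eventually (fun n => bop_norm V (bop_pow B (n + 1)) < e)).
    { assert (Hg : is_lim_seq (fun n => (1 / 2) ^ n) 0)
        by (apply is_lim_seq_geom; rewrite Rabs_pos_eq; lra).
      destruct (Hg (fun x => x < e)) as [N HN].
      - exists (mkposreal e He); intros y Hy.
        change (Rabs (y - 0) < e) in Hy; apply Rabs_lt_between in Hy; lra.
      - exists N; intros n Hn; eapply Rle_lt_trans; [apply HP | apply HN; lia]. }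
    destruct H1 as [N1 H1], H2 as [N2 H2]; exists (max N1 N2); split;
      [apply H1 | apply H2]; lia. }
  set (D := minus (bop_id V) B : BV).
  assert (Hclose : forall X Y : BV, (forall n, bop_norm V (minus X Y) <=
        bop_norm V D * bop_norm V (minus (S n) G) + bop_norm V (bop_pow B (n + 1))) -> X = Y).
  { intros X Y H; apply (norm_minus_eq_0 (V := BV)), Rle_antisym; [ | apply norm_ge_0].
    apply le_of_all_eps; intros e He.
    pose proof (bop_norm_ge_0 V D) as HD.
    assert (He' : 0 < e / (bop_norm V D + 1)) by (apply Rdiv_lt_0_compat; lra).
    destruct (Hlim _ He') as [n [H1 H2]]; specialize (H n).
    change (norm (minus X Y)) with (bop_norm V (minus X Y)).
    eapply Rle_trans; [exact H | ].
    apply Rle_trans with (bop_norm V D * (e / (bop_norm V D + 1)) + e / (bop_norm V D + 1)).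
    - apply Rplus_le_compat; [apply Rmult_le_compat_l | ]; lra.
    - right; field; lra. }
  assert (Hinv : is_inverse V D G).
  { split; apply Hclose; intros n; destruct (HS n) as [H1 H2]; fold D in H1, H2.
    - eapply Rle_trans; [apply (norm_minus_trans (V := BV) _ (bop_comp D (S n))) | ].
      apply Rplus_le_compat.
      + rewrite <- bop_comp_minus_r.
        change (bop_norm V (bop_comp D (minus G (S n))) <= bop_norm V D * bop_norm V (minus (S n) G)).
        eapply Rle_trans; [apply bop_norm_comp | ].
        right; f_equal; apply (norm_minus_sym (V := BV)).
      + rewrite H1.
        rewrite <- (bop_norm_opp V (bop_pow B (n + 1))); right.
        apply (f_equal (bop_norm V)), (minus_minus_l (G := bop_AbelianGroup V)).
    - eapply Rle_trans; [apply (norm_minus_trans (V := BV) _ (bop_comp (S n) D)) | ].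
      apply Rplus_le_compat.
      + rewrite <- bop_comp_minus_l.
        change (bop_norm V (bop_comp (minus G (S n)) D) <= bop_norm V D * bop_norm V (minus (S n) G)).
        eapply Rle_trans; [apply bop_norm_comp | ].
        rewrite Rmult_comm; right; f_equal; apply (norm_minus_sym (V := BV)).
      + rewrite H2.
        rewrite <- (bop_norm_opp V (bop_pow B (n + 1))); right.
        apply (f_equal (bop_norm V)), (minus_minus_l (G := bop_AbelianGroup V)). }
  exists G; split; [exact Hinv | ].
  assert (HGB : G = plus (bop_id V) (bop_comp G B) :> BV).
  { destruct Hinv as [_ H]; unfold D in H; rewrite <- H, bop_comp_minus_r, bop_comp_id_r.
    symmetry; apply (plus_minus (G := bop_AbelianGroup V)). }
  pose proof (bop_norm_plus V (bop_id V) (bop_comp G B)) as H1.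
  change (bop_norm V (plus (bop_id V) (bop_comp G B) : BV)
    <= bop_norm V (bop_id V) + bop_norm V (bop_comp G B)) in H1.
  rewrite <- HGB in H1.
  pose proof (bop_norm_comp G B); pose proof bop_norm_id; pose proof (bop_norm_ge_0 V G).
  nra.
Qed.

(** [T + E = T (1 + T' E)], to which the Neumann series applies. *)
Lemma inverse_perturb T T' E M :
  is_inverse V T T' -> bop_norm V T' <= M -> bop_norm V E * M <= 1 / 2 ->
  exists G, is_inverse V (plus T E) G /\ bop_norm V G <= 2 * M /\
    bop_norm V (minus G T') <= 2 * M ^ 2 * bop_norm V E.
Proof.
  intros [H1 H2] HM HE.
  pose proof (bop_norm_ge_0 V E) as HE0; pose proof (bop_norm_ge_0 V T') as HT0.
  destruct (neumann (bop_opp V (bop_comp T' E))) as [G0 [[H3 H4] HG0]].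
  { rewrite bop_norm_opp; eapply Rle_trans; [apply bop_norm_comp | ]; nra. }
  assert (HD : minus (bop_id V) (bop_opp V (bop_comp T' E)) = bop_comp T' (plus T E) :> BV).
  { rewrite bop_comp_plus_r, H2; unfold minus; f_equal.
    apply (opp_opp (G := bop_AbelianGroup V)). }
  assert (HD' : bop_comp T (minus (bop_id V) (bop_opp V (bop_comp T' E))) = plus T E :> BV).
  { rewrite HD, bop_comp_assoc, H1; apply bop_comp_id_l. }
  assert (Hinv : is_inverse V (plus T E) (bop_comp G0 T')).
  { split.
    - rewrite <- HD', <- bop_comp_assoc, (bop_comp_assoc _ G0 T'), H3, bop_comp_id_l; exact H1.
    - rewrite <- bop_comp_assoc, <- HD; exact H4. }
  assert (HGn : bop_norm V (bop_comp G0 T') <= 2 * M).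
  { eapply Rle_trans; [apply bop_norm_comp | ].
    pose proof (bop_norm_ge_0 V G0); apply Rmult_le_compat; auto. }
  exists (bop_comp G0 T'); split; [exact Hinv | split; [exact HGn | ]].
  set (G := bop_comp G0 T') in *.
  assert (HR : minus G T' = bop_opp V (bop_comp G (bop_comp E T')) :> BV).
  { destruct Hinv as [_ H5].
    assert (H6 : T' = plus G (bop_comp G (bop_comp E T')) :> BV).
    { rewrite <- (bop_comp_id_l T') at 1; rewrite <- H5, <- bop_comp_assoc.
      rewrite bop_comp_plus_l, H1, bop_comp_plus_r, bop_comp_id_r; reflexivity. }
    rewrite H6 at 1; apply (minus_plus_l (G := bop_AbelianGroup V)). }
  rewrite HR, bop_norm_opp.
  eapply Rle_trans; [apply bop_norm_comp | ].
  pose proof (bop_norm_comp E T'); pose proof (bop_norm_ge_0 V (bop_comp E T')).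
  pose proof (bop_norm_ge_0 V G).
  apply Rle_trans with (2 * M * (bop_norm V E * M)); [ | right; ring].
  apply Rmult_le_compat; auto.
  eapply Rle_trans; [eassumption | ]; now apply Rmult_le_compat_l.
Qed.

Lemma resolvent_inverse A z : in_resolvent_set A z -> is_inverse V (shifted V A z) (resolvent A z).
Proof. apply bop_inv_correct. Qed.

(** The shifted operators differ by at most [|B - A| + |w - z|].  The case [B = A] gives the
    continuity of the resolvent, the case [w = z] compares two walks. *)
Lemma resolvent_perturb A B z w M :
  in_resolvent_set A z -> bop_norm V (resolvent A z) <= M ->
  (bop_norm V (minus B A) + Cmod (Cminus w z)) * M <= 1 / 2 ->
  in_resolvent_set B w /\ bop_norm V (resolvent B w) <= 2 * M /\
  bop_norm V (minus (resolvent B w) (resolvent A z))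
    <= 2 * M ^ 2 * (bop_norm V (minus B A) + Cmod (Cminus w z)).
Proof.
  intros HA HM Hd; apply resolvent_inverse in HA.
  set (E := minus (minus B A) (scal (Cminus w z : C_AbsRing) (bop_id V : BV)) : BV).
  assert (HE : bop_norm V E <= bop_norm V (minus B A) + Cmod (Cminus w z)).
  { eapply Rle_trans; [apply bop_norm_plus | ]; apply Rplus_le_compat_l.
    change (bop_norm V (bop_opp V (bop_scal V (Cminus w z) (bop_id V))) <= Cmod (Cminus w z)).
    rewrite bop_norm_opp; eapply Rle_trans; [apply bop_norm_scal | ].
    pose proof bop_norm_id; pose proof (Cmod_ge_0 (Cminus w z)); nra. }
  pose proof (bop_norm_ge_0 V (resolvent A z)) as HR0.
  destruct (inverse_perturb (shifted V A z) (resolvent A z) E M HA HM) as [G [HG [HG1 HG2]]].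
  { pose proof (bop_norm_ge_0 V E); nra. }
  assert (HS : plus (shifted V A z) E = shifted V B w :> BV).
  { unfold shifted, E; apply bop_ext; intros u.
    replace (scal (Cminus w z : C_AbsRing) (bop_id V : BV))
      with (minus (scal (w : C_AbsRing) (bop_id V : BV)) (scal (z : C_AbsRing) (bop_id V : BV))).
    - now rewrite (shift_both (G := bop_AbelianGroup V)).
    - symmetry; exact (scal_minus_distr_r (w : C_AbsRing) z (bop_id V : BV)). }
  rewrite HS in HG.
  assert (HRB : resolvent B w = G) by now apply bop_inv_unique.
  rewrite HRB; split; [now exists G | split; [exact HG1 | ]].
  eapply Rle_trans; [exact HG2 | ].
  apply Rmult_le_compat_l; [ | exact HE].
  pose proof (pow2_ge_0 M); lra.
Qed.
End BanachResolvent.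

(** * Continuation and continuity of resolvents, contour integrals *)

Section BanachSpectrum.
Variable V : NormedModule C_AbsRing.
Notation BV := (bop_NormedModule V).
Hypothesis HV : banach V.

Lemma bop_norm_minus_diag (A : bounded_op V) : bop_norm V (minus A A) = 0.
Proof. rewrite (minus_eq_zero (G := bop_AbelianGroup V) A); exact (bop_norm_zero V). Qed.

(** [A] is here a small perturbation of the invertible operator [- z]. *)
Lemma resolvent_set_large (A : bounded_op V) (z : C) :
  0 < Cmod z -> 2 * bop_norm V A <= Cmod z -> in_resolvent_set A z.
Proof.
  intros Hz HA.
  assert (Hz0 : z <> RtoC 0) by (intros ->; rewrite Cmod_0 in Hz; lra).
  assert (Hi : forall c d, Cmult c d = RtoC 1 ->
            bop_comp (bop_scal V c (bop_id V)) (bop_scal V d (bop_id V)) = bop_id V).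
  { intros c d H; apply bop_ext; intros u; simpl.
    rewrite (scal_assoc (c : C_AbsRing) d u).
    change (scal (Cmult c d : C_AbsRing) u = u); rewrite H; apply (scal_one (V := V)). }
  destruct (inverse_perturb V HV (bop_scal V (Copp z) (bop_id V))
              (bop_scal V (Copp (Cinv z)) (bop_id V)) A (/ Cmod z)) as [G [HG _]].
  - split; apply Hi; field; exact Hz0.
  - eapply Rle_trans; [apply bop_norm_scal | ].
    rewrite Cmod_opp, Cmod_inv by exact Hz0.
    pose proof (bop_norm_id V); assert (0 < / Cmod z) by now apply Rinv_0_lt_compat.
    nra.
  - apply (Rmult_le_reg_r (Cmod z)); [exact Hz | ].
    rewrite Rmult_assoc, Rinv_l; lra.
  - exists G; replace (shifted V A z) with (plus (bop_scal V (Copp z) (bop_id V)) A : BV);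
      [exact HG | ].
    unfold shifted, minus; rewrite plus_comm; apply (f_equal (fun B : BV => plus A B)).
    exact (scal_opp_l (z : C_AbsRing) (bop_id V : BV)).
Qed.

Lemma resolvent_bound_of_lower_bound (A : bounded_op V) z m :
  0 < m -> (forall u, m * norm u <= norm (shifted V A z u)) -> in_resolvent_set A z ->
  bop_norm V (resolvent A z) <= / m.
Proof.
  intros Hm Hlow Hz; destruct (resolvent_inverse V A z Hz) as [H _].
  apply bop_norm_le; [left; now apply Rinv_0_lt_compat | intros u].
  specialize (Hlow (resolvent A z u)).
  change (shifted V A z (resolvent A z u)) with (bop_comp (shifted V A z) (resolvent A z) u) in Hlow.
  rewrite H in Hlow; simpl in Hlow.
  apply (Rmult_le_reg_l m); [exact Hm | ].
  rewrite <- Rmult_assoc, Rinv_r; lra.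
Qed.

(** Along a segment where [A - z] is bounded below uniformly the resolvent, where it exists,
    is bounded uniformly; so its domain of existence propagates by steps of a fixed length. *)
Lemma resolvent_set_segment (A : bounded_op V) (p q : C) m :
  0 < m ->
  (forall t u, 0 <= t <= 1 ->
     m * norm u <= norm (shifted V A (Cplus p (Cmult (RtoC t) (Cminus q p))) u)) ->
  in_resolvent_set A p -> in_resolvent_set A q.
Proof.
  intros Hm Hlow Hp.
  set (g := fun t : R => Cplus p (Cmult (RtoC t) (Cminus q p))) in *.
  pose proof (Cmod_ge_0 (Cminus q p)) as Hqp.
  (* steps of length at most [m / 2]: the resolvent has norm at most [1 / m] *)
  destruct (nfloor_ex (2 * Cmod (Cminus q p) / m)) as [N HN].
  { apply Rmult_le_pos; [lra | left; now apply Rinv_0_lt_compat]. }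
  set (n := S N); assert (Hn : 0 < INR n) by (apply lt_0_INR; lia).
  assert (Hstep : Cmod (Cminus q p) / INR n * / m <= 1 / 2).
  { destruct HN as [_ HN]; unfold n in *; rewrite S_INR in *.
    apply (Rmult_lt_compat_r m) in HN; [ | exact Hm].
    unfold Rdiv in HN; rewrite Rmult_assoc, Rinv_l, Rmult_1_r in HN by lra.
    apply (Rmult_le_reg_r ((INR N + 1) * m)); [now apply Rmult_lt_0_compat | ].
    replace (Cmod (Cminus q p) / (INR N + 1) * / m * ((INR N + 1) * m)) with (Cmod (Cminus q p))
      by (field; split; lra).
    lra. }
  assert (Hall : forall k, (k <= n)%nat -> in_resolvent_set A (g (INR k / INR n))).
  { induction k as [ | k IH]; intros Hk.
    - replace (g (INR 0 / INR n)) with p; [exact Hp | ].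
      unfold g; change (INR 0) with 0; unfold Rdiv; rewrite Rmult_0_l; ring.
    - specialize (IH ltac:(lia)).
      assert (Ht : 0 <= INR k / INR n <= 1).
      { assert (INR k <= INR n) by (apply le_INR; lia); pose proof (pos_INR k).
        split; [apply Rmult_le_pos; [lra | left; now apply Rinv_0_lt_compat] | ].
        apply (Rmult_le_reg_r (INR n)); [exact Hn | ].
        unfold Rdiv; rewrite Rmult_assoc, Rinv_l; lra. }
      apply (resolvent_perturb V HV A A (g (INR k / INR n)) _ (/ m) IH).
      + apply resolvent_bound_of_lower_bound; [exact Hm | intros u; now apply Hlow | exact IH].
      + rewrite bop_norm_minus_diag, Rplus_0_l.
        replace (Cminus (g (INR (S k) / INR n)) (g (INR k / INR n)))
          with (Cmult (RtoC (/ INR n)) (Cminus q p)).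
        * rewrite Cmod_mult, Cmod_R, Rabs_pos_eq by (left; now apply Rinv_0_lt_compat).
          eapply Rle_trans; [ | exact Hstep]; right; unfold Rdiv; ring.
        * unfold g; rewrite S_INR; unfold Rdiv.
          rewrite !RtoC_mult, RtoC_plus; ring. }
  replace q with (g (INR n / INR n)); [now apply Hall | ].
  unfold g; replace (INR n / INR n) with 1 by (field; lra); ring.
Qed.

Lemma resolvent_continuous (A : bounded_op V) z :
  in_resolvent_set A z -> continuous (T := C_UniformSpace) (U := BV) (resolvent A) z.
Proof.
  intros Hz; apply filterlim_locally; intros e.
  set (M := bop_norm V (resolvent A z) + 1).
  assert (HM : 0 < M) by (pose proof (bop_norm_ge_0 V (resolvent A z)); unfold M; lra).
  set (r := Rmin (/ (2 * M)) (e / (4 * M ^ 2))).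
  assert (HM2 : 0 < M ^ 2) by (apply pow_lt; exact HM).
  assert (Hr : 0 < r).
  { apply Rmin_glb_lt; [apply Rinv_0_lt_compat | apply Rdiv_lt_0_compat; [apply cond_pos | ]]; lra. }
  pose proof (@norm_factor_gt_0 _ C_NormedModule) as Hf.
  assert (Hd : 0 < r / @norm_factor _ C_NormedModule) by now apply Rdiv_lt_0_compat.
  exists (mkposreal _ Hd); intros w Hw.
  assert (Hwz : Cmod (Cminus w z) < r).
  { pose proof (norm_compat2 (V := C_NormedModule) z w (mkposreal _ Hd) Hw) as H; simpl in H.
    replace (@norm_factor _ C_NormedModule * (r / @norm_factor _ C_NormedModule)) with r in H
      by (field; lra).
    exact H. }
  pose proof (Rmin_l (/ (2 * M)) (e / (4 * M ^ 2))) as H1.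
  pose proof (Rmin_r (/ (2 * M)) (e / (4 * M ^ 2))) as H2; fold r in H1, H2.
  destruct (resolvent_perturb V HV A A z w M Hz) as [_ [_ H3]].
  - unfold M; lra.
  - rewrite bop_norm_minus_diag, Rplus_0_l.
    apply Rle_trans with (/ (2 * M) * M); [ | right; field; lra].
    apply Rmult_le_compat_r; lra.
  - change (bop_norm V (minus (resolvent A w) (resolvent A z)) < e).
    eapply Rle_lt_trans; [exact H3 | ]; rewrite bop_norm_minus_diag, Rplus_0_l.
    apply Rlt_le_trans with (2 * M ^ 2 * (e / (4 * M ^ 2))).
    + apply Rmult_lt_compat_l; lra.
    + replace (2 * M ^ 2 * (e / (4 * M ^ 2))) with (e / 2) by (field; lra).
      pose proof (cond_pos e); lra.
Qed.

End BanachSpectrum.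

Section ContourIntegrals.
Variable V : NormedModule C_AbsRing.
Notation RV := (restrict_NormedModule V).

Lemma segment_continuous (p q : C) (t : R) :
  continuous (T := R_UniformSpace) (U := C_UniformSpace)
    (fun t : R => Cplus p (Cmult (RtoC t) (Cminus q p))) t.
Proof.
  apply filterlim_locally; intros e.
  pose proof (Cmod_ge_0 (Cminus q p)) as Hqp.
  assert (Hd : 0 < e / (Cmod (Cminus q p) + 1)).
  { apply Rdiv_lt_0_compat; [apply cond_pos | lra]. }
  exists (mkposreal _ Hd); intros s Hs.
  change (Rabs (s - t) < e / (Cmod (Cminus q p) + 1)) in Hs.
  apply (norm_compat1 (V := C_NormedModule)).
  change (Cmod (Cminus (Cplus p (Cmult (RtoC s) (Cminus q p)))
                       (Cplus p (Cmult (RtoC t) (Cminus q p)))) < e).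
  replace (Cminus (Cplus p (Cmult (RtoC s) (Cminus q p))) (Cplus p (Cmult (RtoC t) (Cminus q p))))
    with (Cmult (RtoC (s - t)) (Cminus q p)) by (rewrite RtoC_minus; ring).
  rewrite Cmod_mult, Cmod_R.
  apply Rle_lt_trans with (Rabs (s - t) * (Cmod (Cminus q p) + 1)).
  - apply Rmult_le_compat_l; [apply Rabs_pos | lra].
  - apply (Rmult_lt_compat_r (Cmod (Cminus q p) + 1)) in Hs; [ | lra].
    unfold Rdiv in Hs; rewrite Rmult_assoc, Rinv_l in Hs; lra.
Qed.

Lemma segment_int_exists (F : C -> V) (p q : C) :
  banach V ->
  (forall t, 0 <= t <= 1 ->
     continuous (T := C_UniformSpace) F (Cplus p (Cmult (RtoC t) (Cminus q p)))) ->
  exists I : V, is_segment_int F p q I.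
Proof.
  intros HV HF; apply (banach_ex_RInt (V := RV) HV).
  intros t Ht; rewrite Rmin_left, Rmax_right in Ht by lra.
  exact (continuous_scal_r (V := V) (Cminus q p : C_AbsRing) _ t
    (continuous_comp _ F t (segment_continuous p q t) (HF t Ht))).
Qed.

Lemma segment_int_dist_le (F G : C -> V) (p q : C) (I J : V) B :
  is_segment_int F p q I -> is_segment_int G p q J ->
  (forall t, 0 <= t <= 1 ->
     let z := Cplus p (Cmult (RtoC t) (Cminus q p)) in norm (minus (F z) (G z)) <= B) ->
  norm (minus I J) <= Cmod (Cminus q p) * B.
Proof.
  intros HI HJ HB.
  pose proof (is_RInt_minus (V := RV) _ _ 0 1 _ _ HI HJ) as HD.
  apply (norm_RInt_le_const (V := RV) _ 0 1 _ (Cmod (Cminus q p) * B)) in HD.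
  - rewrite Rminus_0_r, Rmult_1_l in HD; exact HD.
  - lra.
  - intros t Ht; specialize (HB t Ht); simpl in HB.
    set (z := Cplus p (Cmult (RtoC t) (Cminus q p))) in *.
    eapply Rle_trans; [apply (norm_minus_scal (V := V) (Cminus q p : C_AbsRing) (F z) (G z)) | ].
    apply Rmult_le_compat_l; [apply Cmod_ge_0 | exact HB].
Qed.

Lemma rect_side_on_rect (x0 h k t : R) : 0 <= h -> 0 <= k -> 0 <= t <= 1 ->
  let P p q := on_rect x0 h k (Cplus p (Cmult (RtoC t) (Cminus q p))) in
  P (x0 - h, - k) (x0 + h, - k) /\ P (x0 + h, - k) (x0 + h, k) /\
  P (x0 + h, k) (x0 - h, k) /\ P (x0 - h, k) (x0 - h, - k).
Proof.
  intros Hh Hk Ht P; unfold P, on_rect; simpl.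
  repeat split; [right | left | right | left]; split.
  - apply Rabs_le; nra.
  - rewrite Rabs_left1; nra.
  - rewrite Rabs_pos_eq; nra.
  - apply Rabs_le; nra.
  - apply Rabs_le; nra.
  - rewrite Rabs_pos_eq; nra.
  - rewrite Rabs_left1; nra.
  - apply Rabs_le; nra.
Qed.

Lemma rect_int_exists (F : C -> V) (x0 h k : R) :
  banach V -> 0 <= h -> 0 <= k ->
  (forall z, on_rect x0 h k z -> continuous (T := C_UniformSpace) F z) ->
  exists I : V, is_rect_int F x0 h k I.
Proof.
  intros HV Hh Hk HF.
  pose proof (fun t Ht => rect_side_on_rect x0 h k t Hh Hk Ht) as Hs; simpl in Hs.
  destruct (segment_int_exists F (x0 - h, - k) (x0 + h, - k) HV) as [I1 H1];
    [intros t Ht; apply HF, Hs, Ht | ].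
  destruct (segment_int_exists F (x0 + h, - k) (x0 + h, k) HV) as [I2 H2];
    [intros t Ht; apply HF, Hs, Ht | ].
  destruct (segment_int_exists F (x0 + h, k) (x0 - h, k) HV) as [I3 H3];
    [intros t Ht; apply HF, Hs, Ht | ].
  destruct (segment_int_exists F (x0 - h, k) (x0 - h, - k) HV) as [I4 H4];
    [intros t Ht; apply HF, Hs, Ht | ].
  exists (plus (plus (plus I1 I2) I3) I4), I1, I2, I3, I4; auto.
Qed.

Lemma rect_int_dist_le (F G : C -> V) (x0 h k : R) (I J : V) B :
  0 <= h -> 0 <= k ->
  is_rect_int F x0 h k I -> is_rect_int G x0 h k J ->
  (forall z, on_rect x0 h k z -> norm (minus (F z) (G z)) <= B) ->
  norm (minus I J) <= 4 * (h + k) * B.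
Proof.
  intros Hh Hk [I1 [I2 [I3 [I4 [HI1 [HI2 [HI3 [HI4 ->]]]]]]]]
    [J1 [J2 [J3 [J4 [HJ1 [HJ2 [HJ3 [HJ4 ->]]]]]]]] HB.
  pose proof (fun t Ht => rect_side_on_rect x0 h k t Hh Hk Ht) as Hs; simpl in Hs.
  assert (E : forall a b : R, Cmod (a, 0) = Rabs a /\ Cmod (0, b) = Rabs b).
  { intros a b; split; [exact (Cmod_R a) | ].
    unfold Cmod; simpl; replace (0 * (0 * 1) + b * (b * 1)) with (Rsqr b) by (unfold Rsqr; ring).
    apply sqrt_Rsqr_abs. }
  assert (N1 : norm (minus I1 J1) <= 2 * h * B).
  { eapply Rle_trans; [apply (segment_int_dist_le F G _ _ _ _ B HI1 HJ1) | right; f_equal].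
    - intros t Ht; apply HB, Hs, Ht.
    - unfold Cminus, Cplus, Copp; simpl.
      replace (- k + - - k) with 0 by ring; replace (x0 + h + - (x0 - h)) with (2 * h) by ring.
      rewrite (proj1 (E _ 0)); apply Rabs_pos_eq; lra. }
  assert (N2 : norm (minus I2 J2) <= 2 * k * B).
  { eapply Rle_trans; [apply (segment_int_dist_le F G _ _ _ _ B HI2 HJ2) | right; f_equal].
    - intros t Ht; apply HB, Hs, Ht.
    - unfold Cminus, Cplus, Copp; simpl.
      replace (k + - - k) with (2 * k) by ring; replace (x0 + h + - (x0 + h)) with 0 by ring.
      rewrite (proj2 (E 0 _)); apply Rabs_pos_eq; lra. }
  assert (N3 : norm (minus I3 J3) <= 2 * h * B).
  { eapply Rle_trans; [apply (segment_int_dist_le F G _ _ _ _ B HI3 HJ3) | right; f_equal].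
    - intros t Ht; apply HB, Hs, Ht.
    - unfold Cminus, Cplus, Copp; simpl.
      replace (k + - k) with 0 by ring; replace (x0 - h + - (x0 + h)) with (- (2 * h)) by ring.
      rewrite (proj1 (E _ 0)), Rabs_Ropp; apply Rabs_pos_eq; lra. }
  assert (N4 : norm (minus I4 J4) <= 2 * k * B).
  { eapply Rle_trans; [apply (segment_int_dist_le F G _ _ _ _ B HI4 HJ4) | right; f_equal].
    - intros t Ht; apply HB, Hs, Ht.
    - unfold Cminus, Cplus, Copp; simpl.
      replace (- k + - k) with (- (2 * k)) by ring; replace (x0 - h + - (x0 - h)) with 0 by ring.
      rewrite (proj2 (E 0 _)), Rabs_Ropp; apply Rabs_pos_eq; lra. }
  eapply Rle_trans; [apply norm_minus_plus | ].
  eapply Rle_trans; [apply Rplus_le_compat_r, norm_minus_plus | ].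
  eapply Rle_trans; [apply Rplus_le_compat_r, Rplus_le_compat_r, norm_minus_plus | ].
  eapply Rle_trans;
    [apply Rplus_le_compat; [apply Rplus_le_compat; [apply Rplus_le_compat | ] | ]; eassumption | ].
  right; ring.
Qed.

End ContourIntegrals.

(** * Norms on l^2 and isometry of the walk *)

Lemma lsum_app {X} (f : X -> R) l l' : lsum f (l ++ l') = lsum f l + lsum f l'.
Proof. induction l as [ | x l IH]; simpl; [lra | rewrite IH; lra]. Qed.

Lemma lsum_support_le {X} (f : X -> R) (l l' : list X) :
  (forall x, 0 <= f x) -> NoDup l -> (forall x, In x l -> ~ In x l' -> f x = 0) ->
  lsum f l <= lsum f l'.
Proof.
  intros Hf Hnd; revert l'; induction Hnd as [ | x l Hx Hnd IH]; intros l' H.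
  - simpl; now apply lsum_ge_0.
  - simpl; destruct (classic (In x l')) as [Hin | Hout].
    + destruct (in_split _ _ Hin) as [a [b ->]].
      rewrite lsum_app; simpl.
      specialize (IH (a ++ b)); rewrite lsum_app in IH.
      enough (lsum f l <= lsum f a + lsum f b) by lra.
      apply IH; intros y Hy Hy'; apply H; [now right | ].
      intros Hy2; apply in_app_or in Hy2; destruct Hy2 as [Hy2 | [<- | Hy2]]; auto using in_or_app.
    + rewrite (H x) by (simpl; auto).
      enough (lsum f l <= lsum f l') by lra.
      apply IH; intros y Hy; apply H; now right.
Qed.

Lemma lsum_ext {X} (f g : X -> R) l : (forall x, f x = g x) -> lsum f l = lsum g l.
Proof. intros H; f_equal; now apply functional_extensionality. Qed.

Definition dirs : list dir := dleft :: dright :: ddown :: dup :: nil.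

Lemma in_dirs j : In j dirs.
Proof. destruct j; simpl; auto. Qed.

Lemma NoDup_dirs : NoDup dirs.
Proof. repeat constructor; simpl; intuition discriminate. Qed.

Lemma NoDup_prod {X Y} (l : list X) (l' : list Y) :
  NoDup l -> NoDup l' -> NoDup (list_prod l l').
Proof.
  intros Hl Hl'; induction Hl as [ | x l Hx Hl IH]; [constructor | ].
  change (list_prod (x :: l) l') with (map (fun y => (x, y)) l' ++ list_prod l l').
  apply NoDup_app; auto.
  - apply FinFun.Injective_map_NoDup; [ | exact Hl']; intros y y' E; now inversion E.
  - intros p Hp Hp'; apply in_map_iff in Hp; destruct Hp as [y [<- _]].
    apply in_prod_iff in Hp'; tauto.
Qed.

Definition modsq (u : field) (p : site * dir) : R := Cmod (u (fst p) (snd p)) ^ 2.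

Lemma lsum_modsq (u : field) l :
  lsum (modsq u) (list_prod l dirs) = lsum (fun x => normsq4 (u x)) l.
Proof.
  induction l as [ | x l IH]; [reflexivity | ].
  change (list_prod (x :: l) dirs) with (map (fun j => (x, j)) dirs ++ list_prod l dirs).
  rewrite lsum_app, IH; simpl; unfold modsq, normsq4; simpl; ring.
Qed.

(** Sums over single components allow each direction to be moved independently, which sums of
    [normsq4] over sites do not. *)
Lemma sum_le_modsq (u : field) M :
  sum_le (fun x => normsq4 (u x)) M <->
  (forall L : list (site * dir), NoDup L -> lsum (modsq u) L <= M).
Proof.
  assert (Hp : forall p, 0 <= modsq u p) by (intros; apply pow2_ge_0).
  split.
  - intros H L HL.
    assert (Hdec : forall x y : site, {x = y} + {x <> y})
      by (intros; apply excluded_middle_informative).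
    eapply Rle_trans; [ | apply (H (nodup Hdec (map fst L))), NoDup_nodup].
    rewrite <- lsum_modsq; apply lsum_support_le; auto.
    intros [x j] Hin Hout; exfalso; apply Hout, in_prod; [ | apply in_dirs].
    apply nodup_In, (in_map fst _ _ Hin).
  - intros H l Hl; rewrite <- lsum_modsq; apply H.
    apply NoDup_prod; [exact Hl | apply NoDup_dirs].
Qed.

Lemma sum_le_l2_norm (u : l2) : sum_le (fun x => normsq4 (u x)) (l2_norm u ^ 2).
Proof. apply l2_norm_lub. Qed.

Lemma l2_norm_ge_0 (u : l2) : 0 <= l2_norm u.
Proof. apply l2_norm_lub. Qed.

Lemma l2_norm_le (u : l2) M :
  0 <= M -> sum_le (fun x => normsq4 (u x)) (M ^ 2) -> l2_norm u <= M.
Proof. apply l2_norm_lub. Qed.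

Lemma l2_norm_scal_eq c (u : l2) : l2_norm (l2_scal c u) = Cmod c * l2_norm u.
Proof.
  apply Rle_antisym; [apply l2_norm_scal | ].
  destruct (Req_dec (Cmod c) 0) as [E | Hc].
  - rewrite E, Rmult_0_l; apply l2_norm_ge_0.
  - assert (Hc0 : c <> RtoC 0) by (intros ->; rewrite Cmod_0 in Hc; lra).
    assert (Hp : 0 < Cmod c) by now apply Cmod_gt_0.
    apply (Rmult_le_reg_l (/ Cmod c)); [now apply Rinv_0_lt_compat | ].
    rewrite <- Rmult_assoc, Rinv_l, Rmult_1_l, <- Cmod_inv by (lra || assumption).
    eapply Rle_trans; [ | apply l2_norm_scal]; right; f_equal.
    apply l2_ext; intros x j; change (u x j = Cmult (Cinv c) (Cmult c (u x j))).
    field; exact Hc0.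
Qed.

(** The l^2 norm does not see where a component sits, so an operator that moves components without
    merging them is bounded by the largest factor it applies.  [E] leaves room for operators that
    only keep some of the components. *)
Lemma l2_norm_reindex (v u : l2) (E : site * dir -> Prop) (g : site * dir -> site * dir) c :
  0 <= c ->
  (forall x j, E (x, j) -> Cmod (v x j) <= c * Cmod (u (fst (g (x, j))) (snd (g (x, j))))) ->
  (forall x j, ~ E (x, j) -> v x j = RtoC 0) ->
  (forall p q, E p -> E q -> g p = g q -> p = q) ->
  l2_norm v <= c * l2_norm u.
Proof.
  intros Hc HE HnE Hinj; apply l2_norm_le; [apply Rmult_le_pos; auto using l2_norm_ge_0 | ].
  apply sum_le_modsq; intros L HL.
  assert (H : exists L', NoDup L' /\ (forall q, In q L' -> exists p, In p L /\ E p /\ q = g p) /\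
            lsum (modsq v) L <= c ^ 2 * lsum (modsq u) L').
  { induction HL as [ | [x j] L Hp HL IH].
    - exists nil; simpl; split; [constructor | split; [tauto | lra]].
    - destruct IH as [L' [H1 [H2 H3]]]; destruct (classic (E (x, j))) as [He | He].
      + exists (g (x, j) :: L'); split; [ | split].
        * constructor; [ | exact H1]; intros Hin; destruct (H2 _ Hin) as [q [Hq [Eq Hg]]].
          apply Hinj in Hg; auto; now subst q.
        * intros q [<- | Hq]; [exists (x, j); simpl; auto | ].
          destruct (H2 _ Hq) as [r [Hr Hr']]; exists r; simpl; auto.
        * change (modsq v (x, j) + lsum (modsq v) L
                  <= c ^ 2 * (modsq u (g (x, j)) + lsum (modsq u) L')).
          rewrite Rmult_plus_distr_l; apply Rplus_le_compat; [ | exact H3].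
          unfold modsq; simpl fst; simpl snd; rewrite <- Rpow_mult_distr.
          apply pow_incr; split; [apply Cmod_ge_0 | now apply HE].
      + exists L'; split; [exact H1 | split].
        * intros q Hq; destruct (H2 _ Hq) as [r [Hr Hr']]; exists r; simpl; auto.
        * change (modsq v (x, j) + lsum (modsq v) L <= c ^ 2 * lsum (modsq u) L').
          unfold modsq at 1; simpl fst; simpl snd; rewrite (HnE _ _ He), Cmod_0; lra. }
  destruct H as [L' [H1 [_ H3]]].
  eapply Rle_trans; [exact H3 | ].
  rewrite Rpow_mult_distr; apply Rmult_le_compat_l; [apply pow2_ge_0 | ].
  apply (proj1 (sum_le_modsq u _) (sum_le_l2_norm u) L' H1).
Qed.

Lemma l2_norm_pointwise (v u : l2) c :
  0 <= c -> (forall x j, Cmod (v x j) <= c * Cmod (u x j)) -> l2_norm v <= c * l2_norm u.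
Proof.
  intros Hc H; apply (l2_norm_reindex v u (fun _ => True) (fun p => p)); auto; tauto.
Qed.

Lemma l2_norm_sitewise (v u : l2) c :
  0 <= c -> (forall x, normsq4 (v x) <= c ^ 2 * normsq4 (u x)) -> l2_norm v <= c * l2_norm u.
Proof.
  intros Hc H; apply l2_norm_le; [apply Rmult_le_pos; auto using l2_norm_ge_0 | ].
  intros l Hl; eapply Rle_trans; [apply (lsum_le _ _ l H) | ].
  rewrite lsum_scal, Rpow_mult_distr; apply Rmult_le_compat_l; [apply pow2_ge_0 | ].
  now apply sum_le_l2_norm.
Qed.

Lemma finite_support_summable (u : field) (l : list site) :
  (forall x j, ~ In x l -> u x j = RtoC 0) -> square_summable u.
Proof.
  intros H; exists (lsum (fun x => normsq4 (u x)) l); intros l' Hl'.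
  apply lsum_support_le; auto using normsq4_ge_0.
  intros x _ Hx; unfold normsq4; rewrite !H, Cmod_0 by assumption; ring.
Qed.

Lemma l2_norm_finite_support (u : l2) (l : list site) :
  NoDup l -> (forall x j, ~ In x l -> u x j = RtoC 0) ->
  l2_norm u ^ 2 = lsum (fun x => normsq4 (u x)) l.
Proof.
  intros Hl H; apply Rle_antisym; [ | now apply sum_le_l2_norm].
  set (S := lsum _ l).
  assert (HS : 0 <= S) by (apply lsum_ge_0; intros; apply normsq4_ge_0).
  rewrite <- (pow2_sqrt S HS); apply pow_incr; split; [apply l2_norm_ge_0 | ].
  apply l2_norm_le; [apply sqrt_pos | ]; rewrite pow2_sqrt by exact HS.
  intros l' Hl'; apply lsum_support_le; auto using normsq4_ge_0.
  intros x _ Hx; unfold normsq4; rewrite !H, Cmod_0 by assumption; ring.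
Qed.

Definition diag_fun (m u : field) : field := fun x j => Cmult (m x j) (u x j).

Lemma diag_bounded (m : field) c : (forall x j, Cmod (m x j) <= c) -> l2_bounded (diag_fun m).
Proof.
  intros Hm; constructor.
  - intros u v; apply functional_extensionality; intros x.
    apply functional_extensionality; intros j; unfold diag_fun, field_plus; ring.
  - intros d u; apply functional_extensionality; intros x.
    apply functional_extensionality; intros j; unfold diag_fun, field_scal; ring.
  - exists (c ^ 2 + 1); split; [pose proof (pow2_ge_0 c); lra | intros u M Hu l Hl].
    assert (HM : 0 <= M) by exact (Hu nil (NoDup_nil _)).
    apply Rle_trans with (c ^ 2 * M); [ | lra].
    apply Rle_trans with (lsum (fun x => c ^ 2 * normsq4 (u x)) l).
    + apply lsum_le; intros x; unfold normsq4, diag_fun; rewrite !Cmod_mult.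
      assert (Q : forall j, (Cmod (m x j) * Cmod (u x j)) ^ 2 <= c ^ 2 * Cmod (u x j) ^ 2).
      { intros j; rewrite Rpow_mult_distr; apply Rmult_le_compat_r; [apply pow2_ge_0 | ].
        apply pow_incr; split; [apply Cmod_ge_0 | apply Hm]. }
      pose proof (Q dleft); pose proof (Q dright); pose proof (Q ddown); pose proof (Q dup); lra.
    + rewrite lsum_scal; apply Rmult_le_compat_l; [apply pow2_ge_0 | now apply Hu].
Qed.

(** The shift brings to [(x, j)] the component [j] of the site [pred_site x j]. *)
Definition pred_site (x : site) (j : dir) : site :=
  match j with
  | dleft => sadd x e1 | dright => ssub x e1 | ddown => sadd x e2 | dup => ssub x e2
  end.

Definition succ_site (x : site) (j : dir) : site :=
  match j with
  | dleft => ssub x e1 | dright => sadd x e1 | ddown => ssub x e2 | dup => sadd x e2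
  end.

Lemma pred_succ_site x j : pred_site (succ_site x j) j = x.
Proof. destruct x, j; unfold pred_site, succ_site, sadd, ssub; simpl; f_equal; lia. Qed.

Lemma succ_pred_site x j : succ_site (pred_site x j) j = x.
Proof. destruct x, j; unfold pred_site, succ_site, sadd, ssub; simpl; f_equal; lia. Qed.

Lemma shift_fun_pred (u : field) x j : shift_fun u x j = u (pred_site x j) j.
Proof. now destruct j. Qed.

Lemma shift_isometry (u : l2) : l2_norm (Defs.shift u) = l2_norm u.
Proof.
  apply Rle_antisym; (eapply Rle_trans; [ | right; apply Rmult_1_l]).
  - apply (l2_norm_reindex _ _ (fun _ => True) (fun p => (pred_site (fst p) (snd p), snd p)));
      try lra; try tauto.
    + intros x j _; change ((Defs.shift u : l2) x j) with (shift_fun u x j).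
      rewrite shift_fun_pred; simpl; lra.
    + intros [x j] [y k] _ _ E; simpl in E; inversion E as [[E1 E2]]; subst k.
      f_equal; now rewrite <- (succ_pred_site x j), <- (succ_pred_site y j), E1.
  - apply (l2_norm_reindex _ _ (fun _ => True) (fun p => (succ_site (fst p) (snd p), snd p)));
      try lra; try tauto.
    + intros x j _; simpl fst; simpl snd.
      change ((Defs.shift u : l2) (succ_site x j) j) with (shift_fun u (succ_site x j) j).
      rewrite shift_fun_pred, pred_succ_site; simpl; lra.
    + intros [x j] [y k] _ _ E; simpl in E; inversion E as [[E1 E2]]; subst k.
      f_equal; now rewrite <- (pred_succ_site x j), <- (pred_succ_site y j), E1.
Qed.

Lemma normsq4_conj (v : dir -> C) : RtoC (normsq4 v) = dsum (fun j => Cmult (v j) (Cconj (v j))).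
Proof. unfold dsum, normsq4; rewrite <- !Cmod2_conj; now rewrite <- !RtoC_plus. Qed.

Lemma unitary_normsq4 (A : mat4) (v : dir -> C) :
  unitary A -> normsq4 (fun j => dsum (fun k => Cmult (A j k) (v k))) = normsq4 v.
Proof.
  intros [_ H]; apply RtoC_inj; rewrite !normsq4_conj.
  assert (E : forall j, Cconj (dsum (fun k => Cmult (A j k) (v k)))
                      = dsum (fun k => Cmult (Cconj (A j k)) (Cconj (v k)))).
  { intros j; unfold dsum; now rewrite !Cplus_conj, !Cmult_conj. }
  transitivity (dsum (fun j => dsum (fun k => Cmult (Cmult (Cconj (v j)) (v k))
     (dsum (fun l => Cmult (Cconj (A l j)) (A l k)))))).
  - unfold dsum at 1; rewrite !E; unfold dsum; ring.
  - unfold dsum at 1 2; rewrite !H; unfold mat_id, dsum; simpl; ring.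
Qed.

Lemma walk_isometry {M0} (Cn : coin M0) (u : l2) : l2_norm (walk Cn u) = l2_norm u.
Proof.
  change (l2_norm (Defs.shift (l2_apply _ (coin_bounded Cn) u)) = l2_norm u).
  rewrite shift_isometry.
  assert (E : forall x, normsq4 (mul_fun Cn u x) = normsq4 (u x))
    by (intros x; apply unitary_normsq4, coin_unitary).
  apply Rle_antisym; (eapply Rle_trans; [ | right; apply Rmult_1_l]); apply l2_norm_sitewise; try lra;
    intros x; change (l2_apply _ (coin_bounded Cn) u x) with (mul_fun Cn u x); rewrite E; lra.
Qed.

(** * Splitting of the dilated walk by the barrier *)

Definition rev_dir (j : dir) : dir :=
  match j with dleft => dright | dright => dleft | ddown => dup | dup => ddown end.

(** The components that reach a site of the box from another site of the box. *)
Definition inside_barrier (M0 : Z) (x : site) (j : dir) : Prop :=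
  match j with
  | dleft => (- M0 <= fst x < M0 /\ Z.abs (snd x) <= M0)%Z
  | dright => (- M0 < fst x <= M0 /\ Z.abs (snd x) <= M0)%Z
  | ddown => (Z.abs (fst x) <= M0 /\ - M0 <= snd x < M0)%Z
  | dup => (Z.abs (fst x) <= M0 /\ - M0 < snd x <= M0)%Z
  end.

Lemma interior_in_box M0 x j : inside_barrier M0 x j -> in_box M0 x.
Proof. unfold in_box; destruct j; simpl; lia. Qed.

Lemma interior_pred_in_box M0 x j : inside_barrier M0 x j -> in_box M0 (pred_site x j).
Proof. unfold in_box; destruct x, j; simpl; lia. Qed.

Lemma interior_succ_site M0 x j : in_box M0 x ->
  (inside_barrier M0 (succ_site x j) j <-> inside_barrier M0 x (rev_dir j)).
Proof. unfold in_box; destruct x, j; simpl; lia. Qed.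

Lemma rev_dir_involutive j : rev_dir (rev_dir j) = j.
Proof. now destruct j. Qed.

Lemma mat_id_neq j k : j <> k -> mat_id j k = RtoC 0.
Proof. destruct j, k; intros H; try reflexivity; now elim H. Qed.

Lemma dsum_mat_id (v : dir -> C) j : dsum (fun k => Cmult (mat_id j k) (v k)) = v j.
Proof. destruct j; unfold dsum, mat_id; simpl; ring. Qed.

Lemma mul_fun_row (A : site -> mat4) (u : field) x j i :
  (forall k, A x j k = mat_id i k) -> mul_fun A u x j = u x i.
Proof.
  intros H; rewrite <- (dsum_mat_id (u x) i); unfold mul_fun, dsum; now rewrite !H.
Qed.

Lemma delta_summable (x0 : site) (j0 : dir) :
  square_summable (fun x j =>
    if excluded_middle_informative (x = x0) then mat_id j0 j else RtoC 0).
Proof.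
  apply (finite_support_summable _ (x0 :: nil)); intros x j Hx.
  destruct (excluded_middle_informative (x = x0)) as [-> | _]; [ | reflexivity].
  elim Hx; simpl; auto.
Qed.

Definition delta (x0 : site) (j0 : dir) : l2 := mk_l2 _ (delta_summable x0 j0).

Lemma mul_fun_delta (A : site -> mat4) x j k : mul_fun A (delta x k) x j = A x j k.
Proof.
  unfold mul_fun, delta; simpl.
  destruct (excluded_middle_informative (x = x)) as [_ | n]; [ | now elim n].
  destruct k; unfold dsum, mat_id; simpl; ring.
Qed.

Lemma delta_same x k i : delta x k x i = mat_id k i.
Proof.
  unfold delta; simpl.
  destruct (excluded_middle_informative (x = x)) as [_ | n]; [reflexivity | now elim n].
Qed.

Lemma mat_id_sym j k : mat_id j k = mat_id k j.
Proof. now destruct j, k. Qed.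

Section Barrier.
Variable M0 : Z.
Variable Cnp : coin M0.
Hypothesis Hnp : non_penetrable Cnp.

(** The reflection condition, tested on [delta x k], gives the entry [(j, k)] of the coin. *)
Lemma barrier_row x j : in_box M0 x -> ~ inside_barrier M0 (succ_site x j) j ->
  forall k, Cnp x j k = mat_id (rev_dir j) k.
Proof.
  intros Hx Hj k.
  assert (H : (walk Cnp (delta x k) : l2) (succ_site x j) j = delta x k x (rev_dir j)).
  { destruct (Hnp (delta x k) x) as [H1 [H2 [H3 H4]]]; unfold K1, K2 in *.
    pose proof Hx as Hb; unfold in_box in Hb.
    destruct j; [apply H2 | apply H1 | apply H4 | apply H3]; split; auto;
      destruct x; unfold inside_barrier, succ_site, sadd, ssub, e1, e2 in Hj; cbn [fst snd] in *; lia. }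
  change (shift_fun (mul_fun Cnp (delta x k)) (succ_site x j) j = delta x k x (rev_dir j)) in H.
  rewrite shift_fun_pred, pred_succ_site, mul_fun_delta, delta_same in H.
  now rewrite H, mat_id_sym.
Qed.

(** In a unitary matrix an entry of modulus one is alone in its row and in its column: the
    component coming from outside is only reflected. *)
Lemma barrier_column x j : in_box M0 x -> ~ inside_barrier M0 (succ_site x j) j ->
  forall l, Cnp x l (rev_dir j) = mat_id l j.
Proof.
  intros Hx Hj l; destruct (coin_unitary Cnp x) as [H _]; specialize (H l j).
  rewrite <- H, <- (dsum_mat_id (Cnp x l) (rev_dir j)).
  unfold dsum; rewrite !(barrier_row x j Hx Hj).
  destruct j; unfold mat_id; simpl;
    repeat match goal with |- context [Cconj (RtoC ?r)] =>
      replace (Cconj (RtoC r)) with (RtoC r) by (unfold Cconj, RtoC; simpl; f_equal; ring) end;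
    ring.
Qed.

(** Outside the barrier the walk moves components freely, except that one leaving the box comes
    from the reversed direction, by reflection at a side. *)
Definition source (p : site * dir) : site * dir :=
  let x := pred_site (fst p) (snd p) in
  if excluded_middle_informative (in_box M0 x) then (x, rev_dir (snd p)) else (x, snd p).

Lemma walk_exterior (u : field) y k : ~ inside_barrier M0 y k ->
  mul_fun Cnp u (pred_site y k) k = u (fst (source (y, k))) (snd (source (y, k))).
Proof.
  intros H; unfold source; simpl fst; simpl snd.
  destruct (excluded_middle_informative (in_box M0 (pred_site y k))) as [Hx | Hx]; simpl.
  - apply mul_fun_row, barrier_row; [exact Hx | now rewrite succ_pred_site].
  - apply mul_fun_row; intros l; now rewrite (coin_outside Cnp _ Hx).
Qed.

Lemma source_exterior y k : ~ inside_barrier M0 y k ->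
  ~ inside_barrier M0 (fst (source (y, k))) (snd (source (y, k))).
Proof.
  intros H; unfold source; simpl fst; simpl snd.
  destruct (excluded_middle_informative (in_box M0 (pred_site y k))) as [Hx | Hx]; simpl.
  - rewrite <- interior_succ_site, succ_pred_site; auto.
  - intros H'; apply Hx, (interior_in_box _ _ _ H').
Qed.

Lemma source_injective p q : source p = source q -> p = q.
Proof.
  destruct p as [y k], q as [y' k']; unfold source; simpl fst; simpl snd.
  assert (E : pred_site y k = pred_site y' k' -> k = k' -> (y, k) = (y', k')).
  { intros H1 <-; f_equal; now rewrite <- (succ_pred_site y k), H1, succ_pred_site. }
  destruct (excluded_middle_informative (in_box M0 (pred_site y k))) as [H1 | H1];
  destruct (excluded_middle_informative (in_box M0 (pred_site y' k'))) as [H2 | H2];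
    intros H; injection H as H3 H4; simpl in *.
  - apply E; auto; now rewrite <- (rev_dir_involutive k), H4, rev_dir_involutive.
  - rewrite H3 in H1; contradiction.
  - rewrite H3 in H1; contradiction.
  - now apply E.
Qed.

Definition interior_part (u : field) : field := fun x j =>
  if excluded_middle_informative (inside_barrier M0 x j) then u x j else RtoC 0.

(** No component from outside is scattered to the inside, so the inside evolves on its own. *)
Lemma walk_interior (u : field) y k : inside_barrier M0 y k ->
  mul_fun Cnp u (pred_site y k) k = mul_fun Cnp (interior_part u) (pred_site y k) k.
Proof.
  intros H; pose proof (interior_pred_in_box _ _ _ H) as Hx.
  assert (E : forall j, Cmult (Cnp (pred_site y k) k j) (u (pred_site y k) j)
                      = Cmult (Cnp (pred_site y k) k j) (interior_part u (pred_site y k) j)).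
  { intros j; unfold interior_part.
    destruct (excluded_middle_informative (inside_barrier M0 (pred_site y k) j)) as [_ | Hj]; [reflexivity | ].
    rewrite <- (rev_dir_involutive j) in Hj; rewrite <- interior_succ_site in Hj by exact Hx.
    pose proof (barrier_column _ _ Hx Hj k) as Hc; rewrite rev_dir_involutive in Hc.
    rewrite Hc, mat_id_neq; [ring | ].
    intros ->; apply Hj; now rewrite succ_pred_site. }
  unfold mul_fun, dsum; now rewrite !E.
Qed.

(** Position along the direction of motion.  It is the exponent in the modulus of [dil_phase], and
    it increases at each step outside the barrier, reflections included. *)
Definition outward (x : site) (j : dir) : Z :=
  match j with dleft => - fst x | dright => fst x | ddown => - snd x | dup => snd x end.

Lemma exp_le_exp a b : a <= b -> exp a <= exp b.
Proof. intros [H | ->]; [left; now apply exp_increasing | right; reflexivity]. Qed.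

Lemma Cmod_dil_phase theta x j :
  Cmod (dil_phase theta x j) = exp (Im theta * IZR (outward x j)).
Proof.
  destruct theta as [p q], x as [x1 x2]; destruct j; simpl; rewrite Cmod_Cexp; f_equal;
    rewrite ?opp_IZR; simpl; ring.
Qed.

Lemma outward_source y k : (0 < M0)%Z -> ~ inside_barrier M0 y k ->
  (outward (fst (source (y, k))) (snd (source (y, k))) + 1 <= outward y k)%Z.
Proof.
  intros HM H; unfold source; simpl fst; simpl snd.
  destruct (excluded_middle_informative (in_box M0 (pred_site y k))) as [Hx | Hx].
  - unfold in_box in Hx; destruct y, k; simpl in *; lia.
  - destruct y, k; simpl in *; lia.
Qed.

Variable theta : C.
Hypothesis HM0 : (0 < M0)%Z.
Hypothesis Htheta : Im theta < 0.

Lemma dil_walk_apply (u : l2) x j :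
  (dil_walk Cnp theta u : l2) x j
  = Cmult (dil_phase theta x j) (mul_fun Cnp (dil_inv theta u) (pred_site x j) j).
Proof.
  change (Cplus (Cmult (Cexp (Copp (Cmult Ci theta))) (shift_fun u x j))
            (dil_pert_fun Cnp theta u x j) =
          Cmult (dil_phase theta x j) (mul_fun Cnp (dil_inv theta u) (pred_site x j) j)).
  rewrite <- dil_shift, <- shift_fun_pred; unfold dil_pert_fun, dil, pert_fun; ring.
Qed.

Lemma walk_apply (u : l2) x j : (walk Cnp u : l2) x j = mul_fun Cnp u (pred_site x j) j.
Proof.
  rewrite <- shift_fun_pred; reflexivity.
Qed.

Definition indicator (P : Prop) : C := if excluded_middle_informative P then RtoC 1 else RtoC 0.

Lemma indicator_le (P : Prop) : Cmod (indicator P) <= 1.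
Proof. unfold indicator; destruct excluded_middle_informative; rewrite ?Cmod_1, ?Cmod_0; lra. Qed.

Definition phase_bound : R := exp (Rabs (Im theta) * IZR M0).

Definition undil_field : field := fun x j =>
  if excluded_middle_informative (inside_barrier M0 x j) then Cinv (dil_phase theta x j) else RtoC 0.

Lemma undil_field_bound x j : Cmod (undil_field x j) <= phase_bound.
Proof.
  unfold undil_field, phase_bound.
  destruct excluded_middle_informative as [H | H].
  - apply dil_phase_bound, (interior_in_box _ _ _ H).
  - rewrite Cmod_0; left; apply exp_pos.
Qed.

(** [T(theta)^-1] restricted to the interior, where it is bounded. *)
Definition undil : BH := l2_lift _ (diag_bounded undil_field phase_bound undil_field_bound).

Definition exterior_proj : BH :=
  l2_lift _ (diag_bounded (fun x j => indicator (~ inside_barrier M0 x j)) 1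
    (fun x j => indicator_le _)).

Lemma undil_norm (u : l2) : l2_norm (undil u) <= phase_bound * l2_norm u.
Proof.
  apply l2_norm_pointwise; [left; apply exp_pos | intros x j].
  change ((undil u : l2) x j) with (Cmult (undil_field x j) (u x j)); rewrite Cmod_mult.
  apply Rmult_le_compat_r; [apply Cmod_ge_0 | apply undil_field_bound].
Qed.

Lemma exterior_proj_norm (u : l2) : l2_norm (exterior_proj u) <= l2_norm u.
Proof.
  rewrite <- (Rmult_1_l (l2_norm u)); apply l2_norm_pointwise; [lra | intros x j].
  change ((exterior_proj u : l2) x j) with (Cmult (indicator (~ inside_barrier M0 x j)) (u x j)).
  rewrite Cmod_mult; apply Rmult_le_compat_r; [apply Cmod_ge_0 | apply indicator_le].
Qed.

Lemma undil_apply (u : l2) x j : (undil u : l2) x j = interior_part (dil_inv theta u) x j.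
Proof.
  change ((undil u : l2) x j) with (Cmult (undil_field x j) (u x j)).
  unfold undil_field, interior_part, dil_inv; destruct excluded_middle_informative; ring.
Qed.

Lemma undil_interior (u : l2) x j : ~ inside_barrier M0 x j -> (undil u : l2) x j = RtoC 0.
Proof.
  intros H; rewrite undil_apply; unfold interior_part.
  destruct excluded_middle_informative; [contradiction | reflexivity].
Qed.

Lemma exterior_proj_out (u : l2) x j : ~ inside_barrier M0 x j -> (exterior_proj u : l2) x j = u x j.
Proof.
  intros H; change ((exterior_proj u : l2) x j) with (Cmult (indicator (~ inside_barrier M0 x j)) (u x j)).
  unfold indicator; destruct excluded_middle_informative; [ring | contradiction].
Qed.

Lemma exterior_proj_in (u : l2) x j : inside_barrier M0 x j -> (exterior_proj u : l2) x j = RtoC 0.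
Proof.
  intros H; change ((exterior_proj u : l2) x j) with (Cmult (indicator (~ inside_barrier M0 x j)) (u x j)).
  unfold indicator; destruct excluded_middle_informative; [contradiction | ring].
Qed.

Lemma l2_norm_split (u : l2) :
  l2_norm u <= phase_bound * l2_norm (undil u) + l2_norm (exterior_proj u).
Proof.
  pose proof (norm_le_minus (V := l2_NormedModule) u (exterior_proj u)) as H.
  change (l2_norm u <= l2_norm (minus u (exterior_proj u)) + l2_norm (exterior_proj u)) in H.
  eapply Rle_trans; [exact H | apply Rplus_le_compat_r].
  apply l2_norm_pointwise; [left; apply exp_pos | intros x j].
  change ((minus u (exterior_proj u) : l2) x j)
    with (Cplus (u x j) (Cmult (Copp (RtoC 1)) ((exterior_proj u : l2) x j))).
  destruct (classic (inside_barrier M0 x j)) as [Hi | Hi].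
  - rewrite exterior_proj_in by exact Hi; rewrite undil_apply; unfold interior_part.
    destruct excluded_middle_informative; [ | contradiction].
    replace (Cplus (u x j) (Cmult (Copp (RtoC 1)) (RtoC 0)))
      with (Cmult (dil_phase theta x j) (dil_inv theta u x j)).
    + rewrite Cmod_mult; apply Rmult_le_compat_r; [apply Cmod_ge_0 | ].
      apply dil_phase_bound, (interior_in_box _ _ _ Hi).
    + unfold dil_inv; field; apply dil_phase_neq_0.
  - rewrite exterior_proj_out by exact Hi.
    replace (Cplus (u x j) (Cmult (Copp (RtoC 1)) (u x j))) with (RtoC 0) by ring.
    rewrite Cmod_0; apply Rmult_le_pos; [left; apply exp_pos | apply Cmod_ge_0].
Qed.

(** Inside the barrier, dilation is a similarity. *)
Lemma undil_intertwines (u : l2) : undil (dil_walk Cnp theta u) = walk Cnp (undil u).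
Proof.
  apply l2_ext; intros y k; rewrite walk_apply, undil_apply.
  assert (E : (undil u : l2) = interior_part (dil_inv theta u) :> field).
  { apply functional_extensionality; intros x; apply functional_extensionality; intros j.
    apply undil_apply. }
  unfold interior_part at 1; destruct excluded_middle_informative as [H | H].
  - rewrite E, <- walk_interior by exact H.
    unfold dil_inv at 1; rewrite dil_walk_apply; field; apply dil_phase_neq_0.
  - rewrite walk_exterior by exact H; symmetry.
    apply undil_interior, source_exterior, H.
Qed.

(** Outside the barrier the dilated walk is a weighted shift along the outgoing trajectories
    whose weights have modulus at most [exp (Im theta) < 1]. *)
Lemma exterior_contraction (u : l2) :
  l2_norm (exterior_proj (dil_walk Cnp theta u)) <= exp (Im theta) * l2_norm (exterior_proj u).
Proof.
  apply (l2_norm_reindex _ _ (fun p => ~ inside_barrier M0 (fst p) (snd p)) source).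
  - left; apply exp_pos.
  - intros y k H; simpl in H; rewrite exterior_proj_out by exact H.
    rewrite exterior_proj_out by now apply source_exterior.
    rewrite dil_walk_apply, walk_exterior by exact H.
    unfold dil_inv; rewrite !Cmod_mult, Cmod_inv by apply dil_phase_neq_0.
    rewrite <- Rmult_assoc; apply Rmult_le_compat_r; [apply Cmod_ge_0 | ].
    rewrite !Cmod_dil_phase, <- exp_Ropp, <- exp_plus.
    pose proof (outward_source y k HM0 H) as Ho; apply IZR_le in Ho; rewrite plus_IZR in Ho.
    set (a := IZR (outward y k)) in *; set (b := IZR (outward _ _)) in *.
    apply exp_le_exp; nra.
  - intros y k H; simpl in H; apply exterior_proj_in.
    destruct (classic (inside_barrier M0 y k)); tauto.
  - intros p q _ _; apply source_injective.
Qed.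

Lemma l2_shifted_apply (A : BH) z (u : l2) :
  shifted l2_NormedModule A z u = minus (A u : l2) (l2_scal z u).
Proof. reflexivity. Qed.

(** The equation [(U(theta) - z) u = w] decouples: [undil] turns its inside part into an equation
    for the undilated walk, and outside [U(theta)] is a contraction by [exp (Im theta)]. *)
Lemma dil_walk_lower_bound (z : C) (mu : R) (u : l2) :
  0 < mu -> exp (Im theta) < Cmod z ->
  mu * l2_norm (undil u) <= l2_norm (shifted l2_NormedModule (walk Cnp) z (undil u)) ->
  l2_norm u <= (phase_bound ^ 2 / mu + / (Cmod z - exp (Im theta)))
               * l2_norm (shifted l2_NormedModule (dil_walk Cnp theta) z u).
Proof.
  intros Hmu Hz Hlow.
  set (w := shifted l2_NormedModule (dil_walk Cnp theta) z u : l2).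
  assert (HE : 0 < phase_bound) by apply exp_pos.
  assert (H1 : shifted l2_NormedModule (walk Cnp) z (undil u) = undil w).
  { unfold w; rewrite !l2_shifted_apply, <- undil_intertwines; apply l2_ext; intros x j.
    change (Cplus ((undil (dil_walk Cnp theta u) : l2) x j)
              (Cmult (Copp (RtoC 1)) (Cmult z ((undil u : l2) x j))) =
            Cmult (undil_field x j) (Cplus ((dil_walk Cnp theta u : l2) x j)
              (Cmult (Copp (RtoC 1)) (Cmult z (u x j))))).
    change ((undil (dil_walk Cnp theta u) : l2) x j)
      with (Cmult (undil_field x j) ((dil_walk Cnp theta u : l2) x j)).
    change ((undil u : l2) x j) with (Cmult (undil_field x j) (u x j)); ring. }
  rewrite H1 in Hlow.
  assert (H2 : (Cmod z - exp (Im theta)) * l2_norm (exterior_proj u) <= l2_norm w).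
  { eapply Rle_trans; [ | apply exterior_proj_norm].
    assert (H3 : l2_norm (l2_scal z (exterior_proj u)) <=
                 l2_norm (exterior_proj w) + l2_norm (exterior_proj (dil_walk Cnp theta u))).
    { assert (E : l2_scal z (exterior_proj u) = minus (exterior_proj (dil_walk Cnp theta u)) (exterior_proj w)).
      { apply l2_ext; intros x j; unfold w; rewrite l2_shifted_apply.
        change (Cmult z (Cmult (indicator (~ inside_barrier M0 x j)) (u x j)) =
          Cplus (Cmult (indicator (~ inside_barrier M0 x j)) ((dil_walk Cnp theta u : l2) x j))
            (Cmult (Copp (RtoC 1)) (Cmult (indicator (~ inside_barrier M0 x j))
               (Cplus ((dil_walk Cnp theta u : l2) x j)
                  (Cmult (Copp (RtoC 1)) (Cmult z (u x j))))))); ring. }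
      rewrite E, Rplus_comm; unfold minus.
      eapply Rle_trans; [apply l2_norm_plus | ].
      apply Rplus_le_compat_l, l2_norm_opp_le. }
    rewrite l2_norm_scal_eq in H3.
    pose proof (exterior_contraction u); lra. }
  pose proof (l2_norm_split u) as H3; pose proof (undil_norm w) as H4.
  pose proof (l2_norm_ge_0 w) as Hw.
  assert (H5 : phase_bound * l2_norm (undil u) <= phase_bound ^ 2 / mu * l2_norm w).
  { apply (Rmult_le_reg_l mu); [exact Hmu | ].
    replace (mu * (phase_bound ^ 2 / mu * l2_norm w)) with (phase_bound * (phase_bound * l2_norm w))
      by (field; lra).
    replace (mu * (phase_bound * l2_norm (undil u))) with (phase_bound * (mu * l2_norm (undil u)))
      by ring.
    apply Rmult_le_compat_l; lra. }
  assert (H6 : l2_norm (exterior_proj u) <= / (Cmod z - exp (Im theta)) * l2_norm w).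
  { apply (Rmult_le_reg_l (Cmod z - exp (Im theta))); [lra | ].
    rewrite <- Rmult_assoc, Rinv_r; lra. }
  lra.
Qed.

End Barrier.

(** * Resolvent bound inside the barrier *)

Lemma bounded_subsequence (a : nat -> R) B : (forall n, Rabs (a n) <= B) ->
  exists (phi : nat -> nat) (l : R), (forall n, (n <= phi n)%nat) /\
    forall e, 0 < e -> exists N, forall n, (N <= n)%nat -> Rabs (a (phi n) - l) < e.
Proof.
  intros Ha.
  destruct (Bolzano_Weierstrass a (fun c => - B <= c <= B)) as [l Hl].
  { apply compact_P3. }
  { intros n; apply Rabs_le_between, Ha. }
  assert (H : forall n, exists p, (n <= p)%nat /\ Rabs (a p - l) < / INR (S n)).
  { intros n; assert (Hn : 0 < / INR (S n)) by (apply Rinv_0_lt_compat, lt_0_INR; lia).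
    apply (Hl (fun x => Rabs (x - l) < / INR (S n))).
    exists (mkposreal _ Hn); intros x Hx; exact Hx. }
  apply choice in H; destruct H as [phi Hphi].
  exists phi, l; split; [intros n; apply Hphi | ]; intros e He.
  destruct (archimed_cor1 e He) as [N [HN HN0]]; exists N; intros n Hn.
  eapply Rlt_trans; [apply Hphi | ]; eapply Rle_lt_trans; [ | exact HN].
  apply Rinv_le_contravar; [apply lt_0_INR; lia | apply le_INR; lia].
Qed.

(** One subsequence for finitely many sequences at once, extracted one after the other. *)
Lemma bounded_subsequence_list {X} (L : list X) (a : nat -> X -> R) B :
  (forall n p, Rabs (a n p) <= B) ->
  exists (phi : nat -> nat) (l : X -> R), (forall n, (n <= phi n)%nat) /\
    forall e, 0 < e -> exists N, forall n, (N <= n)%nat ->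
      forall p, In p L -> Rabs (a (phi n) p - l p) < e.
Proof.
  intros Ha; induction L as [ | x L [phi [l [Hphi Hl]]]].
  - exists (fun n => n), (fun _ => 0); split; [auto | intros e He; exists O; simpl; tauto].
  - destruct (bounded_subsequence (fun n => a (phi n) x) B) as [psi [lx [Hpsi Hlx]]].
    { intros n; apply Ha. }
    exists (fun n => phi (psi n)),
      (fun p => if excluded_middle_informative (p = x) then lx else l p); split.
    + intros n; specialize (Hpsi n); specialize (Hphi (psi n)); lia.
    + intros e He; destruct (Hl e He) as [N1 H1], (Hlx e He) as [N2 H2].
      exists (max N1 N2); intros n Hn p Hp.
      destruct (excluded_middle_informative (p = x)) as [-> | Hne].
      * apply H2; lia.
      * apply H1; [specialize (Hpsi n); lia | ].
        destruct Hp as [<- | Hp]; [now elim Hne | exact Hp].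
Qed.

Definition box_range (M0 : Z) : list Z :=
  map (fun n => Z.of_nat n - M0)%Z (seq 0 (Z.to_nat (2 * M0 + 1))).

Definition box_sites (M0 : Z) : list site := list_prod (box_range M0) (box_range M0).

Lemma in_box_range M0 m : In m (box_range M0) <-> (Z.abs m <= M0)%Z.
Proof.
  unfold box_range; rewrite in_map_iff; split.
  - intros [n [<- Hn]]; apply in_seq in Hn; lia.
  - intros H; exists (Z.to_nat (m + M0)); rewrite in_seq; lia.
Qed.

Lemma in_box_sites M0 x : In x (box_sites M0) <-> in_box M0 x.
Proof.
  destruct x as [x1 x2]; unfold box_sites, in_box; rewrite <- !in_box_range.
  apply in_prod_iff.
Qed.

Lemma NoDup_box_sites M0 : NoDup (box_sites M0).
Proof.
  assert (H : NoDup (box_range M0)).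
  { apply FinFun.Injective_map_NoDup; [intros m n; lia | apply seq_NoDup]. }
  now apply NoDup_prod.
Qed.

Definition supported_inside (M0 : Z) (u : field) : Prop :=
  forall x j, ~ inside_barrier M0 x j -> u x j = RtoC 0.

Lemma supported_inside_box M0 (u : field) : supported_inside M0 u ->
  forall x j, ~ In x (box_sites M0) -> u x j = RtoC 0.
Proof.
  intros H x j Hx; apply H; intros Hi; apply Hx, in_box_sites, (interior_in_box _ _ _ Hi).
Qed.

Lemma l2_norm_inside M0 (u : l2) : supported_inside M0 u ->
  l2_norm u ^ 2 = lsum (fun x => normsq4 (u x)) (box_sites M0).
Proof.
  intros H; apply l2_norm_finite_support; [apply NoDup_box_sites | ].
  now apply supported_inside_box.
Qed.

Lemma Cmod_sq z : Cmod z ^ 2 = Re z ^ 2 + Im z ^ 2.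
Proof. unfold Cmod; rewrite pow2_sqrt; [reflexivity | ]; nra. Qed.

(** Only finitely many components are nonzero, so bounded sequences converge componentwise along a
    subsequence, and then in norm. *)
Lemma inside_cluster_point M0 (f : nat -> l2) :
  (forall n, supported_inside M0 (f n)) -> (forall n, l2_norm (f n) <= 1) ->
  exists g : l2, supported_inside M0 g /\
    forall e, 0 < e -> forall N, exists n, (N <= n)%nat /\ l2_norm (minus (f n) g) < e.
Proof.
  intros Hin Hf.
  set (coord := fun (n : nat) (p : site * dir * bool) =>
    let z := f n (fst (fst p)) (snd (fst p)) in if snd p then Re z else Im z).
  destruct (bounded_subsequence_list
    (list_prod (list_prod (box_sites M0) dirs) (true :: false :: nil)) coord 1)
    as [phi [l [Hphi Hl]]].
  { intros n [[x j] b]; unfold coord; simpl.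
    pose proof (l2_component_le (f n) x j); pose proof (Hf n).
    pose proof (Rmax_Cmod (f n x j)) as Hm.
    pose proof (Rmax_l (Rabs (fst (f n x j))) (Rabs (snd (f n x j)))).
    pose proof (Rmax_r (Rabs (fst (f n x j))) (Rabs (snd (f n x j)))).
    destruct b; unfold Re, Im; lra. }
  set (g0 := fun x j => (l (x, j, true), l (x, j, false)) : C).
  assert (Hg : supported_inside M0 (interior_part M0 g0)).
  { intros x j H; unfold interior_part.
    destruct excluded_middle_informative; [contradiction | reflexivity]. }
  exists (mk_l2 _ (finite_support_summable _ _ (supported_inside_box M0 _ Hg))).
  split; [exact Hg | ]; intros e He N.
  set (K := INR (length (box_sites M0))).
  assert (HK : 0 <= K) by apply pos_INR.
  set (d := e / (4 * (K + 1))).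
  assert (Hd : 0 < d) by (apply Rdiv_lt_0_compat; lra).
  destruct (Hl d Hd) as [N1 HN1]; exists (phi (max N N1)); split.
  { specialize (Hphi (max N N1)); lia. }
  set (n := phi (max N N1)).
  match goal with |- l2_norm ?w < e => set (v := w : l2) end.
  assert (Hv : forall x j, v x j = Cminus (f n x j) (interior_part M0 g0 x j)).
  { intros x j; change (Cplus (f n x j) (Cmult (Copp (RtoC 1)) (interior_part M0 g0 x j))
                      = Cminus (f n x j) (interior_part M0 g0 x j)); ring. }
  assert (Hvs : supported_inside M0 v).
  { intros x j H; rewrite Hv, (Hin n x j H), (Hg x j H); ring. }
  assert (Hsq : forall x j, Cmod (v x j) ^ 2 <= 2 * d ^ 2).
  { intros x j; destruct (classic (inside_barrier M0 x j)) as [Hi | Hi].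
    - assert (Hb : forall b, Rabs (coord n (x, j, b) - l (x, j, b)) < d).
      { intros b; apply HN1; [lia | ]; apply in_prod; [apply in_prod | destruct b; simpl; auto].
        - apply in_box_sites, (interior_in_box _ _ _ Hi).
        - apply in_dirs. }
      rewrite Hv, Cmod_sq; unfold interior_part.
      destruct excluded_middle_informative; [ | contradiction].
      pose proof (Hb true) as H1; pose proof (Hb false) as H2; unfold coord in H1, H2; simpl in H1, H2.
      apply Rabs_lt_between in H1, H2; unfold Re, Im, g0 in *; simpl fst; simpl snd.
      assert (Q : forall r, - d < r < d -> r ^ 2 <= d ^ 2) by (intros r Hr; nra).
      pose proof (Q _ H1); pose proof (Q _ H2); lra.
    - rewrite (Hvs x j Hi), Cmod_0; nra. }
  assert (Hsum : l2_norm v ^ 2 <= 8 * d ^ 2 * K).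
  { rewrite (l2_norm_inside M0 v Hvs); unfold K.
    generalize (box_sites M0); intros L; induction L as [ | x L IH].
    - simpl; lra.
    - change (normsq4 (v x) + lsum (fun x => normsq4 (v x)) L
              <= 8 * d ^ 2 * INR (S (length L))).
      rewrite S_INR; unfold normsq4 at 1.
      pose proof (Hsq x dleft); pose proof (Hsq x dright).
      pose proof (Hsq x ddown); pose proof (Hsq x dup); lra. }
  assert (HdK : 8 * d ^ 2 * K < e ^ 2).
  { assert (E : e = 4 * d * (K + 1)) by (unfold d; field; lra).
    rewrite E.
    assert (0 < d ^ 2) by (apply pow_lt; exact Hd).
    replace ((4 * d * (K + 1)) ^ 2) with (d ^ 2 * (16 * (K + 1) ^ 2)) by ring.
    replace (8 * d ^ 2 * K) with (d ^ 2 * (8 * K)) by ring.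
    apply Rmult_lt_compat_l; nra. }
  pose proof (l2_norm_ge_0 v); nra.
Qed.

(** Real parts of the inner products on C^4 and on the states inside the barrier. *)
Definition pairing4 (v w : dir -> C) : R :=
  let r j := Re (v j) * Re (w j) + Im (v j) * Im (w j) in
  r dleft + r dright + r ddown + r dup.

Definition pairing (M0 : Z) (u v : field) : R :=
  lsum (fun x => pairing4 (u x) (v x)) (box_sites M0).

Lemma normsq4_plus (v w : dir -> C) :
  normsq4 (fun j => Cplus (v j) (w j)) = normsq4 v + 2 * pairing4 v w + normsq4 w.
Proof. unfold normsq4, pairing4; rewrite !Cmod_sq; unfold Re, Im, Cplus; simpl; ring. Qed.

Lemma pairing4_plus_l (v v' w : dir -> C) :
  pairing4 (fun j => Cplus (v j) (v' j)) w = pairing4 v w + pairing4 v' w.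
Proof. unfold pairing4, Re, Im, Cplus; simpl; ring. Qed.

Lemma pairing4_scal (c : C) (v w : dir -> C) :
  pairing4 (fun j => Cmult c (v j)) (fun j => Cmult c (w j)) = Cmod c ^ 2 * pairing4 v w.
Proof. rewrite Cmod_sq; unfold pairing4, Re, Im, Cmult; simpl; ring. Qed.

(** Young's inequality; the weights 4 and 1/4 suit an [f] that is within 1/4 of [g] below. *)
Lemma pairing4_le (v w : dir -> C) : 2 * pairing4 v w <= 4 * normsq4 v + normsq4 w / 4.
Proof.
  assert (Q : forall z z', 2 * (Re z * Re z' + Im z * Im z') <= 4 * Cmod z ^ 2 + Cmod z' ^ 2 / 4).
  { intros z z'; rewrite !Cmod_sq.
    pose proof (pow2_ge_0 (2 * Re z - Re z' / 2)); pose proof (pow2_ge_0 (2 * Im z - Im z' / 2)); nra. }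
  unfold pairing4, normsq4.
  pose proof (Q (v dleft) (w dleft)); pose proof (Q (v dright) (w dright)).
  pose proof (Q (v ddown) (w ddown)); pose proof (Q (v dup) (w dup)); lra.
Qed.

Section InteriorSpectrum.
Variable M0 : Z.
Variable Cnp : coin M0.
Hypothesis Hnp : non_penetrable Cnp.
Notation inside := (supported_inside M0).

Lemma inside_plus (u v : l2) : inside u -> inside v -> inside (l2_plus u v).
Proof.
  intros Hu Hv x j H; change (Cplus (u x j) (v x j) = RtoC 0); rewrite Hu, Hv by exact H; ring.
Qed.

Lemma inside_scal c (u : l2) : inside u -> inside (l2_scal c u).
Proof. intros Hu x j H; change (Cmult c (u x j) = RtoC 0); rewrite Hu by exact H; ring. Qed.

Lemma inside_walk (u : l2) : inside u -> inside (walk Cnp u : l2).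
Proof.
  intros Hu x j H; rewrite walk_apply, (walk_exterior M0 Cnp Hnp) by exact H.
  apply Hu, source_exterior, H.
Qed.

Lemma l2_norm_plus_sq (u v : l2) : inside u -> inside v ->
  l2_norm (l2_plus u v) ^ 2 = l2_norm u ^ 2 + 2 * pairing M0 u v + l2_norm v ^ 2.
Proof.
  intros Hu Hv; rewrite !(l2_norm_inside M0) by auto using inside_plus.
  unfold pairing; rewrite <- lsum_scal, <- !lsum_plus; apply lsum_ext; intros x.
  apply normsq4_plus.
Qed.

(** Polarization of the isometry. *)
Lemma walk_pairing (u v : l2) : inside u -> inside v ->
  pairing M0 (walk Cnp u : l2) (walk Cnp v : l2) = pairing M0 u v.
Proof.
  intros Hu Hv.
  pose proof (l2_norm_plus_sq u v Hu Hv) as H1.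
  pose proof (l2_norm_plus_sq (walk Cnp u) (walk Cnp v) (inside_walk u Hu) (inside_walk v Hv)) as H2.
  assert (E : l2_plus (walk Cnp u) (walk Cnp v) = walk Cnp (l2_plus u v))
    by (symmetry; apply (linear_plus _ (bop_linear _ (walk Cnp)))).
  rewrite E, !walk_isometry in H2; lra.
Qed.

Lemma pairing_le (u v : l2) : inside u -> inside v ->
  2 * pairing M0 u v <= 4 * l2_norm u ^ 2 + l2_norm v ^ 2 / 4.
Proof.
  intros Hu Hv; rewrite !(l2_norm_inside M0) by assumption; unfold pairing.
  unfold Rdiv; rewrite (Rmult_comm _ (/ 4)), <- !lsum_scal, <- lsum_plus.
  apply lsum_le; intros x; pose proof (pairing4_le (u x) (v x)); lra.
Qed.

(** Since [U] preserves the pairing and [U g = z0 g], the pairing of [f] with [g] equals that of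
    [(U - z) f / (z0 - z)] with [g].  The latter is small by assumption, so [f] and [g] are almost
    orthogonal; as [f] is a unit vector it is far from [g].  This is where a Jordan block at [z0]
    is excluded. *)
Lemma approximate_eigenvector_far (z z0 : C) (f g : l2) :
  inside f -> inside g -> l2_norm f = 1 -> Cmod z0 = 1 -> z <> z0 ->
  walk Cnp g = l2_scal z0 g ->
  l2_norm (shifted l2_NormedModule (walk Cnp) z f) <= Cmod (Cminus z z0) / 4 ->
  1 / 4 < l2_norm (minus f g).
Proof.
  intros Hf Hg Hf1 Hz0 Hz Hev Hw.
  assert (Hd : Cminus z0 z <> RtoC 0).
  { intros H; apply Hz; replace z with (Cminus z0 (Cminus z0 z)) by ring; rewrite H; ring. }
  set (w := shifted l2_NormedModule (walk Cnp) z f : l2) in *.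
  (* [U (c f) = z (c f) + c w]; this factor makes [z0 (c f) - z (c f)] equal to [z0 f] *)
  set (c := Cdiv z0 (Cminus z0 z)).
  assert (Hwf : forall x j, (walk Cnp f : l2) x j = Cplus (Cmult z (f x j)) (w x j)).
  { intros x j; change (w x j) with (Cplus ((walk Cnp f : l2) x j)
      (Cmult (Copp (RtoC 1)) (Cmult z (f x j)))); ring. }
  assert (Hwi : inside w).
  { intros x j H; pose proof (Hwf x j) as E.
    rewrite (inside_walk f Hf x j H), (Hf x j H) in E.
    replace (w x j) with (Cplus (Cmult z (RtoC 0)) (w x j)) by ring; now rewrite <- E. }
  assert (Hcw : l2_norm (l2_scal c w) <= 1 / 4).
  { eapply Rle_trans; [apply l2_norm_scal | ].
    assert (Hd0 : 0 < Cmod (Cminus z0 z)) by (now apply Cmod_gt_0).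
    replace (Cmod (Cminus z z0)) with (Cmod (Cminus z0 z)) in Hw
      by (rewrite <- Cmod_opp; f_equal; ring).
    unfold c; rewrite Cmod_div, Hz0 by exact Hd.
    apply Rle_trans with (1 / Cmod (Cminus z0 z) * (Cmod (Cminus z0 z) / 4)).
    - apply Rmult_le_compat_l; [left; apply Rdiv_lt_0_compat; lra | exact Hw].
    - right; field; lra. }
  assert (Hpair : pairing M0 f g = pairing M0 (l2_scal c w) (l2_scal z0 g)).
  { pose proof (walk_pairing (l2_scal c f) g (inside_scal c f Hf) Hg) as H.
    rewrite Hev in H.
    assert (E1 : pairing M0 (walk Cnp (l2_scal c f) : l2) (l2_scal z0 g)
      = pairing M0 (l2_scal (Cmult c z) f) (l2_scal z0 g) + pairing M0 (l2_scal c w) (l2_scal z0 g)).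
    { unfold pairing; rewrite <- lsum_plus; apply lsum_ext; intros x.
      rewrite <- pairing4_plus_l; f_equal; apply functional_extensionality; intros j.
      pose proof (f_equal (fun u : l2 => u x j)
        (linear_scal _ (bop_linear _ (walk Cnp)) (c : C_AbsRing) f)) as E.
      simpl in E; etransitivity; [exact E | ].
      change (Cmult c ((walk Cnp f : l2) x j)
        = Cplus (Cmult (Cmult c z) (f x j)) (Cmult c (w x j))).
      rewrite Hwf; ring. }
    assert (E2 : pairing M0 (l2_scal c f) g
      = pairing M0 (l2_scal (Cmult c z) f) (l2_scal z0 g) + pairing M0 f g).
    { transitivity (pairing M0 (l2_scal z0 (l2_scal c f)) (l2_scal z0 g)).
      - unfold pairing; apply lsum_ext; intros x; symmetry.
        etransitivity; [exact (pairing4_scal z0 (l2_scal c f x) (g x)) | ].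
        rewrite Hz0; ring.
      - assert (E3 : pairing M0 f g = pairing M0 (l2_scal z0 f) (l2_scal z0 g)).
        { unfold pairing; apply lsum_ext; intros x; symmetry.
          etransitivity; [exact (pairing4_scal z0 (f x) (g x)) | ]; rewrite Hz0; ring. }
        rewrite E3; unfold pairing; rewrite <- lsum_plus; apply lsum_ext; intros x.
        rewrite <- pairing4_plus_l; f_equal; apply functional_extensionality; intros j.
        change (Cmult z0 (Cmult c (f x j))
          = Cplus (Cmult (Cmult c z) (f x j)) (Cmult z0 (f x j))).
        unfold c; field; exact Hd. }
    lra. }
  pose proof (pairing_le (l2_scal c w) (l2_scal z0 g) (inside_scal c w Hwi) (inside_scal z0 g Hg)) as H1.
  assert (Hng : l2_norm (l2_scal z0 g) = l2_norm g) by (rewrite <- Hev; apply walk_isometry).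
  rewrite Hng, <- Hpair in H1.
  pose proof (inside_scal (Copp (RtoC 1)) g Hg) as Hog.
  pose proof (l2_norm_plus_sq f (l2_scal (Copp (RtoC 1)) g) Hf Hog) as H2.
  change (l2_plus f (l2_scal (Copp (RtoC 1)) g)) with (minus f g : l2) in H2.
  assert (Hp : pairing M0 f (l2_scal (Copp (RtoC 1)) g) = - pairing M0 f g).
  { unfold pairing; rewrite <- (Rmult_1_l (lsum (fun x => pairing4 (f x) (g x)) _)).
    rewrite <- Ropp_mult_distr_l_reverse, <- lsum_scal; apply lsum_ext; intros x.
    unfold pairing4; simpl; unfold field_scal, Re, Im, Cmult; simpl; ring. }
  assert (Hn : l2_norm (l2_scal (Copp (RtoC 1)) g) = l2_norm g)
    by (rewrite l2_norm_scal_eq, Cmod_opp, Cmod_1; ring).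
  rewrite Hp, Hn, Hf1 in H2.
  destruct (Rlt_le_dec (1 / 4) (l2_norm (minus f g))) as [ | Hle]; [easy | exfalso].
  pose proof (l2_norm_ge_0 (minus f g)) as H3; pose proof (l2_norm_ge_0 (l2_scal c w)) as H4.
  assert (l2_norm (minus f g) ^ 2 <= 1 / 16) by nra.
  assert (l2_norm (l2_scal c w) ^ 2 <= 1 / 16) by nra.
  pose proof (pow2_ge_0 (l2_norm g)); lra.
Qed.

(** If no [c] worked, unit vectors [f n] and parameters [z n] tending to [z0] would satisfy
    [(U - z n) f n = o(|z n - z0|)].  By compactness the [f n] come close to a limit [g], which is an
    eigenvector for [z0], contradicting [approximate_eigenvector_far]. *)
Lemma interior_lower_bound (z0 : C) : Cmod z0 = 1 ->
  exists c, 0 < c /\ forall z, Cmod (Cminus z z0) <= c -> forall f : l2, inside f ->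
    c * Cmod (Cminus z z0) * l2_norm f <= l2_norm (shifted l2_NormedModule (walk Cnp) z f).
Proof.
  intros Hz0; apply NNPP; intros Hno.
  assert (Hbad : forall n : nat, exists zf : C * l2,
    let z := fst zf in let f := snd zf in
    Cmod (Cminus z z0) <= / INR (S n) /\ inside f /\ l2_norm f = 1 /\ z <> z0 /\
    l2_norm (shifted l2_NormedModule (walk Cnp) z f) <= / INR (S n) * Cmod (Cminus z z0)).
  { intros n; apply NNPP; intros Hn; apply Hno; exists (/ INR (S n)).
    split; [apply Rinv_0_lt_compat, lt_0_INR; lia | ]; intros z Hz f Hf.
    apply Rnot_lt_le; intros Hlt; apply Hn.
    assert (Hpos : 0 < / INR (S n)) by (apply Rinv_0_lt_compat, lt_0_INR; lia).
    pose proof (l2_norm_ge_0 (shifted l2_NormedModule (walk Cnp) z f)) as H0.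
    pose proof (l2_norm_ge_0 f) as Hf0; pose proof (Cmod_ge_0 (Cminus z z0)) as Hz'.
    assert (Hf1 : 0 < l2_norm f).
    { destruct Hf0 as [ | E]; [easy | rewrite <- E in Hlt; lra]. }
    assert (Hz1 : z <> z0).
    { intros ->; replace (Cminus z0 z0) with (RtoC 0) in Hlt by ring; rewrite Cmod_0 in Hlt; lra. }
    assert (Hr : 0 < / l2_norm f) by now apply Rinv_0_lt_compat.
    set (t := RtoC (/ l2_norm f)).
    assert (Ht : Cmod t = / l2_norm f) by (unfold t; rewrite Cmod_R; now apply Rabs_pos_eq, Rlt_le).
    exists (z, l2_scal t f); simpl; split; [exact Hz | ].
    split; [now apply inside_scal | ].
    split; [rewrite l2_norm_scal_eq, Ht; field; lra | ].
    split; [exact Hz1 | ].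
    assert (E : shifted l2_NormedModule (walk Cnp) z (l2_scal t f)
              = l2_scal t (shifted l2_NormedModule (walk Cnp) z f))
      by apply (linear_scal _ (bop_linear _ (shifted l2_NormedModule (walk Cnp) z)) (t : C_AbsRing) f).
    eapply Rle_trans; [right; exact (f_equal l2_norm E) | ].
    change (l2_norm (l2_scal t (shifted l2_NormedModule (walk Cnp) z f)) <= / INR (S n) * Cmod (Cminus z z0)).
    rewrite l2_norm_scal_eq, Ht.
    apply (Rmult_le_reg_l (l2_norm f)); [exact Hf1 | ].
    rewrite <- Rmult_assoc, Rinv_r, Rmult_1_l by lra; lra. }
  apply choice in Hbad; destruct Hbad as [zf Hzf].
  destruct (inside_cluster_point M0 (fun n => snd (zf n))) as [g [Hg Hcl]].
  { intros n; apply Hzf. }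
  { intros n; right; apply Hzf. }
  assert (Hev : walk Cnp g = l2_scal z0 g).
  { apply (norm_minus_eq_0 (V := l2_NormedModule)), Rle_antisym; [ | apply norm_ge_0].
    apply le_of_all_eps; intros e He.
    destruct (archimed_cor1 (e / 4)) as [N [HN HN0]]; [lra | ].
    destruct (Hcl (e / 4) ltac:(lra) N) as [n [Hn Hfg]].
    destruct (Hzf n) as [H1 [H2 [H3 [_ H4]]]].
    set (f := snd (zf n)) in *; set (z := fst (zf n)) in *.
    assert (Hn' : / INR (S n) <= e / 4).
    { left; eapply Rle_lt_trans; [ | exact HN].
      apply Rinv_le_contravar; [apply lt_0_INR; lia | apply le_INR; lia]. }
    assert (Hn1 : / INR (S n) <= 1).
    { rewrite <- Rinv_1; apply Rinv_le_contravar; [lra | ].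
      rewrite S_INR; pose proof (pos_INR n); lra. }
    assert (Q1 : norm (minus (walk Cnp g) (walk Cnp f) : l2_NormedModule) <= e / 4).
    { rewrite norm_minus_sym.
      replace (minus (walk Cnp f) (walk Cnp g)) with (walk Cnp (minus f g)).
      - change (l2_norm (walk Cnp (minus f g)) <= e / 4); rewrite walk_isometry; lra.
      - unfold minus; rewrite (linear_plus _ (bop_linear _ (walk Cnp))).
        f_equal; apply bop_apply_opp. }
    assert (Q2 : norm (minus (walk Cnp f) (l2_scal z f) : l2_NormedModule) <= e / 4).
    { change (l2_norm (shifted l2_NormedModule (walk Cnp) z f) <= e / 4).
      pose proof (Cmod_ge_0 (Cminus z z0)).
      assert (0 < / INR (S n)) by (apply Rinv_0_lt_compat, lt_0_INR; lia).
      nra. }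
    assert (Q3 : norm (minus (l2_scal z f) (l2_scal z0 f) : l2_NormedModule) <= e / 4).
    { replace (minus (l2_scal z f) (l2_scal z0 f)) with (l2_scal (Cminus z z0) f).
      - eapply Rle_trans; [apply l2_norm_scal | ]; rewrite H3; lra.
      - apply l2_ext; intros x j.
        change (Cmult (Cminus z z0) (f x j)
          = Cplus (Cmult z (f x j)) (Cmult (Copp (RtoC 1)) (Cmult z0 (f x j)))); ring. }
    assert (Q4 : norm (minus (l2_scal z0 f) (l2_scal z0 g) : l2_NormedModule) <= e / 4).
    { eapply Rle_trans; [apply (norm_minus_scal (V := l2_NormedModule) (z0 : C_AbsRing) f g) | ].
      change (Cmod z0 * l2_norm (minus f g) <= e / 4); rewrite Hz0; lra. }
    eapply Rle_trans; [apply (norm_minus_trans _ (walk Cnp f)) | ].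
    eapply Rle_trans; [apply Rplus_le_compat_l, (norm_minus_trans _ (l2_scal z f)) | ].
    eapply Rle_trans;
      [apply Rplus_le_compat_l, Rplus_le_compat_l, (norm_minus_trans _ (l2_scal z0 f)) | ].
    eapply Rle_trans; [apply Rplus_le_compat; [exact Q1 | apply Rplus_le_compat;
      [exact Q2 | apply Rplus_le_compat; [exact Q3 | exact Q4]]] | lra]. }
  destruct (Hcl (1 / 4) ltac:(lra) 3%nat) as [n [Hn Hfg]].
  destruct (Hzf n) as [_ [H2 [H3 [H4 H5]]]].
  assert (H := approximate_eigenvector_far (fst (zf n)) z0 (snd (zf n)) g H2 Hg H3 Hz0 H4 Hev).
  enough (1 / 4 < l2_norm (minus (snd (zf n)) g)) by lra.
  apply H; eapply Rle_trans; [exact H5 | ].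
  rewrite Rmult_comm; apply Rmult_le_compat_l; [apply Cmod_ge_0 | ].
  apply Rinv_le_contravar; [lra | ].
  change 4 with (INR 4) || replace 4 with (INR 4) by (simpl; ring); apply le_INR; lia.
Qed.

Lemma interior_lower_bound_far (z : C) (f : l2) :
  (Cmod z - 1) * l2_norm f <= l2_norm (shifted l2_NormedModule (walk Cnp) z f).
Proof.
  pose proof (norm_le_minus (V := l2_NormedModule) (l2_scal z f) (walk Cnp f)) as H2.
  rewrite norm_minus_sym in H2.
  change (l2_norm (l2_scal z f) <= l2_norm (shifted l2_NormedModule (walk Cnp) z f)
          + l2_norm (walk Cnp f)) in H2.
  rewrite walk_isometry, l2_norm_scal_eq in H2; lra.
Qed.

End InteriorSpectrum.

(** * Resolvent of the dilated walk near the eigenvalue *)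

Lemma le_of_sq_le x y : 0 <= y -> x ^ 2 <= y ^ 2 -> x <= y.
Proof. intros Hy H; nra. Qed.

Lemma Cmod_Ci : Cmod Ci = 1.
Proof.
  unfold Cmod, Ci; simpl.
  replace (0 * (0 * 1) + 1 * (1 * 1)) with 1 by ring; apply sqrt_1.
Qed.

Section BarrierResolvent.
Variable M0 : Z.
Variable Cnp : coin M0.
Hypothesis Hnp : non_penetrable Cnp.
Hypothesis HM0 : (0 < M0)%Z.
Variable theta : C.
Hypothesis Htheta : Im theta < 0.
Notation W := (dil_walk Cnp theta).
Notation q := (exp (Im theta)).
Notation E := (phase_bound M0 theta).

Lemma dil_walk_lower_bound_of_modulus (z : C) (mu : R) (u : l2) :
  0 < mu -> q < 1 -> (1 + q) / 2 <= Cmod z ->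
  mu * l2_norm (undil M0 theta u)
    <= l2_norm (shifted l2_NormedModule (walk Cnp) z (undil M0 theta u)) ->
  l2_norm u <= (E ^ 2 / mu + 2 / (1 - q)) * l2_norm (shifted l2_NormedModule W z u).
Proof.
  intros Hmu Hq Hz H.
  eapply Rle_trans; [apply (dil_walk_lower_bound M0 Cnp Hnp theta HM0 Htheta z mu u Hmu); [lra | exact H] | ].
  apply Rmult_le_compat_r; [apply l2_norm_ge_0 | apply Rplus_le_compat_l].
  replace (2 / (1 - q)) with (/ ((1 - q) / 2)) by (field; lra).
  apply Rinv_le_contravar; lra.
Qed.

(** The lower bound near [z0] gives the size of the resolvent once it exists.  For its existence
    [z] is joined to infinity by a ray that stays at distance [|z - z0| / 2] from [z0] and, once far
    from [z0], outside the unit disc: the lower bounds in these two regions are uniform on it. *)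
Lemma dil_walk_resolvent_near (z0 : C) : Cmod z0 = 1 ->
  exists K d, 0 < K /\ 0 < d <= 1 /\ forall z, z <> z0 -> Cmod (Cminus z z0) <= d ->
    in_resolvent_set W z /\
    bop_norm l2_NormedModule (resolvent W z) <= K / Cmod (Cminus z z0).
Proof.
  intros Hz0.
  assert (Hq : q < 1) by (rewrite <- exp_0; now apply exp_increasing).
  pose proof (exp_pos (Im theta)) as Hq0.
  assert (HE : 0 < E) by apply exp_pos.
  assert (HE2 : 0 < E ^ 2) by (apply pow_lt; exact HE).
  destruct (interior_lower_bound M0 Cnp Hnp z0 Hz0) as [c [Hc Hlow]].
  set (d := Rmin c ((1 - q) / 2)).
  assert (Hd : 0 < d) by (apply Rmin_glb_lt; lra).
  assert (Hdc : d <= c) by apply Rmin_l.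
  assert (Hdq : d <= (1 - q) / 2) by apply Rmin_r.
  assert (Hinside : forall u, supported_inside M0 (undil M0 theta u : l2))
    by (intros u x j H; now apply undil_interior).
  assert (Hq2 : 0 < 2 / (1 - q)) by (apply Rdiv_lt_0_compat; lra).
  assert (Hnear : forall z, z <> z0 -> Cmod (Cminus z z0) <= d -> forall u,
    l2_norm u <= (E ^ 2 / (c * Cmod (Cminus z z0)) + 2 / (1 - q))
                 * l2_norm (shifted l2_NormedModule W z u)).
  { intros z Hz Hzd u; apply dil_walk_lower_bound_of_modulus; try lra.
    - apply Rmult_lt_0_compat; [exact Hc | apply Cmod_gt_0; intros H; apply Hz].
      replace z with (Cplus (Cminus z z0) z0) by ring; rewrite H; ring.
    - pose proof (Cmod_triangle z (Copp (Cminus z z0))) as H; rewrite Cmod_opp in H.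
      replace (Cplus z (Copp (Cminus z z0))) with z0 in H by ring; lra.
    - apply Hlow; [lra | apply Hinside]. }
  assert (Hfar : forall z, 1 < Cmod z -> forall u,
    l2_norm u <= (E ^ 2 / (Cmod z - 1) + 2 / (1 - q))
                 * l2_norm (shifted l2_NormedModule W z u)).
  { intros z Hz u; apply dil_walk_lower_bound_of_modulus; try lra.
    apply interior_lower_bound_far. }
  exists (E ^ 2 / c + 2 / (1 - q)), (d / 4); split; [ | split; [lra | ]].
  { pose proof (Rdiv_lt_0_compat _ _ HE2 Hc); lra. }
  intros z Hz Hzd.
  set (rho := Cmod (Cminus z z0)) in *.
  assert (Hrho : 0 < rho).
  { apply Cmod_gt_0; intros H; apply Hz.
    replace z with (Cplus (Cminus z z0) z0) by ring; rewrite H; ring. }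
  assert (Hz0n : z0 <> RtoC 0) by (intros H; rewrite H, Cmod_0 in Hz0; lra).
  assert (Hres : in_resolvent_set W z).
  { set (om := Cdiv (Cminus z z0) z0).
    assert (Hom : Cmod om = rho)
      by (unfold om; rewrite Cmod_div, Hz0 by exact Hz0n; fold rho; field).
    assert (Hzom : z = Cmult z0 (Cplus (RtoC 1) om)) by (unfold om; field; exact Hz0n).
    (* the ray leaves towards the side of the line through 0 and z0 on which z lies *)
    assert (Hsg : exists sg : R, (sg = 1 \/ sg = -1) /\ 0 <= sg * Im om).
    { destruct (Rle_lt_dec 0 (Im om)); [exists 1 | exists (-1)]; split; auto; lra. }
    destruct Hsg as [sg [Hsg Hsgom]].
    set (v := (1, sg) : C).
    assert (Hsg2 : sg * sg = 1) by (destruct Hsg as [-> | ->]; ring).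
    assert (Hv : Cmod v <= 3 / 2).
    { apply Rsqr_incr_0_var; [ | lra]; unfold Rsqr.
      pose proof (Cmod_sq v) as H; unfold v, Re, Im in H; simpl in H.
      unfold v; nra. }
    assert (Hshift : forall s, Cmod (Cminus (Cplus z (Cmult (RtoC s) (Cmult z0 v))) z0)
                             = Cmod (Cplus om (Cmult (RtoC s) v))).
    { intros s; rewrite Hzom.
      replace (Cminus (Cplus (Cmult z0 (Cplus (RtoC 1) om)) (Cmult (RtoC s) (Cmult z0 v))) z0)
        with (Cmult z0 (Cplus om (Cmult (RtoC s) v))) by ring.
      rewrite Cmod_mult, Hz0; ring. }
    assert (Haway : forall s, 0 <= s -> rho / 2 <= Cmod (Cplus om (Cmult (RtoC s) v))).
    { intros s Hs; apply le_of_sq_le; [apply Cmod_ge_0 | ].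
      replace ((rho / 2) ^ 2) with (rho ^ 2 / 4) by field.
      rewrite <- Hom, !Cmod_sq; unfold v; destruct om as [p r]; unfold Re, Im in *; simpl in *.
      pose proof (pow2_ge_0 (p + 2 * s)); nra. }
    assert (Hout : forall s, 0 <= s ->
      1 + s - rho <= Cmod (Cplus z (Cmult (RtoC s) (Cmult z0 v)))).
    { intros s Hs; rewrite Hzom.
      replace (Cplus (Cmult z0 (Cplus (RtoC 1) om)) (Cmult (RtoC s) (Cmult z0 v)))
        with (Cmult z0 (Cplus (Cplus (RtoC 1) om) (Cmult (RtoC s) v))) by ring.
      rewrite Cmod_mult, Hz0, Rmult_1_l.
      set (y := Cplus (Cplus (RtoC 1) om) (Cmult (RtoC s) v)).
      assert (Hy : fst y = 1 + fst om + s) by (unfold y, v, Cplus, Cmult, RtoC; simpl; ring).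
      pose proof (Rmax_Cmod y) as H1; pose proof (Rmax_l (Rabs (fst y)) (Rabs (snd y))) as H2.
      pose proof (Rle_abs (fst y)) as H3.
      pose proof (Rmax_Cmod om) as H4; pose proof (Rmax_l (Rabs (fst om)) (Rabs (snd om))) as H5.
      pose proof (Rle_abs (- fst om)) as H6; rewrite Rabs_Ropp in H6; lra. }
    set (mu := Rmin (c * (rho / 2)) (d / 4)).
    assert (Hmu : 0 < mu) by (apply Rmin_glb_lt; [apply Rmult_lt_0_compat | ]; lra).
    assert (Hmu1 : mu <= c * (rho / 2)) by apply Rmin_l.
    assert (Hmu2 : mu <= d / 4) by apply Rmin_r.
    set (B := E ^ 2 / mu + 2 / (1 - q)).
    assert (HB : 0 < B) by (pose proof (Rdiv_lt_0_compat _ _ HE2 Hmu); unfold B; lra).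
    assert (Hray : forall s u, 0 <= s ->
      / B * l2_norm u <= l2_norm (shifted l2_NormedModule W
                                   (Cplus z (Cmult (RtoC s) (Cmult z0 v))) u)).
    { intros s u Hs.
      set (zs := Cplus z (Cmult (RtoC s) (Cmult z0 v))) in *.
      assert (Hle : forall m, mu <= m ->
        l2_norm u <= (E ^ 2 / m + 2 / (1 - q)) * l2_norm (shifted l2_NormedModule W zs u) ->
        / B * l2_norm u <= l2_norm (shifted l2_NormedModule W zs u)).
      { intros m Hm H.
        apply (Rmult_le_reg_l B); [exact HB | ].
        rewrite <- Rmult_assoc, Rinv_r, Rmult_1_l by lra.
        eapply Rle_trans; [exact H | ].
        apply Rmult_le_compat_r; [apply l2_norm_ge_0 | ]; unfold B.
        apply Rplus_le_compat_r, Rmult_le_compat_l; [lra | ].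
        now apply Rinv_le_contravar. }
      pose proof (Haway s Hs) as Ha; rewrite <- Hshift in Ha; fold zs in Ha.
      destruct (Rle_lt_dec (Cmod (Cminus zs z0)) d) as [Hn | Hf].
      - apply (Hle (c * Cmod (Cminus zs z0))).
        + eapply Rle_trans; [exact Hmu1 | ]; apply Rmult_le_compat_l; lra.
        + apply Hnear; [ | exact Hn]; intros ->.
          replace (Cminus z0 z0) with (RtoC 0) in Ha by ring; rewrite Cmod_0 in Ha; lra.
      - assert (Hs2 : d / 2 < s).
        { apply Rnot_le_lt; intros Hs'.
          unfold zs in Hf; rewrite Hshift in Hf.
          pose proof (Cmod_triangle om (Cmult (RtoC s) v)) as H.
          rewrite Cmod_mult, Cmod_R, Rabs_pos_eq, Hom in H by exact Hs; nra. }
        pose proof (Hout s Hs) as Ho; fold zs in Ho.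
        apply (Hle (Cmod zs - 1)); [lra | apply Hfar; lra]. }
    set (T := 2 * bop_norm l2_NormedModule W + 1).
    assert (HT : 1 <= T) by (pose proof (bop_norm_ge_0 l2_NormedModule W); unfold T; lra).
    apply (resolvent_set_segment l2_NormedModule l2_banach W
             (Cplus z (Cmult (RtoC T) (Cmult z0 v))) z (/ B)).
    - now apply Rinv_0_lt_compat.
    - intros t u Ht.
      replace (Cplus (Cplus z (Cmult (RtoC T) (Cmult z0 v)))
                (Cmult (RtoC t) (Cminus z (Cplus z (Cmult (RtoC T) (Cmult z0 v))))))
        with (Cplus z (Cmult (RtoC ((1 - t) * T)) (Cmult z0 v)))
        by (rewrite RtoC_mult, RtoC_minus; ring).
      apply Hray; nra.
    - pose proof (Hout T ltac:(lra)) as Ho.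
      apply resolvent_set_large; [exact l2_banach | lra | unfold T in *; lra]. }
  split; [exact Hres | ].
  set (B := E ^ 2 / (c * rho) + 2 / (1 - q)).
  assert (HB : 0 < B).
  { assert (0 < c * rho) by now apply Rmult_lt_0_compat.
    pose proof (Rdiv_lt_0_compat _ _ HE2 H); unfold B; lra. }
  apply Rle_trans with B.
  - rewrite <- (Rinv_inv B); apply resolvent_bound_of_lower_bound;
      [now apply Rinv_0_lt_compat | intros u | exact Hres].
    change (/ B * l2_norm u <= l2_norm (shifted l2_NormedModule W z u)).
    apply (Rmult_le_reg_l B); [exact HB | ].
    rewrite <- Rmult_assoc, Rinv_r, Rmult_1_l by lra.
    apply Hnear; [exact Hz | fold rho; lra].
  - unfold B, Rdiv; rewrite Rmult_plus_distr_r, Rinv_mult, Rmult_assoc.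
    apply Rplus_le_compat_l.
    rewrite <- (Rmult_1_r (2 * / (1 - q))) at 1.
    apply Rmult_le_compat_l; [unfold Rdiv in Hq2; lra | ].
    rewrite <- Rinv_1; apply Rinv_le_contravar; lra.
Qed.

End BarrierResolvent.

Lemma mat_max_entry (A : mat4) j k : Cmod (A j k) <= mat_max A.
Proof.
  unfold mat_max.
  assert (H : forall i, Cmod (A i k) <= Rmax (Rmax (Cmod (A i dleft)) (Cmod (A i dright)))
                                         (Rmax (Cmod (A i ddown)) (Cmod (A i dup)))).
  { intros i; destruct k;
      [eapply Rle_trans; [apply Rmax_l | apply Rmax_l] | eapply Rle_trans; [apply Rmax_r | apply Rmax_l]
      |eapply Rle_trans; [apply Rmax_l | apply Rmax_r] | eapply Rle_trans; [apply Rmax_r | apply Rmax_r]]. }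
  eapply Rle_trans; [apply (H j) | ].
  destruct j;
      [eapply Rle_trans; [apply Rmax_l | apply Rmax_l] | eapply Rle_trans; [apply Rmax_r | apply Rmax_l]
      |eapply Rle_trans; [apply Rmax_l | apply Rmax_r] | eapply Rle_trans; [apply Rmax_r | apply Rmax_r]].
Qed.

(** Coins agree outside the box, so the unbounded weights [T(theta)] only act on their
    difference through the finitely many sites of the box. *)
Lemma dil_walk_dist {M0} (Cn Cn' : coin M0) theta e : 0 <= e -> Im theta <= 0 ->
  (forall x j k, Cmod (Cminus (Cn x j k) (Cn' x j k)) <= e) ->
  bop_norm l2_NormedModule (minus (dil_walk Cn theta) (dil_walk Cn' theta))
    <= 4 * phase_bound M0 theta ^ 2 * e.
Proof.
  intros He Htheta HC.
  set (E := phase_bound M0 theta).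
  assert (HE : 0 < E) by apply exp_pos.
  set (D := fun x j k => Cmult (Cmult (dil_phase theta x j) (Cminus (Cn x j k) (Cn' x j k)))
                               (Cinv (dil_phase theta x k))).
  assert (HD : forall x j k, Cmod (D x j k) <= E ^ 2 * e).
  { intros x j k; unfold D; destruct (classic (in_box M0 x)) as [Hx | Hx].
    - rewrite !Cmod_mult.
      destruct (dil_phase_bound M0 theta x j Hx) as [P _].
      destruct (dil_phase_bound M0 theta x k Hx) as [_ Q].
      replace (E ^ 2 * e) with (E * e * E) by ring.
      repeat apply Rmult_le_compat; auto using Cmod_ge_0, Rmult_le_pos.
    - rewrite (coin_outside Cn x Hx), (coin_outside Cn' x Hx).
      replace (Cminus (mat_id j k) (mat_id j k)) with (RtoC 0) by ring.
      rewrite !Cmod_mult, Cmod_0, Rmult_0_r, Rmult_0_l.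
      apply Rmult_le_pos; [apply pow2_ge_0 | exact He]. }
  assert (HE2 : 0 <= E ^ 2 * e) by (apply Rmult_le_pos; [apply pow2_ge_0 | exact He]).
  set (phi := Cexp (Copp (Cmult Ci theta))).
  assert (Hphi : Cmod phi <= 1).
  { unfold phi; rewrite Cmod_Cexp, <- exp_0; apply exp_le_exp.
    destruct theta as [p r]; simpl in *; lra. }
  apply bop_norm_le; [nra | intros u].
  set (v := l2_lift _ (mul_bounded D _ HD) u : l2).
  assert (Ev : minus (dil_walk Cn theta) (dil_walk Cn' theta) u = l2_scal phi (Defs.shift v)).
  { apply l2_ext; intros x j.
    change (Cplus ((dil_walk Cn theta u : l2) x j)
             (Cmult (Copp (RtoC 1)) ((dil_walk Cn' theta u : l2) x j))
            = Cmult phi (shift_fun (mul_fun D u) x j)).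
    rewrite !dil_walk_apply; unfold phi; rewrite <- dil_shift.
    unfold dil; rewrite shift_fun_pred.
    set (y := pred_site x j); unfold dil_inv, mul_fun, dsum, D.
    field; repeat split; apply dil_phase_neq_0. }
  change (l2_norm (minus (dil_walk Cn theta) (dil_walk Cn' theta) u) <= 4 * E ^ 2 * e * l2_norm u).
  rewrite Ev, l2_norm_scal_eq, shift_isometry.
  apply Rle_trans with (1 * (4 * (E ^ 2 * e) * l2_norm u)); [ | right; ring].
  apply Rmult_le_compat; [apply Cmod_ge_0 | apply l2_norm_ge_0 | exact Hphi | ].
  apply l2_norm_sitewise; [lra | intros x].
  change (v x) with (mul_fun D u x); unfold normsq4 at 1, mul_fun.
  pose proof (Cmod_dsum_sq (D x dleft) (u x) _ HE2 (HD x dleft)).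
  pose proof (Cmod_dsum_sq (D x dright) (u x) _ HE2 (HD x dright)).
  pose proof (Cmod_dsum_sq (D x ddown) (u x) _ HE2 (HD x ddown)).
  pose proof (Cmod_dsum_sq (D x dup) (u x) _ HE2 (HD x dup)).
  replace ((4 * (E ^ 2 * e)) ^ 2) with (16 * (E ^ 2 * e) ^ 2) by ring; lra.
Qed.

Lemma one_minus_cos_bounds r : Rabs r <= 1 / 2 -> r ^ 2 / 4 <= 1 - cos r <= r ^ 2 / 2.
Proof.
  assert (Hpos : forall r, 0 <= r <= 1 / 2 -> r ^ 2 / 4 <= 1 - cos r <= r ^ 2 / 2).
  { clear r; intros r Hr.
    assert (E : 1 - cos r = 2 * sin (r / 2) ^ 2).
    { replace r with (2 * (r / 2)) at 1 by field; rewrite cos_2a_sin; simpl; ring. }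
    assert (HPI : 1 < PI) by (pose proof PI2_1; lra).
    pose proof (sin_bound (r / 2) 0 ltac:(lra) ltac:(lra)) as [H1 H2].
    unfold sin_approx, sin_term in H1, H2; simpl in H1, H2.
    set (y := r / 2) in *; set (sy := sin y) in *.
    assert (Hy : 0 <= y <= 1 / 4) by (unfold y; lra).
    assert (H3 : 3 / 4 * y <= sy) by nra.
    assert (H4 : sy <= y).
    { unfold sy; destruct (Req_dec y 0) as [-> | Hne]; [rewrite sin_0; lra | ].
      left; apply sin_lt_x; lra. }
    rewrite E; fold y sy; replace (r ^ 2) with (4 * y ^ 2) by (unfold y; field); nra. }
  intros Hr; destruct (Rle_lt_dec 0 r) as [H | H].
  - rewrite Rabs_pos_eq in Hr by exact H; apply Hpos; lra.
  - rewrite Rabs_left in Hr by exact H; rewrite <- (cos_neg r).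
    replace (r ^ 2) with ((- r) ^ 2) by ring; apply Hpos; lra.
Qed.

(** With [w = p + i r], the squared modulus is [(e^p - 1)^2 + 2 e^p (1 - cos r)]. *)
Lemma Cexp_minus_1_bounds w : Cmod w <= 1 / 2 ->
  Cmod w / 2 <= Cmod (Cminus (Cexp w) (RtoC 1)) <= 2 * Cmod w.
Proof.
  intros Hw; destruct w as [p r].
  pose proof (Rmax_Cmod (p, r)) as H; simpl in H.
  pose proof (Rmax_l (Rabs p) (Rabs r)) as Hl; pose proof (Rmax_r (Rabs p) (Rabs r)) as Hr'.
  assert (Hp : Rabs p <= 1 / 2) by lra; assert (Hr : Rabs r <= 1 / 2) by lra.
  apply Rabs_le_between in Hp.
  pose proof (one_minus_cos_bounds r Hr) as Hc.
  assert (E1 : Cmod (Cminus (Cexp (p, r)) (RtoC 1)) ^ 2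
             = (exp p - 1) ^ 2 + 2 * exp p * (1 - cos r)).
  { rewrite Cmod_sq; unfold Cexp, Cminus, Cplus, Copp, RtoC, Re, Im; simpl.
    pose proof (sin2_cos2 r) as Hsc; unfold Rsqr in Hsc.
    replace (sin r * sin r) with (1 - cos r * cos r) in Hsc by lra.
    replace ((exp p * sin r + - 0) * ((exp p * sin r + - 0) * 1))
      with (exp p * exp p * (sin r * sin r)) by ring.
    replace (sin r * sin r) with (1 - cos r * cos r)
      by (pose proof (sin2_cos2 r) as Hsc'; unfold Rsqr in Hsc'; lra).
    ring. }
  assert (E2 : Cmod (p, r) ^ 2 = p ^ 2 + r ^ 2) by (rewrite Cmod_sq; reflexivity).
  pose proof (exp_ineq1_le p) as H1; pose proof (exp_ineq1_le (- p)) as H2.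
  rewrite exp_Ropp in H2.
  pose proof (exp_pos p) as H3.
  assert (H4 : exp p * (1 - p) <= 1).
  { apply (Rmult_le_compat_l (exp p)) in H2; [ | lra].
    rewrite Rinv_r in H2 by lra; lra. }
  assert (H5 : exp p <= 2) by nra.
  assert (H6 : p ^ 2 / 4 <= (exp p - 1) ^ 2 <= 4 * p ^ 2).
  { set (y := exp p - 1); assert (Hy : p <= y) by (unfold y; lra).
    assert (Hy2 : y * (1 - p) <= p) by (unfold y; lra).
    destruct (Rle_lt_dec 0 p) as [Hp0 | Hp0].
    - assert (y <= 2 * p) by nra; split; nra.
    - assert (y <= p / 2) by nra; split; nra. }
  pose proof (Cmod_ge_0 (p, r)); pose proof (Cmod_ge_0 (Cminus (Cexp (p, r)) (RtoC 1))).
  split; apply le_of_sq_le; try lra.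
  - replace ((Cmod (p, r) / 2) ^ 2) with (Cmod (p, r) ^ 2 / 4) by field.
    rewrite E1, E2; nra.
  - replace ((2 * Cmod (p, r)) ^ 2) with (4 * Cmod (p, r) ^ 2) by ring.
    rewrite E1, E2; nra.
Qed.

(** The parameter [kappa] of the contour corresponds to the point [e^{-i kappa}] of the spectral
    plane. *)
Definition spectral_point (kappa : C) : C := Cexp (Copp (Cmult Ci kappa)).

Lemma spectral_point_dist kappa kappa0 : Cmod (Cminus kappa kappa0) <= 1 / 2 ->
  Cmod (spectral_point kappa0) * (Cmod (Cminus kappa kappa0) / 2)
    <= Cmod (Cminus (spectral_point kappa) (spectral_point kappa0))
    <= Cmod (spectral_point kappa0) * (2 * Cmod (Cminus kappa kappa0)).
Proof.
  intros H; unfold spectral_point.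
  replace (Cminus (Cexp (Copp (Cmult Ci kappa))) (Cexp (Copp (Cmult Ci kappa0))))
    with (Cmult (Cexp (Copp (Cmult Ci kappa0)))
           (Cminus (Cexp (Copp (Cmult Ci (Cminus kappa kappa0)))) (RtoC 1))).
  - assert (E : Cmod (Copp (Cmult Ci (Cminus kappa kappa0))) = Cmod (Cminus kappa kappa0)).
    { rewrite Cmod_opp, Cmod_mult, Cmod_Ci; ring. }
    rewrite Cmod_mult, <- E in *.
    destruct (Cexp_minus_1_bounds _ H); split; apply Rmult_le_compat_l; auto using Cmod_ge_0.
  - replace (Copp (Cmult Ci kappa))
      with (Cplus (Copp (Cmult Ci kappa0)) (Copp (Cmult Ci (Cminus kappa kappa0)))) by ring.
    rewrite Cexp_plus; ring.
Qed.

Lemma spectral_point_continuous kappa e : 0 < e ->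
  exists d : posreal, forall kappa', ball (M := C_UniformSpace) kappa d kappa' ->
    Cmod (Cminus (spectral_point kappa') (spectral_point kappa)) < e.
Proof.
  intros He; set (m := Cmod (spectral_point kappa)).
  assert (Hm : 0 < m) by (apply Cmod_gt_0, Cexp_neq_0).
  pose proof (@norm_factor_gt_0 _ C_NormedModule) as Hf.
  set (r := Rmin (1 / 2) (e / (4 * m))).
  assert (Hem : 0 < e / (4 * m)) by (apply Rdiv_lt_0_compat; lra).
  assert (Hr : 0 < r) by (apply Rmin_glb_lt; lra).
  assert (Hd : 0 < r / @norm_factor _ C_NormedModule) by now apply Rdiv_lt_0_compat.
  exists (mkposreal _ Hd); intros kappa' Hk.
  assert (Hkk : Cmod (Cminus kappa' kappa) < r).
  { pose proof (norm_compat2 (V := C_NormedModule) kappa kappa' (mkposreal _ Hd) Hk) as H; simpl in H.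
    replace (@norm_factor _ C_NormedModule * (r / @norm_factor _ C_NormedModule)) with r in H
      by (field; lra).
    exact H. }
  pose proof (Rmin_l (1 / 2) (e / (4 * m))) as H1; pose proof (Rmin_r (1 / 2) (e / (4 * m))) as H2.
  fold r in H1, H2.
  destruct (spectral_point_dist kappa' kappa ltac:(lra)) as [_ H3]; fold m in H3.
  eapply Rle_lt_trans; [exact H3 | ].
  apply Rle_lt_trans with (m * (2 * (e / (4 * m)))).
  - apply Rmult_le_compat_l; lra.
  - replace (m * (2 * (e / (4 * m)))) with (e / 2) by (field; lra); lra.
Qed.

Lemma loop_integrand_continuous {M0} (Cn : coin M0) theta kappa :
  in_resolvent_set (dil_walk Cn theta) (spectral_point kappa) ->
  continuous (T := C_UniformSpace) (U := bop_NormedModule l2_NormedModule)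
    (loop_integrand Cn theta) kappa.
Proof.
  intros H.
  apply (continuous_scal (U := C_UniformSpace) (K := C_AbsRing)
           (V := bop_NormedModule l2_NormedModule)
           spectral_point (fun k => resolvent (dil_walk Cn theta) (spectral_point k))).
  - apply filterlim_locally; intros e.
    destruct (spectral_point_continuous kappa e (cond_pos e)) as [d Hd].
    exists d; intros k Hk; exact (Hd k Hk).
  - apply (continuous_comp (U := C_UniformSpace) (V := C_UniformSpace) spectral_point).
    + apply filterlim_locally; intros e.
      destruct (spectral_point_continuous kappa e (cond_pos e)) as [d Hd].
      exists d; intros k Hk; apply (norm_compat1 (V := C_NormedModule)); exact (Hd k Hk).
    + apply resolvent_continuous; [exact l2_banach | exact H].
Qed.

(** * The spectral projections *)

Lemma on_rect_dist x0 h k z : on_rect x0 h k z ->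
  Rmin h k <= Cmod (Cminus z (RtoC x0)) <= h + k.
Proof.
  intros H; destruct z as [x y]; unfold on_rect in H; simpl in H.
  pose proof (Rmax_Cmod (Cminus (x, y) (RtoC x0))) as H1.
  unfold Cminus at 1 2, Cplus, Copp, RtoC in H1; simpl in H1; rewrite Ropp_0, Rplus_0_r in H1.
  change (x + - x0) with (x - x0) in H1; change (x0, 0) with (RtoC x0) in H1.
  assert (H2 : Cmod (Cminus (x, y) (RtoC x0)) <= Rabs (x - x0) + Rabs y).
  { replace (Cminus (x, y) (RtoC x0)) with (Cplus (RtoC (x - x0)) (Cmult Ci (RtoC y)))
      by (unfold Cminus, Cplus, Copp, Cmult, Ci, RtoC; simpl; f_equal; ring).
    eapply Rle_trans; [apply Cmod_triangle | ].
    rewrite Cmod_mult, !Cmod_R, Cmod_Ci; lra. }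
  pose proof (Rmax_l (Rabs (x - x0)) (Rabs y)); pose proof (Rmax_r (Rabs (x - x0)) (Rabs y)).
  pose proof (Rmin_l h k); pose proof (Rmin_r h k).
  destruct H as [[E1 E2] | [E1 E2]]; split; lra.
Qed.

(** The bound [eps <= (eps ^ s) ^ 2] is the only place where [s <= 1 / 2] matters. *)
Lemma Rpower_small s t : 0 < s <= 1 / 2 -> 0 < t ->
  exists eps0, 0 < eps0 <= 1 /\ forall eps, 0 < eps < eps0 ->
    0 < Rpower eps s <= t /\ eps <= Rpower eps s ^ 2.
Proof.
  intros Hs Ht; exists (Rmin 1 (Rpower t (/ s))).
  split; [split; [apply Rmin_glb_lt; [lra | apply exp_pos] | apply Rmin_l] | ].
  intros eps Heps.
  pose proof (Rmin_l 1 (Rpower t (/ s))); pose proof (Rmin_r 1 (Rpower t (/ s))).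
  split; [split; [apply exp_pos | ] | ].
  - rewrite <- (Rpower_1 t) by exact Ht; rewrite <- (Rinv_l s), <- Rpower_mult by lra.
    apply Rle_Rpower_l; lra.
  - replace (Rpower eps s ^ 2) with (Rpower eps (s + s)) by (rewrite Rpower_plus; ring).
    rewrite <- (Rpower_1 eps) at 1 by lra; apply exp_le_exp.
    assert (ln eps < 0) by (rewrite <- ln_1; apply ln_increasing; lra); nra.
Qed.

Theorem theorem5p3 (M0 : Z) (HM0 : (0 < M0)%Z)
  (Cnp : coin M0) (Hnp : non_penetrable Cnp)
  (Ceps : R -> coin M0)
  (Hoff : forall eps, 0 < eps <= 1 -> forall x, ~ barrier M0 x -> Ceps eps x = Cnp x)
  (Hon : forall eps, 0 < eps <= 1 -> forall x, barrier M0 x ->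
           mat_max (mat_sub (Ceps eps x) (Cnp x)) < eps)
  (theta : C) (Htheta : Im theta < 0)
  (mu0 : R) (Hmu0 : eigenvalue (walk Cnp) (Cexp (Copp (Cmult Ci (RtoC mu0)))))
  (a b : R) (Ha : 0 < a) (Hb : 0 < b)
  (s : R) (Hs : 0 < s <= 1 / 2) :
  exists K eps0 : R, 0 < eps0 <= 1 /\
    forall eps : R, 0 < eps < eps0 ->
    let h := a * Rpower eps s in
    let k := b * Rpower eps s in
    (forall mu : C, inside_rect mu0 h k mu ->
       eigenvalue (walk Cnp) (Cexp (Copp (Cmult Ci mu))) ->
       Cexp (Copp (Cmult Ci mu)) = Cexp (Copp (Cmult Ci (RtoC mu0)))) ->
    (forall kappa : C, on_rect mu0 h k kappa ->
       in_resolvent_set (dil_walk (Ceps eps) theta) (Cexp (Copp (Cmult Ci kappa))) /\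
       in_resolvent_set (dil_walk Cnp theta) (Cexp (Copp (Cmult Ci kappa)))) /\
    exists I_eps I_np : bop_NormedModule l2_NormedModule,
      is_rect_int (loop_integrand (Ceps eps) theta) mu0 h k I_eps /\
      is_rect_int (loop_integrand Cnp theta) mu0 h k I_np /\
      norm (minus (scal (RtoC (1 / (2 * PI)) : C_AbsRing) I_eps)
                  (scal (RtoC (1 / (2 * PI)) : C_AbsRing) I_np))
      <= K * Rpower eps s.
Proof.
  set (z0 := spectral_point (RtoC mu0)).
  assert (Hz0 : Cmod z0 = 1).
  { unfold z0, spectral_point; rewrite Cmod_Cexp, <- exp_0; f_equal; simpl; ring. }
  destruct (dil_walk_resolvent_near M0 Cnp Hnp HM0 theta Htheta z0 Hz0)
    as [K0 [d [HK0 [Hd Hnear]]]].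
  set (m := Rmin a b).
  assert (Hm : 0 < m) by (apply Rmin_glb_lt; assumption).
  set (M := 2 * K0 / m).
  assert (HM : 0 < M) by (apply Rdiv_lt_0_compat; lra).
  set (L := 4 * phase_bound M0 theta ^ 2).
  assert (HL : 0 < L) by (apply Rmult_lt_0_compat; [lra | apply pow_lt, exp_pos]).
  (* [r <= t] puts the image of the loop in the disc of radius [d] about [z0] and makes the
     perturbation, of norm [L r ^ 2], at most half the inverse of the resolvent bound [M / r] *)
  set (t := Rmin (d / (2 * (a + b))) (1 / (2 * (L * M)))).
  assert (HLM : 0 < L * M) by now apply Rmult_lt_0_compat.
  assert (Ht : 0 < t) by (apply Rmin_glb_lt; apply Rdiv_lt_0_compat; lra).
  assert (Ht1 : (a + b) * t <= d / 2).
  { replace (d / 2) with ((a + b) * (d / (2 * (a + b)))) by (field; lra).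
    apply Rmult_le_compat_l; [lra | apply Rmin_l]. }
  assert (Ht2 : L * M * t <= 1 / 2).
  { replace (1 / 2) with (L * M * (1 / (2 * (L * M)))) by (field; split; lra).
    apply Rmult_le_compat_l; [lra | apply Rmin_r]. }
  destruct (Rpower_small s t Hs Ht) as [eps0 [Heps0 Hpow]].
  exists (16 * (a + b) * (M ^ 2 * L)), eps0; split; [exact Heps0 | ].
  intros eps Heps h k _.
  destruct (Hpow eps Heps) as [Hr Hepsr]; clear Hpow.
  set (r := Rpower eps s) in *.
  assert (Hh : 0 <= h) by (unfold h; apply Rmult_le_pos; lra).
  assert (Hk : 0 <= k) by (unfold k; apply Rmult_le_pos; lra).
  assert (Hcoin : forall x i j, Cmod (Cminus (Ceps eps x i j) (Cnp x i j)) <= eps).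
  { intros x i j; destruct (classic (barrier M0 x)) as [Hx | Hx].
    - left; eapply Rle_lt_trans; [ | apply (Hon eps ltac:(lra) x Hx)].
      exact (mat_max_entry (mat_sub (Ceps eps x) (Cnp x)) i j).
    - rewrite (Hoff eps ltac:(lra) x Hx).
      replace (Cminus (Cnp x i j) (Cnp x i j)) with (RtoC 0) by ring; rewrite Cmod_0; lra. }
  pose proof (dil_walk_dist (Ceps eps) Cnp theta eps ltac:(lra) ltac:(lra) Hcoin) as HD.
  fold L in HD.
  set (D := bop_norm l2_NormedModule (minus (dil_walk (Ceps eps) theta) (dil_walk Cnp theta))) in HD.
  assert (HDr : D <= L * r ^ 2) by (eapply Rle_trans; [exact HD | apply Rmult_le_compat_l; lra]).
  assert (Hloop : forall kappa, on_rect mu0 h k kappa ->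
    let z := spectral_point kappa in
    in_resolvent_set (dil_walk (Ceps eps) theta) z /\ in_resolvent_set (dil_walk Cnp theta) z /\
    Cmod z <= 2 /\
    bop_norm l2_NormedModule (minus (resolvent (dil_walk (Ceps eps) theta) z)
                                    (resolvent (dil_walk Cnp theta) z)) <= 2 * (M ^ 2 * L)).
  { intros kappa Hkappa z.
    destruct (on_rect_dist _ _ _ _ Hkappa) as [Hlo Hhi].
    assert (Hlo' : m * r <= Cmod (Cminus kappa (RtoC mu0))).
    { eapply Rle_trans; [ | exact Hlo]; apply Rmin_glb; apply Rmult_le_compat_r; try lra;
        [apply Rmin_l | apply Rmin_r]. }
    assert (Hhi' : Cmod (Cminus kappa (RtoC mu0)) <= d / 2).
    { eapply Rle_trans; [exact Hhi | ]; unfold h, k; rewrite <- Rmult_plus_distr_r.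
      eapply Rle_trans; [ | exact Ht1]; apply Rmult_le_compat_l; lra. }
    destruct (spectral_point_dist kappa (RtoC mu0) ltac:(lra)) as [Hz1 Hz2].
    fold z0 z in Hz1, Hz2; rewrite Hz0, Rmult_1_l in Hz1, Hz2.
    assert (Hmr : 0 < m * r) by (apply Rmult_lt_0_compat; lra).
    destruct (Hnear z) as [Hin Hbd]; [ | lra | ].
    { intros H; rewrite H in Hz1; replace (Cminus z0 z0) with (RtoC 0) in Hz1 by ring.
      rewrite Cmod_0 in Hz1; lra. }
    assert (Hbd' : bop_norm l2_NormedModule (resolvent (dil_walk Cnp theta) z) <= M / r).
    { eapply Rle_trans; [exact Hbd | ].
      replace (M / r) with (K0 / (m * r / 2)) by (unfold M; field; split; lra).
      apply Rmult_le_compat_l; [lra | apply Rinv_le_contravar; lra]. }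
    destruct (resolvent_perturb l2_NormedModule l2_banach (dil_walk Cnp theta)
      (dil_walk (Ceps eps) theta) z z (M / r) Hin Hbd') as [H1 [_ H2]].
    - fold D; replace (Cminus z z) with (RtoC 0) by ring; rewrite Cmod_0, Rplus_0_r.
      apply Rle_trans with (L * r ^ 2 * (M / r)).
      + apply Rmult_le_compat_r; [left; apply Rdiv_lt_0_compat; lra | exact HDr].
      + replace (L * r ^ 2 * (M / r)) with (L * M * r) by (field; lra).
        eapply Rle_trans; [ | exact Ht2]; apply Rmult_le_compat_l; lra.
    - split; [exact H1 | split; [exact Hin | split]].
      + pose proof (Cmod_triangle (Cminus z z0) z0) as H3.
        replace (Cplus (Cminus z z0) z0) with z in H3 by ring; lra.
      + eapply Rle_trans; [exact H2 | ].
        fold D; replace (Cminus z z) with (RtoC 0) by ring; rewrite Cmod_0, Rplus_0_r.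
        replace (2 * (M ^ 2 * L)) with (2 * (M / r) ^ 2 * (L * r ^ 2)) by (field; lra).
        apply Rmult_le_compat_l; [ | exact HDr].
        pose proof (pow2_ge_0 (M / r)); lra. }
  split; [intros kappa Hkappa; destruct (Hloop kappa Hkappa) as [H1 [H2 _]]; now split | ].
  pose proof (bop_banach _ l2_banach) as Hban.
  destruct (rect_int_exists (bop_NormedModule l2_NormedModule) (loop_integrand (Ceps eps) theta)
    mu0 h k Hban Hh Hk) as [I1 HI1].
  { intros z Hz; apply loop_integrand_continuous, (Hloop z Hz). }
  destruct (rect_int_exists (bop_NormedModule l2_NormedModule) (loop_integrand Cnp theta)
    mu0 h k Hban Hh Hk) as [I2 HI2].
  { intros z Hz; apply loop_integrand_continuous, (Hloop z Hz). }
  exists I1, I2; split; [exact HI1 | split; [exact HI2 | ]].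
  assert (HI : norm (minus I1 I2) <= 4 * (h + k) * (4 * (M ^ 2 * L))).
  { apply (rect_int_dist_le _ _ _ mu0 h k I1 I2 _ Hh Hk HI1 HI2).
    intros kappa Hkappa; destruct (Hloop kappa Hkappa) as [_ [_ [H1 H2]]].
    eapply Rle_trans; [apply (norm_minus_scal (V := bop_NormedModule l2_NormedModule)
      (spectral_point kappa : C_AbsRing)) | ].
    replace (4 * (M ^ 2 * L)) with (2 * (2 * (M ^ 2 * L))) by ring.
    apply Rmult_le_compat; [apply Cmod_ge_0 | apply bop_norm_ge_0 | exact H1 | exact H2]. }
  eapply Rle_trans; [apply norm_minus_scal | ].
  change (Cmod (RtoC (1 / (2 * PI))) * norm (minus I1 I2) <= 16 * (a + b) * (M ^ 2 * L) * r).
  assert (HPI : 0 < 1 / (2 * PI) <= 1).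
  { pose proof PI2_1; split; [apply Rdiv_lt_0_compat; lra | ].
    unfold Rdiv; rewrite Rmult_1_l, <- Rinv_1; apply Rinv_le_contravar; lra. }
  rewrite Cmod_R, Rabs_pos_eq by lra.
  replace (16 * (a + b) * (M ^ 2 * L) * r) with (1 * (4 * (h + k) * (4 * (M ^ 2 * L))))
    by (unfold h, k; ring).
  apply Rmult_le_compat; [lra | apply norm_ge_0 | lra | exact HI].
Qed.
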